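(* The map $T:G_c[[r]]\to G(X)$, $T(f)=[a(f)]$, is a continuous embedding such that $\widehat P\circ T=\mathrm{id}$. Moreover, the map $\widetilde T:G_c[[r]]\times\widehat{\mathcal{C}}\to G(X)$ defined by $\widetilde T(f,g):=T(f)\cdot g$ is a homeomorphism.
   Context: Functions on the circle $S^1$ are identified with $2\pi$-periodic functions on $\mathbb{R}$. $X$ is the complex vector space of sequences $a=(a_1,a_2,\dots)$ with $a_i\in L^\infty(S^1)$ (complex-valued) for which there is $l>0$ (depending on $a$) with $\sup_{x\in S^1}|a_i(x)|\le l^i$ for all $i\ge1$ (sup understood as the $L^\infty$-norm). For $a,b\in X$: $a*b=(a_1*b_1,a_2*b_2,\dots)\in X$ and $a^{-1}=(a_1^{-1},a_2^{-1},\dots)\in X$, where $(a_i*b_i)(t)=2a_i(2t)$ for $0<t\le\pi$, $(a_i*b_i)(t)=2b_i(2t-2\pi)$ for $\pi<t\le2\pi$, and $a_i^{-1}(t)=-a_i(2\pi-t)$ for $0<t\le2\pi$ (extended $2\pi$-periodically). Basic iterated integrals on $X$: $I_{i_1,\dots,i_k}(a)=\int\cdots\int_{0\le s_1\le\cdots\le s_k\le2\pi}a_{i_k}(s_k)\cdots a_{i_1}(s_1)\,ds_k\cdots ds_1$. $\mathcal{U}\subset X$ is the set of $a$ at which all $I_{i_1,\dots,i_k}$ with $k\ge1$ vanish. The relation $a\sim b$ iff $a*b^{-1}\in\mathcal{U}$ is an equivalence relation; $G(X)$ is the set of classes $[a]$, a group under $[a]\cdot[b]=[a*b]$ with unit $[0]$.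 Each $I_{i_1,\dots,i_k}$ is constant on classes and gives a function $\widehat I_{i_1,\dots,i_k}$ on $G(X)$; $G(X)$ carries the weakest topology $\tau$ making all of these continuous. For $a\in X$ and sufficiently small $r$ let $v(x;r;a)$, $x\in[0,2\pi]$, be the unique Lipschitz function satisfying $\frac{dv}{dx}=\sum_{i\ge1}a_i(x)v^{i+1}$ almost everywhere and $v(0;r;a)=r$. The first return map $P(a)(r):=v(2\pi;r;a)$ depends only on $[a]$; put $\widehat P([a]):=P(a)$. $G_c[[r]]$ is the set of complex power series $f(r)=r+\sum_{k\ge1}d_kr^{k+1}$, each convergent near $0\in\mathbb{C}$, a group under composition, with the weakest topology $\tau'$ in which all coefficient functions $d_k$ are continuous. $\widehat{\mathcal{C}}=\{g\in G(X):\widehat P(g)(r)\equiv r\}$ is the kernel of $\widehat P$, with the topology induced by $\tau$. For $f(r)=r+\sum_{k\ge1}d_kr^{k+1}\in G_c[[r]]$ the element $a(f)=(a_1,a_2,\dots)\in X$ is defined by the identity of formal power series in $t$ $$\sum_{i=1}^\infty a_i(x)t^{i+1}=\frac{\sum_{k=1}^\infty(d_k/2\pi)t^{k+1}}{1+\sum_{k=1}^\infty(k+1)d_k(1-x/2\pi)t^k},\quad x\in(0,2\pi],$$ extended by periodicity. *)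

(* Defs.v *)
(* Sequences and power series that the mathematics indexes from 1 are indexed
   from 0 here:  a i  stands for  a_{i+1}, and  f k  for  d_{k+1}(f). *)
From HB Require Import structures.
From mathcomp Require Import all_boot all_order all_algebra.
From mathcomp Require Import complex.
From mathcomp Require Import all_classical all_reals all_analysis.
From mathcomp Require Import measurable_realfun ess_sup_inf.
From mathcomp Require Import ring lra.

Set Implicit Arguments.
Unset Strict Implicit.
Unset Printing Implicit Defensive.

Import Order.TTheory GRing.Theory Num.Theory.
Import numFieldNormedType.Exports.

Local Open Scope classical_set_scope.
Local Open Scope complex_scope.
Local Open Scope ring_scope.

(* The topology of R[i] given by its modulus. *)
HB.instance Definition _ (R : realType) := NormedModule.copy R[i] R[i]^o.

Definition homeomorphism (S T : topologicalType) (f : S -> T) : Prop :=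
  exists g : T -> S,
    [/\ cancel f g, cancel g f, continuous f & continuous g].

Definition embedding (S T : topologicalType) (f : S -> T) : Prop :=
  [/\ injective f, continuous f &
      forall U : set S, open U ->
        exists2 V : set T, open V & f @` U = V `&` range f].

Section complex_functions.
Context {R : realType}.
Implicit Types (f : R -> R[i]).

Definition cmod (z : R[i]) : R := Normc.normc z.

Definition cmeasurable f : Prop :=
  measurable_fun [set: R] (fun x => complex.Re (f x)) /\
  measurable_fun [set: R] (fun x => complex.Im (f x)).

Definition cintegral (D : set R) f : R[i] :=
  (\int[lebesgue_measure]_(x in D) complex.Re (f x)) +i*
  (\int[lebesgue_measure]_(x in D) complex.Im (f x)).

Definition is_cderive (x : R) f (s : R[i]) : Prop :=
  is_derive x 1 (fun y => complex.Re (f y)) (complex.Re s) /\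
  is_derive x 1 (fun y => complex.Im (f y)) (complex.Im s).

(* The representative of t modulo 2 pi in ]0, 2 pi]. *)
Definition red (t : R) : R := t - (Num.ceil (t / (2 * pi)) - 1)%:~R * (2 * pi).

(* The 2 pi-periodic extension of the restriction of f to ]0, 2 pi]. *)
Definition perext f : R -> R[i] := fun t => f (red t).

Lemma red_itv t : 0 < red t <= 2 * pi.
Proof.
have p0 : 0 < 2 * pi :> R by rewrite mulr_gt0// pi_gt0.
have /andP[h1 h2] := ceil_itv (t / (2 * pi)).
move: h1 h2; rewrite ltr_pdivlMr// ler_pdivrMr// /red !intrB => h1 h2.
by apply/andP; split; lra.
Qed.

Lemma periodicz f (T : R) (k : int) t :
  periodic f T -> f (t + k%:~R * T) = f t.
Proof.
move=> fT; have fTn (n : nat) u : f (u + n%:R * T) = f u.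
  by rewrite mulr_natl; apply: periodicn.
case: k => n; first exact: fTn.
by rewrite NegzE intrN mulNr -[LHS](fTn n.+1) subrK.
Qed.

Lemma red_ext f t : periodic f (2 * pi) -> f (red t) = f t.
Proof. by move=> fp; rewrite /red -mulNr -intrN periodicz. Qed.

Lemma redD t : red (t + 2 * pi) = red t.
Proof.
have p0 : 2 * pi != 0 :> R by rewrite mulf_neq0// gt_eqF// pi_gt0.
rewrite /red; set T := 2 * pi in p0 *.
rewrite [(t + T) / T]mulrDl divff// ceilDrz// ceil1 !intrD intrN.
ring.
Qed.

Lemma periodic_perext f : periodic (perext f) (2 * pi).
Proof. by move=> t; rewrite /perext redD. Qed.

Lemma measurable_red : measurable_fun [set: R] red.
Proof.
apply: measurable_funB => //; apply: measurable_funM => //.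
apply: nondecreasing_measurable => // x y xy.
rewrite ler_int lerD2r le_ceil// ler_pM2r// invr_gt0 mulr_gt0//.
exact: pi_gt0.
Qed.

Lemma cmeasurableM f g : cmeasurable f -> cmeasurable g ->
  cmeasurable (fun x => f x * g x).
Proof.
move=> [rf jf] [rg jg]; split.
  rewrite (_ : (fun x => _) = (fun x => complex.Re (f x) * complex.Re (g x) -
     complex.Im (f x) * complex.Im (g x))); last first.
    by apply/funext => x; case: (f x) (g x) => [a b] [c d].
  by apply: measurable_funB; apply: measurable_funM.
rewrite (_ : (fun x => _) = (fun x => complex.Re (f x) * complex.Im (g x) +
     complex.Im (f x) * complex.Re (g x))); last first.
  by apply/funext => x; case: (f x) (g x) => [a b] [c d].
by apply: measurable_funD; apply: measurable_funM.
Qed.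

Lemma cmeasurableD f g : cmeasurable f -> cmeasurable g ->
  cmeasurable (fun x => f x + g x).
Proof.
move=> [rf jf] [rg jg]; split.
  rewrite (_ : (fun x => _) = (fun x => complex.Re (f x) + complex.Re (g x))).
    exact: measurable_funD.
  by apply/funext => x; case: (f x) (g x) => [a b] [c d].
rewrite (_ : (fun x => _) = (fun x => complex.Im (f x) + complex.Im (g x))).
  exact: measurable_funD.
by apply/funext => x; case: (f x) (g x) => [a b] [c d].
Qed.

Lemma cmeasurable_real (g : R -> R) : measurable_fun [set: R] g ->
  cmeasurable (fun x => (g x)%:C).
Proof. by move=> mg; split. Qed.

Lemma cmeasurable_cst c : cmeasurable (fun=> c).
Proof. by split. Qed.

Lemma cmeasurable_comp f (g : R -> R) : measurable_fun [set: R] g ->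
  cmeasurable f -> cmeasurable (fun x => f (g x)).
Proof.
by move=> mg [rf jf]; split; [apply: (measurableT_comp rf)|apply: (measurableT_comp jf)].
Qed.

Lemma cmeasurableN f : cmeasurable f -> cmeasurable (fun x => - f x).
Proof.
move=> mf; rewrite (_ : (fun x => _) = (fun x => (-1) * f x)).
  by apply: cmeasurableM => //; exact: cmeasurable_cst.
by apply/funext => x; rewrite mulN1r.
Qed.

Lemma cmeasurable_sum n (F : nat -> R -> R[i]) :
  (forall j, (j < n)%N -> cmeasurable (F j)) ->
  cmeasurable (fun x => \sum_(j < n) F j x).
Proof.
elim: n => [|n IH] Fn.
  by under eq_fun do rewrite big_ord0; exact: cmeasurable_cst.
under eq_fun do rewrite big_ord_recr/=; apply: cmeasurableD; last exact: Fn.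
by apply: IH => j jn; apply: Fn; rewrite (ltn_trans jn).
Qed.

Lemma cmeasurable_if (b : R -> bool) f g : measurable_fun [set: R] b ->
  cmeasurable f -> cmeasurable g -> cmeasurable (fun x => if b x then f x else g x).
Proof.
move=> mb [rf jf] [rg jg]; split.
  under eq_fun do rewrite (fun_if (@complex.Re R)); exact: measurable_fun_ifT.
under eq_fun do rewrite (fun_if (@complex.Im R)); exact: measurable_fun_ifT.
Qed.

Lemma cmodE z : `|z| = (cmod z)%:C. Proof. by []. Qed.

Lemma cmodM z w : cmod (z * w) = cmod z * cmod w.
Proof. exact: Normc.normcM. Qed.

Lemma cmod_nat n : cmod n%:R = n%:R.
Proof.
by apply: (@complexI R); rewrite -cmodE normr_nat raddfMn/=.
Qed.


Lemma lebesgue_null_comp (g : R -> R) (c : R) (P : R -> Prop) :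
  0 < c -> measurable_fun [set: R] g ->
  (forall a b, a < b -> (c%:E * lebesgue_measure (g @^-1` `]a, b]) =
     (b - a)%:E)%E) ->
  {ae lebesgue_measure, forall x, P x} ->
  {ae lebesgue_measure, forall x, P (g x)}.
Proof.
move=> c0 mg gl [N [mN N0 PN]].
exists (g @^-1` N); split; last first.
- by move=> x /= Px; apply: PN.
- pose c' : {nonneg R} := NngNum (ltW c0).
  pose pu : {measure set (measurableTypeR R) -> \bar R} :=
    measure_function_pushforward__canonical__measure_function_Measure
      (@lebesgue_measure R)
      (mg : @measurable_fun _ _ (measurableTypeR R) (measurableTypeR R) setT g).
  have /lebesgue_measure_unique/(_ N mN) : forall X, ocitv X -> lebesgue_measure X = mscale c' pu X.
    move=> X /ocitvP[->|[[a b]/= ab ->]]; first by rewrite !measure0.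
    rewrite lebesgue_measure_itv/= lte_fin ab -EFinB -gl//.
  by rewrite N0 => /esym/eqP; rewrite mule_eq0 eqe gt_eqF//= => /eqP.
- by rewrite -[_ @^-1` _]setTI; exact: mg.
Qed.

Lemma ae_double (P : R -> Prop) : {ae lebesgue_measure, forall x, P x} ->
  {ae lebesgue_measure, forall x, P (2 * x)}.
Proof.
apply: (@lebesgue_null_comp _ 2) => // a b ab.
rewrite (_ : _ @^-1` _ = [set` `]a / 2, b / 2]]).
  rewrite lebesgue_measure_itv/= lte_fin ltr_pM2r ?invr_gt0// ab -EFinB -EFinM.
  by congr EFin; lra.
by apply/seteqP; split => x /=; rewrite !in_itv/= => /andP[? ?];
  apply/andP; split; lra.
Qed.

Lemma ae_opp (P : R -> Prop) : {ae lebesgue_measure, forall x, P x} ->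
  {ae lebesgue_measure, forall x, P (- x)}.
Proof.
apply: (@lebesgue_null_comp _ 1) => // a b ab.
rewrite (_ : _ @^-1` _ = [set` `[- b, - a[]).
  rewrite lebesgue_measure_itv/= lte_fin ltrN2 ab -EFinB mul1e.
  by congr EFin; lra.
by apply/seteqP; split => x /=; rewrite !in_itv/= => /andP[? ?];
  apply/andP; split; lra.
Qed.

End complex_functions.

(* The coefficients are representatives of elements of L^oo(S^1); representatives
   that agree almost everywhere have the same iterated integrals, hence give the
   same element of G(X).  Periodicity makes the essential supremum over R the
   one over the circle. *)
Record X (R : realType) := MkX {
  coef :> nat -> R -> R[i];
  coef_periodic : forall i, periodic (coef i) (2 * pi);
  coef_measurable : forall i, cmeasurable (coef i);
  coef_bounded : exists2 l : R, 0 < l & forall i,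
    (ess_sup lebesgue_measure (fun x => (cmod (coef i x))%:E)
       <= (l ^+ i.+1)%:E)%E }.

Section operations.
Context {R : realType}.
Implicit Types (a b : X R) (i : nat) (t : R).

Definition cat_fun a b i : R -> R[i] := perext (fun t =>
  if t <= pi then 2 * a i (2 * t) else 2 * b i (2 * t - 2 * pi)).

Definition inv_fun a i : R -> R[i] := perext (fun t => - a i (2 * pi - t)).

Lemma cat_funE a b i t :
  cat_fun a b i t = if red t <= pi then 2 * a i (2 * t) else 2 * b i (2 * t).
Proof.
have H (c : X R) : c i (2 * red t) = c i (2 * t).
  rewrite -(periodicz (- (2 * (Num.ceil (t / (2 * pi)) - 1))) (2 * t)
    (@coef_periodic _ c i)) /red; congr (c i _).
  by rewrite intrN intrM; ring.
rewrite /cat_fun /perext -{1}H; case: ifP => // _.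
by rewrite -H -[in RHS](subrK (2 * pi) (2 * red t)) coef_periodic.
Qed.

Lemma inv_funE a i t : inv_fun a i t = - a i (- t).
Proof.
rewrite /inv_fun /perext; congr (- _).
rewrite addrC coef_periodic /red opprB addrC.
by rewrite (periodicz _ _ (@coef_periodic _ a i)).
Qed.

Lemma cat_periodic a b i : periodic (cat_fun a b i) (2 * pi).
Proof. exact: periodic_perext. Qed.

Lemma cat_measurable a b i : cmeasurable (cat_fun a b i).
Proof.
rewrite (funext (cat_funE a b i)); apply: cmeasurable_if.
- by apply: measurable_fun_ler => //; exact: measurable_red.
- apply: cmeasurableM; first exact: cmeasurable_cst.
  by apply: cmeasurable_comp (coef_measurable _ _); exact: measurable_funM.
- apply: cmeasurableM; first exact: cmeasurable_cst.
  by apply: cmeasurable_comp (coef_measurable _ _); exact: measurable_funM.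
Qed.

Lemma cat_bounded a b : exists2 l : R, 0 < l & forall i,
  (ess_sup lebesgue_measure (fun x => (cmod (cat_fun a b i x))%:E)
     <= (l ^+ i.+1)%:E)%E.
Proof.
have [l l0 al] := coef_bounded a.
have [m m0 bm] := coef_bounded b.
exists (2 * (l + m)); first by rewrite mulr_gt0// addr_gt0.
move=> i; apply/ess_supP.
have /ess_supP/ae_double A := al i; have /ess_supP/ae_double B := bm i.
have pw (x y : R) : 0 < x -> 0 < y -> 2 * x ^+ i.+1 <= (2 * (x + y)) ^+ i.+1.
  move=> x0 y0; rewrite exprMn; apply: ler_pM => //.
  - by rewrite exprn_ge0// ltW.
  - by rewrite exprS ler_pMr// exprn_ege1// ler1n.
  - by rewrite lerXn2r ?nnegrE ?addr_ge0 ?ltW// ltrDl.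
apply: filterS2 A B; first exact: (ae_filter_ringOfSetsType lebesgue_measure).
move=> x; rewrite !lee_fin => Ax Bx.
rewrite cat_funE; case: ifP => _; rewrite cmodM cmod_nat.
  by rewrite (le_trans _ (pw l m l0 m0))// ler_pM2l.
by rewrite addrC (le_trans _ (pw m l m0 l0))// ler_pM2l.
Qed.

Lemma inv_periodic a i : periodic (inv_fun a i) (2 * pi).
Proof. exact: periodic_perext. Qed.

Lemma inv_measurable a i : cmeasurable (inv_fun a i).
Proof.
rewrite (funext (inv_funE a i)); apply: cmeasurableN.
by apply: cmeasurable_comp (coef_measurable _ _); exact: measurable_funN.
Qed.

Lemma inv_bounded a : exists2 l : R, 0 < l & forall i,
  (ess_sup lebesgue_measure (fun x => (cmod (inv_fun a i x))%:E)
     <= (l ^+ i.+1)%:E)%E.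
Proof.
have [l l0 al] := coef_bounded a.
exists l => // i; apply/ess_supP; have /ess_supP/ae_opp A := al i.
apply: filterS A; first exact: (ae_filter_ringOfSetsType lebesgue_measure).
move=> x; rewrite !lee_fin; apply: le_trans.
by rewrite inv_funE /cmod normcN.
Qed.

Definition catX a b : X R :=
  MkX (cat_periodic a b) (cat_measurable a b) (cat_bounded a b).

Definition invX a : X R :=
  MkX (inv_periodic a) (inv_measurable a) (inv_bounded a).

End operations.

Section iterated_integrals.
Context {R : realType}.
Implicit Types a b : X R.

(* iterint a s [:: i_1; ...; i_k] is
     int_s^{2 pi} a_{i_1}(s_1) int_{s_1}^{2 pi} ... a_{i_k}(s_k) ds_k ... ds_1,
   the iterated integral over s <= s_1 <= ... <= s_k <= 2 pi. *)
Fixpoint iterint a (s : R) (w : seq nat) : R[i] :=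
  if w is i :: w' then
    cintegral `[s, 2 * pi] (fun x => a i x * iterint a x w')
  else 1.

Definition word := {w : seq nat | w != [::]}.

Definition basic_integral (w : word) a : R[i] := iterint a 0 (val w).

Definition calU : set (X R) := [set a | forall w, basic_integral w a = 0].

Definition eqvX a b : Prop := calU (catX a (invX b)).

Definition eqv_class a : set (X R) := [set b | eqvX a b].

End iterated_integrals.

(* The set of classes for eqvX.  As the product, the iterated integrals and the
   first return map do not depend on the choice of representatives, they are
   defined on G(X) through a chosen one (reprX). *)
Definition GX (R : realType) := {S : set (X R) | exists a, S = eqv_class a}.

HB.instance Definition _ (R : realType) := gen_eqMixin (GX R).
HB.instance Definition _ (R : realType) := gen_choiceMixin (GX R).

Section GX_operations.
Context {R : realType}.

Definition classX (a : X R) : GX R :=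
  exist _ (eqv_class a) (ex_intro _ a erefl).

Definition reprX (g : GX R) : X R := sval (cid (svalP g)).

Lemma reprXK : cancel reprX classX.
Proof.
move=> g; have := svalP (cid (svalP g)); rewrite -/(reprX g) => gE.
case: g gE => S hS /= gE; rewrite /classX.
move: (ex_intro _ _ _); rewrite -gE => p.
by congr exist; exact: Prop_irrelevance.
Qed.

Definition mulG (g h : GX R) : GX R := classX (catX (reprX g) (reprX h)).

Definition hat_integral (w : word) (g : GX R) : R[i] :=
  basic_integral w (reprX g).

End GX_operations.

HB.instance Definition _ (R : realType) := Topological.copy (GX R)
  (sup_topology (fun w : word =>
     Topological.class (initial_topology (@hat_integral R w)))).

(* The series r + \sum_(k >= 1) d_k r^(k+1), with dcoef k = d_{k+1}. *)
Record Gc (R : realType) := MkGc {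
  dcoef :> nat -> R[i];
  dcoef_cvg : \forall r \near (0 : R[i]),
    cvgn (series (fun k => dcoef k * r ^+ k.+2)) }.

HB.instance Definition _ (R : realType) := gen_eqMixin (Gc R).
HB.instance Definition _ (R : realType) := gen_choiceMixin (Gc R).

HB.instance Definition _ (R : realType) := Topological.copy (Gc R)
  (sup_topology (fun k : nat =>
     Topological.class (initial_topology (fun f : Gc R => dcoef f k)))).

Section first_return_map.
Context {R : realType}.

Definition Gc_eval (f : Gc R) (r : R[i]) : R[i] :=
  r + limn (series (fun k => f k * r ^+ k.+2)).

Lemma Gc_id_subproof : \forall r \near (0 : R[i]),
  cvgn (series (fun k => (0 : R[i]) * r ^+ k.+2)).
Proof.
apply: (@filterE _ (nbhs (0 : R[i]))) => r; under eq_fun do rewrite mul0r.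
rewrite (_ : series _ = fun=> 0); first exact: is_cvg_cst.
by apply/funext => n; rewrite /series/= big1.
Qed.

Definition Gc_id : Gc R := MkGc Gc_id_subproof.

(* v is Lipschitz on [0, 2 pi] and solves the initial value problem; the values
   of v outside [0, 2 pi] are irrelevant. *)
Definition is_flow (a : X R) (r : R[i]) (v : R -> R[i]) : Prop :=
  [/\ v 0 = r,
      exists K : R, forall x y, x \in `[0, 2 * pi] -> y \in `[0, 2 * pi] ->
        cmod (v x - v y) <= K * `|x - y| &
      {ae lebesgue_measure, forall x, x \in `]0, 2 * pi[ ->
        exists2 s : R[i], is_cderive x v s &
          series (fun i => a i x * v x ^+ i.+2) @ \oo --> s}].

Definition flow (a : X R) (r : R[i]) : R -> R[i] :=
  xget (fun=> 0) (is_flow a r).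

Definition first_return (a : X R) (r : R[i]) : R[i] := flow a r (2 * pi).

(* The first return map is compared with the sum of the series as a germ at 0;
   for large r the value of flow is arbitrary. *)
Definition hatP (g : GX R) : Gc R := xget Gc_id
  [set f | \forall r \near (0 : R[i]), first_return (reprX g) r = Gc_eval f r].

Definition hatC : set (GX R) := [set g | hatP g = Gc_id].

End first_return_map.

(* fquo N D is the sequence of coefficients of the formal power series
   (\sum_k N_k t^k) / (\sum_k D_k t^k), for D_0 = 1; see fquoP. *)
Section formal_quotient.
Context {K : comNzRingType}.
Implicit Types N D : nat -> K.

Fixpoint fquo_seq N D n : seq K :=
  if n is m.+1 then
    let s := fquo_seq N D m in
    rcons s (N m - \sum_(j < m) s`_j * D (m - j)%N)
  else [::].

Definition fquo N D n : K := (fquo_seq N D n.+1)`_n.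

Lemma size_fquo_seq N D n : size (fquo_seq N D n) = n.
Proof. by elim: n => //= n IH; rewrite size_rcons IH. Qed.

Lemma nth_fquo_seq N D n j : (j < n)%N -> (fquo_seq N D n)`_j = fquo N D j.
Proof.
elim: n => // n IH; rewrite ltnS leq_eqVlt => /predU1P[->//|jn].
by rewrite /= nth_rcons size_fquo_seq jn IH.
Qed.

Lemma fquoE N D n :
  fquo N D n = N n - \sum_(j < n) fquo N D j * D (n - j)%N.
Proof.
rewrite /fquo/= nth_rcons size_fquo_seq ltnn eqxx; congr (_ - _).
by apply: eq_bigr => j _; rewrite nth_fquo_seq.
Qed.

Lemma fquoP N D n : D 0 = 1 ->
  \sum_(j < n.+1) fquo N D j * D (n - j)%N = N n.
Proof.
by move=> D0; rewrite big_ord_recr/= subnn D0 mulr1 fquoE addrC subrK.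
Qed.

End formal_quotient.

Section sectionT.
Context {R : realType}.
Implicit Types f : Gc R.

(* Coefficients of t^(k+2) in the numerator and of t^k in the denominator of the
   quotient defining a(f); a_fun_identity is the defining identity, multiplied
   out. *)
Definition numer f k : R[i] := f k / (2 * pi)%:C.

Definition denom f (x : R) k : R[i] :=
  if k is k'.+1 then k.+1%:R * f k' * (1 - x / (2 * pi))%:C else 1.

Definition a_fun f i : R -> R[i] :=
  perext (fun x => fquo (numer f) (denom f x) i).

Lemma a_fun_identity f (x : R) n : 0 < x <= 2 * pi ->
  \sum_(j < n.+1) a_fun f j x * denom f x (n - j)%N = numer f n.
Proof.
move=> /andP[x0 x2]; have p0 : 0 < 2 * pi :> R by rewrite mulr_gt0// pi_gt0.
have xE : red x = x.
  rewrite /red (@ceil_def _ _ 1) ?subrr ?mul0r ?subr0//.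
  by rewrite divr_gt0//= ler_pdivrMr// mul1r.
rewrite -(fquoP (numer f) n (erefl : denom f x 0 = 1)).
by apply: eq_bigr => j _; rewrite /a_fun /perext xE.
Qed.

Lemma a_periodic f i : periodic (a_fun f i) (2 * pi).
Proof. exact: periodic_perext. Qed.

Lemma a_measurable f i : cmeasurable (a_fun f i).
Proof.
apply: (cmeasurable_comp measurable_red).
have md k : cmeasurable (fun x => denom f x k).
  case: k => [|k]; first exact: cmeasurable_cst.
  apply: cmeasurableM; first exact: cmeasurable_cst.
  apply: cmeasurable_real; apply: measurable_funB => //.
  exact: measurable_funM.
elim/ltn_ind: i => i IH.
under eq_fun do rewrite fquoE.
apply: cmeasurableD; first exact: cmeasurable_cst.
apply: cmeasurableN.
apply: (@cmeasurable_sum _ _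
  (fun j x => fquo (numer f) (denom f x) j * denom f x (i - j)%N)).
by move=> j ji; apply: cmeasurableM => //; exact: IH.
Qed.

Lemma Gc_coef_bound f : exists2 L : R, 1 <= L &
  forall k, k.+2%:R * cmod (f k) <= L ^+ k.+1.
Proof.
have [e/= e0 fe] := (nbhs_ballP _ _).1 (dcoef_cvg f).
have [rho rho0 rhoe] : exists2 r : R, 0 < r & r%:C < e.
  exists (complex.Re e / 2).
    by move: e0; rewrite ltcE/= => /andP[_ ?]; rewrite divr_gt0.
  move: e0; rewrite !ltcE/= => /andP[-> e0]/=.
  by rewrite ltr_pdivrMr// ltr_pMr// ltr1n.
have fcvg : cvgn (series (fun k => f k * rho%:C ^+ k.+2)).
  apply: fe; rewrite /ball/= sub0r normrN ger0_norm//.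
  by rewrite lecR ltW.
have [M M0 fM] : exists2 M : R, 0 < M & forall k, cmod (f k) * rho ^+ k.+2 <= M.
  have /cvgP/cvg_seq_bounded[M [Mr HM]] := cvg_series_cvg_0 fcvg.
  have M1 : M < `|M| + 1 by rewrite (le_lt_trans (real_ler_norm Mr))// ltrDl.
  exists (cmod M + 1).
    by rewrite ltr_wpDl// -lecR -cmodE normr_ge0.
  move=> k; have /= := HM _ M1 k Logic.I.
  rewrite normrM normrX !cmodE [cmod rho%:C](_ : _ = rho); last first.
    by rewrite /cmod/= expr0n/= addr0 sqrtr_sqr gtr0_norm.
  by rewrite -rmorphXn -rmorphM -[1]/(1%:C) -rmorphD lecR.
pose A := 1 + M / rho.
have A1 : 1 <= A by rewrite lerDl divr_ge0// ltW.
have A0 : 0 < A by rewrite (lt_le_trans _ A1).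
exists (1 + 2 * (A / rho)).
  by rewrite lerDl mulr_ge0// divr_ge0// ltW.
move=> k; apply: (@le_trans _ _ ((2 * (A / rho)) ^+ k.+1)); last first.
  by rewrite lerXn2r ?nnegrE ?addr_ge0 ?mulr_ge0 ?invr_ge0 ?ltW// ltrDr.
rewrite exprMn ler_pM ?ler0n//.
- by rewrite -lecR -cmodE normr_ge0.
- by rewrite -natrX ler_nat ltn_expl.
rewrite -(ler_pM2r (exprn_gt0 k.+2 rho0)) (le_trans (fM k))//.
rewrite [rho ^+ k.+2]exprSr mulrA -exprMn divfK ?gt_eqF//.
rewrite -ler_pdivrMr// (@le_trans _ _ A)//; first by rewrite lerDr.
by rewrite exprS ler_pMr// exprn_ege1.
Qed.

Lemma a_bounded f : exists2 l : R, 0 < l & forall i,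
  (ess_sup lebesgue_measure (fun x => (cmod (a_fun f i x))%:E)
     <= (l ^+ i.+1)%:E)%E.
Proof.
have [L L1 fL] := Gc_coef_bound f.
have L0 : 0 < L by rewrite (lt_le_trans _ L1).
exists (2 * L); first by rewrite mulr_gt0.
move=> i; apply/ess_supP; apply: aeW => t; rewrite lee_fin /a_fun /perext.
have /andP[x0 x2] := red_itv t; move: (red t) x0 x2 => x x0 x2.
have p1 : 1 <= 2 * pi :> R by have := pi_ge2 R; lra.
have p0 : 0 < 2 * pi :> R by rewrite (lt_le_trans _ p1).
have c0 z : 0 <= cmod z by rewrite -lecR -cmodE normr_ge0.
have cR (y : R) : cmod y%:C = `|y|.
  by rewrite /cmod/= expr0n/= addr0 sqrtr_sqr.
have fk k : cmod (f k) <= L ^+ k.+1.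
  by rewrite (le_trans _ (fL k))// ler_peMl ?c0 ?ler1n.
have Nb k : cmod (numer f k) <= L ^+ k.+1.
  rewrite /numer -fmorphV cmodM cR (le_trans _ (fk k))//.
  rewrite ger0_norm; last by rewrite invr_ge0 ltW.
  by rewrite ler_piMr ?c0 ?invf_le1.
have Db k : (0 < k)%N -> cmod (denom f x k) <= L ^+ k.
  case: k => // k _; rewrite /denom !cmodM cR cmod_nat (le_trans _ (fL k))//.
  rewrite ler_piMr ?mulr_ge0 ?c0// ger0_norm; last by rewrite subr_ge0 ler_pdivrMr ?mul1r.
  by rewrite gerBl divr_ge0 ?ltW.
have cD (z w : R[i]) : cmod (z + w) <= cmod z + cmod w by exact: le_normcD.
have cN (z : R[i]) : cmod (- z) = cmod z by exact: normcN.
have geo n : \sum_(j < n) 2 ^+ j.+1 + 1 <= 2 ^+ n.+1 :> R.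
  elim: n => [|n IH]; first by rewrite big_ord0 add0r expr1 ler1n.
  by rewrite big_ord_recr/= addrAC [leRHS]exprS mulr2n mulrDl mul1r lerD2r.
elim/ltn_ind: i => i IH; rewrite fquoE.
apply: (@le_trans _ _ ((\sum_(j < i) 2 ^+ j.+1 + 1) * L ^+ i.+1)); last first.
  by rewrite exprMn ler_pM2r ?exprn_gt0.
rewrite mulrDl mul1r addrC (le_trans (cD _ _))// lerD// cN mulr_suml.
apply: (big_ind2 (fun z (r : R) => cmod z <= r)).
- by rewrite /cmod Normc.normc0.
- by move=> z r w s zr ws; rewrite (le_trans (cD _ _))// lerD.
move=> j _; rewrite cmodM.
have -> : 2 ^+ j.+1 * L ^+ i.+1 = (2 * L) ^+ j.+1 * L ^+ (i - j).
  by rewrite exprMn -mulrA -exprD addSn subnKC// ltnW.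
by rewrite ler_pM ?c0 ?IH ?Db ?subn_gt0.
Qed.

Definition a_of f : X R :=
  MkX (a_periodic f) (a_measurable f) (a_bounded f).

Definition Tmap f : GX R := classX (a_of f).

Definition Ttilde (p : Gc R * @hatC R) : GX R :=
  mulG (Tmap p.1) (set_val p.2).

End sectionT.

(* Main.v *)
Require Import Defs.
From HB Require Import structures.
From mathcomp Require Import all_boot all_order all_algebra.
From mathcomp Require Import complex.
From mathcomp Require Import all_classical all_reals all_analysis.
From mathcomp Require Import measurable_realfun ess_sup_inf.
From mathcomp Require Import ring lra.

Set Implicit Arguments.
Unset Strict Implicit.
Unset Printing Implicit Defensive.

Import Order.TTheory GRing.Theory Num.Theory.
Import numFieldNormedType.Exports.

Local Open Scope classical_set_scope.
Local Open Scope complex_scope.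
Local Open Scope ring_scope.

(** For [a] in X and a time [x] in [[0, 2 pi]], let [Psi_x] be the germ at 0 that
    sends the value at time [x] of a solution of [v' = \sum_i a_i v ^+ i.+2] to its
    value at time [2 pi]; the first return map is [Psi_0]. Everything follows from
    the fact that the coefficients of [Psi_x] are linear combinations of iterated
    integrals.

    _The first return map is read off the iterated integrals._ As [Psi_x (v x)] is
    constant along a solution [v], the coefficients of [Psi_x] satisfy a triangular
    linear system ([transportS]) whose solution is a finite linear combination of
    iterated integrals over [[x, 2 pi]]. They grow at most geometrically with the
    degree ([transport_bound_exp]), so [Psi_0] is a convergent series; [flow_end]
    shows that every solution starting near 0 ends where this series says, by
    differentiating the partial sums of [Psi_x (v x)] almost everywhere. Solutions
    exist by Picard iteration ([picard_fixpoint]). By the identity theorem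
    ([Gc_eval_inj]) each coefficient of the first return map is then a fixed
    combination of iterated integrals ([hatP_coef]); in particular the first
    return map is well defined and continuous on G(X).

    _The group structure._ The iterated integrals of [a], indexed by words, form
    a noncommutative power series; concatenation of paths multiplies these
    series (Chen, [iterint_cat]) and inversion of paths inverts them
    ([ncmul_inv_l]). Hence two elements of X are equivalent exactly when all
    their iterated integrals agree ([eqvX_iterint]), G(X) embeds in the group of
    invertible series, and multiplication and inversion are continuous, the
    coefficients of a product or of an inverse being polynomials in those of the
    factors. Gluing solutions shows that the first return map of a product is
    the composition of the first return maps ([return_map_cat]).

    _The section._ For [a = a_of f] the map
    [r |-> r + (1 - x / (2 pi)) (f r - r)] solves the transport equation: this is
    precisely the identity that defines [a_of f] ([transport_a_of]). At [x = 0] it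
    is [f], so the first return map of [a_of f] is [f]. On [(0, 2 pi]] the
    functions [a_i] are polynomials in [x] whose coefficients are polynomials in
    finitely many coefficients of [f], therefore so are the iterated integrals,
    and [Tmap] is continuous ([Tmap_continuous]). A continuous map with a continuous left
    inverse is an embedding, and
    [g |-> (hatP g, Tmap (hatP g) ^-1 g)] inverts [Ttilde]. *)

(** * Complex numbers and geometric convergence *)

Section modulus.
Context {R : realType}.
Implicit Types (z w : R[i]) (x : R).

Lemma cmod_ge0 z : 0 <= cmod z.
Proof. by rewrite -lecR -cmodE normr_ge0. Qed.

Lemma cmod0 : cmod (0 : R[i]) = 0.
Proof. exact: Normc.normc0. Qed.

Lemma cmod1 : cmod (1 : R[i]) = 1.
Proof. exact: Normc.normc1. Qed.

Lemma cmodD z w : cmod (z + w) <= cmod z + cmod w.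
Proof. exact: le_normcD. Qed.

Lemma cmodN z : cmod (- z) = cmod z.
Proof. exact: normcN. Qed.

Lemma cmodB z w : cmod (z - w) <= cmod z + cmod w.
Proof. by rewrite -(cmodN w) cmodD. Qed.

Lemma cmodC z w : cmod (z - w) = cmod (w - z).
Proof. by rewrite -cmodN opprB. Qed.

Lemma cmodX z n : cmod (z ^+ n) = cmod z ^+ n.
Proof. by elim: n => [|n IH]; rewrite ?expr0 ?cmod1// !exprS cmodM IH. Qed.

Lemma cmodR x : cmod x%:C = `|x|.
Proof. by rewrite /cmod/= expr0n/= addr0 sqrtr_sqr. Qed.

Lemma cmod_eq0 z : cmod z = 0 -> z = 0.
Proof. exact: Normc.eq0_normc. Qed.

Lemma cmod_distD z w v : cmod (z - w) <= cmod (z - v) + cmod (v - w).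
Proof. by rewrite (_ : z - w = (z - v) + (v - w)) ?cmodD//; ring. Qed.

Lemma Re_le_cmod z : `|complex.Re z| <= cmod z.
Proof.
case: z => a b; rewrite /cmod/= -sqrtr_sqr ler_wsqrtr// lerDl sqr_ge0//.
Qed.

Lemma Im_le_cmod z : `|complex.Im z| <= cmod z.
Proof.
case: z => a b; rewrite /cmod/= -sqrtr_sqr ler_wsqrtr// lerDr sqr_ge0//.
Qed.

Lemma cmod_le_ReIm z : cmod z <= `|complex.Re z| + `|complex.Im z|.
Proof.
rewrite {1}[z]complexE (le_trans (cmodD _ _))// cmodM !cmodR.
by rewrite /cmod/= expr0n expr1n add0r sqrtr1 mul1r.
Qed.

Lemma cmod_sum n (F : 'I_n -> R[i]) (G : 'I_n -> R) :
  (forall k, cmod (F k) <= G k) -> cmod (\sum_k F k) <= \sum_k G k.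
Proof.
move=> FG; apply: (big_ind2 (fun z (r : R) => cmod z <= r)).
- by rewrite cmod0.
- by move=> z r w s zr ws; rewrite (le_trans (cmodD _ _))// lerD.
- by move=> k _; exact: FG.
Qed.

Lemma complexP z w : complex.Re z = complex.Re w ->
  complex.Im z = complex.Im w -> z = w.
Proof. by case: z w => [a b] [c d]/= -> ->. Qed.

Lemma cReD z w : complex.Re (z + w) = complex.Re z + complex.Re w.
Proof. by case: z w => [a b] [c d]. Qed.

Lemma cImD z w : complex.Im (z + w) = complex.Im z + complex.Im w.
Proof. by case: z w => [a b] [c d]. Qed.

Lemma cReN z : complex.Re (- z) = - complex.Re z.
Proof. by case: z => [a b]. Qed.

Lemma cImN z : complex.Im (- z) = - complex.Im z.
Proof. by case: z => [a b]. Qed.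

Lemma cReM z w : complex.Re (z * w) =
  complex.Re z * complex.Re w - complex.Im z * complex.Im w.
Proof. by case: z w => [a b] [c d]. Qed.

Lemma cImM z w : complex.Im (z * w) =
  complex.Re z * complex.Im w + complex.Im z * complex.Re w.
Proof. by case: z w => [a b] [c d]. Qed.

Definition ReImE := (cReD, cImD, cReN, cImN, cReM, cImM).

(** The norm of the complex numbers takes complex values; limits are handled
    through the real modulus. *)
Lemma cvg_cmodP (T : Type) (F : set_system T) (FF : Filter F) (f : T -> R[i]) z :
  f @ F --> z <-> forall e, 0 < e -> \forall x \near F, cmod (f x - z) < e.
Proof.
split=> [/cvgrPdistC_lt fz e e0|fz].
  by near=> x; rewrite -ltcR -cmodE; near: x; apply: fz; rewrite ltcR.
apply/cvgrPdistC_lt => e; rewrite ltcE/= => /andP[/eqP eI e0].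
have -> : e = (complex.Re e)%:C by apply: complexP.
by near=> x; rewrite cmodE ltcR; near: x; exact: fz.
Unshelve. all: by end_near. Qed.

Lemma near0_cmodP (P : R[i] -> Prop) :
  (\forall r \near (0 : R[i]), P r) <->
  exists2 e, 0 < e & forall r, cmod r < e -> P r.
Proof.
split=> [/nbhs_ballP[e/= + eP]|[e e0 eP]].
  rewrite ltcE/= => /andP[/eqP eI e0]; exists (complex.Re e) => // r re.
  apply: eP; rewrite /ball/= sub0r normrN.
  have -> : e = (complex.Re e)%:C by apply: complexP.
  by rewrite cmodE ltcR.
apply/nbhs_ballP; exists e%:C; rewrite /= ?ltcR// => r.
by rewrite /ball/= sub0r normrN cmodE ltcR; exact: eP.
Qed.

Lemma cvg_ReIm (u : nat -> R[i]) (a b : R) :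
  (@complex.Re R \o u) @ \oo --> a -> (@complex.Im R \o u) @ \oo --> b ->
  u @ \oo --> a +i* b.
Proof.
move=> /cvgrPdistC_lt ua /cvgrPdistC_lt ub; apply/cvg_cmodP => e e0.
have e2 : 0 < e / 2 by rewrite divr_gt0.
near=> n; rewrite (le_lt_trans (cmod_le_ReIm _))// [ltRHS](splitr e) !ReImE/=.
by apply: ltrD; near: n; [exact: ua|exact: ub].
Unshelve. all: by end_near. Qed.

Lemma Re_Im_cvg (u : nat -> R[i]) z : u @ \oo --> z ->
  (@complex.Re R \o u) @ \oo --> complex.Re z /\
  (@complex.Im R \o u) @ \oo --> complex.Im z.
Proof.
move=> /cvg_cmodP uz; split; apply/cvgrPdistC_lt => e e0; near=> n.
  rewrite -cReN -cReD (le_lt_trans (Re_le_cmod _))//; near: n; exact: uz.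
rewrite -cImN -cImD (le_lt_trans (Im_le_cmod _))//; near: n; exact: uz.
Unshelve. all: by end_near. Qed.

Lemma geometric_dist (u : nat -> R[i]) (C q : R) : 0 <= q <= 2^-1 ->
  (forall n, cmod (u n.+1 - u n) <= C * q ^+ n) ->
  forall n m, cmod (u (n + m)%N - u n) <= 2 * C * q ^+ n.
Proof.
move=> /andP[q0 q2] du n m.
have C0 : 0 <= C by have := du 0%N; rewrite expr0 mulr1; apply: le_trans; exact: cmod_ge0.
have qn0 : 0 <= q ^+ n by rewrite exprn_ge0.
(* The factor [1 - q ^+ m] makes the bound provable by induction on [m]. *)
suff : cmod (u (n + m)%N - u n) <= 2 * C * q ^+ n * (1 - q ^+ m).
  move/le_trans; apply; rewrite ler_piMr ?mulr_ge0//.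
  by rewrite gerBl exprn_ge0.
elim: m => [|m IH]; first by rewrite addn0 subrr cmod0 expr0 subrr mulr0.
rewrite addnS (le_trans (cmod_distD _ _ (u (n + m)%N)))//.
rewrite (le_trans (lerD (du _) IH))// exprD.
have : q ^+ m.+1 <= 2^-1 * q ^+ m by rewrite exprS ler_wpM2r// exprn_ge0.
move: (q ^+ m) (q ^+ m.+1) => a b ba.
have : 0 <= C * q ^+ n * (2^-1 * a - b) by rewrite !mulr_ge0// subr_ge0.
by move: (q ^+ n) => d; lra.
Qed.

(** Completeness of the complex numbers, in the form in which it is used: the
    power series and the Picard iterates below converge geometrically, and the
    error bound is what makes their limits computable. *)
Lemma geometric_cvg (u : nat -> R[i]) (C q : R) : 0 <= q <= 2^-1 ->
  (forall n, cmod (u n.+1 - u n) <= C * q ^+ n) ->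
  exists2 s, u @ \oo --> s & forall n, cmod (s - u n) <= 2 * C * q ^+ n.
Proof.
move=> q02 du; have /andP[q0 q2] := q02.
have q1 : `|q| < 1 by rewrite ger0_norm//; lra.
have C0 : 0 <= C by have := du 0%N; rewrite expr0 mulr1; apply: le_trans; exact: cmod_ge0.
have qlt e : 0 < e -> exists N, 2 * C * q ^+ N < e.
  move=> e0; have /cvgr0Pnorm_lt/(_ _ e0)[N _ /(_ N (leqnn N))] := cvg_geometric (2 * C) q1.
  by rewrite /= ger0_norm ?mulr_ge0 ?exprn_ge0// => ?; exists N.
have dist := geometric_dist q02 du.
have cv (f : R[i] -> R) : (forall z w, `|f z - f w| <= cmod (z - w)) ->
    cvgn (f \o u).
  move=> fl; apply: cauchy_cvg; apply: cauchy_exP => e e0.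
  have [N NE] := qlt _ e0; exists (f (u N)); exists N => // n /= Nn.
  by rewrite /ball/= (le_lt_trans (fl _ _))// cmodC -(subnKC Nn) (le_lt_trans (dist _ _)).
have lim_dist s : u @ \oo --> s -> forall n, cmod (s - u n) <= 2 * C * q ^+ n.
  move=> us n; apply/ler_addgt0Pr => e e0.
  have [N _ NE] := (cvg_cmodP _ u s).1 us _ e0.
  rewrite (le_trans (cmod_distD _ _ (u (n + N)%N)))// addrC lerD//.
  by rewrite cmodC ltW// NE//= leq_addl.
have cvRe : cvgn (@complex.Re R \o u).
  by apply: cv => z w; rewrite -cReN -cReD Re_le_cmod.
have cvIm : cvgn (@complex.Im R \o u).
  by apply: cv => z w; rewrite -cImN -cImD Im_le_cmod.
suff us : u @ \oo --> limn (@complex.Re R \o u) +i* limn (@complex.Im R \o u).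
  by exists (limn (@complex.Re R \o u) +i* limn (@complex.Im R \o u)) => //; exact: lim_dist.
exact: cvg_ReIm.
Qed.

Lemma geometric_series_cvg (c : nat -> R[i]) (C q : R) : 0 <= q <= 2^-1 ->
  (forall n, cmod (c n) <= C * q ^+ n) ->
  exists2 s, series c @ \oo --> s &
    forall n, cmod (s - series c n) <= 2 * C * q ^+ n.
Proof.
move=> q2 cC; apply: geometric_cvg => // n.
by rewrite /series/= big_nat_recr//= addrAC subrr add0r.
Qed.

Lemma complex_hausdorff : hausdorff_space R[i].
Proof. exact: norm_hausdorff. Qed.
End modulus.

(** * Integrals of real functions *)

Section real_integrals.
Context {R : realType}.
Let mu := @lebesgue_measure R.
Implicit Types (f g : R -> R) (s t u : R).

Lemma ae_and (P Q : R -> Prop) : {ae mu, forall x, P x} ->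
  {ae mu, forall x, Q x} -> {ae mu, forall x, P x /\ Q x}.
Proof.
by apply: filterS2 => //; exact: (ae_filter_ringOfSetsType mu).
Qed.

Lemma ae_imp (P Q : R -> Prop) : (forall x, P x -> Q x) ->
  {ae mu, forall x, P x} -> {ae mu, forall x, Q x}.
Proof.
by move=> PQ; apply: filterS => //; exact: (ae_filter_ringOfSetsType mu).
Qed.

Lemma ae_neq s : {ae mu, forall x, x != s}.
Proof.
exists [set s]; split => //; first exact: lebesgue_measure_set1.
by move=> x /= /negP; rewrite negbK => /eqP.
Qed.

(** The coefficients of an element of X are bounded only almost everywhere, and
    iterated integrals are bounded only locally; both are allowed here, and this
    class is closed under products. *)
Definition rloc_bounded f := measurable_fun [set: R] f /\
  forall T, exists C, {ae mu, forall x, `|x| <= T -> `|f x| <= C}.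

Lemma rloc_bounded_integrable_set f (D : set R) T : rloc_bounded f ->
  measurable D -> (forall x, D x -> `|x| <= T) -> mu.-integrable D (EFin \o f).
Proof.
move=> [mf /(_ T)[C fC]] mD DT.
have mfD : measurable_fun D f by exact: measurable_funS mf.
apply/integrableP; split; first exact/measurable_EFinP.
apply: (@le_lt_trans _ _ (\int[mu]_(x in D) (`|C|)%:E)%E).
  apply: ae_ge0_le_integral => //.
  - by apply/measurable_EFinP; apply: measurableT_comp.
  - apply: (ae_imp _ fC) => x /= {}fC Dx; rewrite lee_fin.
    by rewrite (le_trans (fC (DT _ Dx)))// ler_norm.
rewrite integral_cst// lte_mul_pinfty ?lee_fin//.
rewrite (@le_lt_trans _ _ (mu `[- T, T]))//; last first.
  rewrite /mu lebesgue_measure_itv/= ; case: ifP => // _.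
  by rewrite -EFinB ltry.
apply: le_measure; rewrite ?inE// => x /DT.
by rewrite /= in_itv/= ler_norml.
Qed.

Lemma rloc_bounded_integrable f s t : rloc_bounded f ->
  mu.-integrable `[s, t] (EFin \o f).
Proof.
move=> lf; apply: (@rloc_bounded_integrable_set _ _ (`|s| + `|t|)) => // x.
rewrite /= in_itv/= => /andP[sx xt]; rewrite ler_norml; apply/andP; split.
  rewrite (le_trans _ sx)// lerNl (le_trans (ler_norm _))// normrN lerDl//.
by rewrite (le_trans xt)// (le_trans (ler_norm _))// lerDr.
Qed.

Lemma rloc_bounded_locally_integrable f : rloc_bounded f ->
  locally_integrable [set: R] f.
Proof.
move=> lf; split; [by case: lf|exact: openT|move=> K _ cK].
have [M [_ /(_ (M + 1))]] := compact_bounded cK; rewrite ltrDl => /(_ ltr01) KM.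
have mK : measurable K by apply: compact_measurable.
by have /integrableP[_] := rloc_bounded_integrable_set lf mK KM.
Qed.

Lemma rint_split f s t u : rloc_bounded f -> s <= t -> t <= u ->
  \int[mu]_(x in `[s, u]) f x =
  \int[mu]_(x in `[s, t]) f x + \int[mu]_(x in `[t, u]) f x.
Proof.
move=> lf st tu; apply/eqP; rewrite addrC -subr_eq; apply/eqP.
rewrite Rintegral_itvB ?bnd_simp//; last exact: rloc_bounded_integrable.
apply: Rintegral_itv_obnd_cbnd; apply: integrableS (rloc_bounded_integrable t u lf) => //.
exact: subset_itv_oc_cc.
Qed.

(** The dominating function is given with a primitive, so that exponential
    bounds can be integrated as easily as constant ones. *)
Lemma rint_le f (g G : R -> R) s t : rloc_bounded f -> s <= t ->
  continuous g -> (forall x, 0 <= g x) ->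
  (forall x : R, is_derive x (1 : R) G (g x)) ->
  {ae mu, forall x, x \in `]s, t[ -> `|f x| <= g x} ->
  `|\int[mu]_(x in `[s, t]) f x| <= G t - G s.
Proof.
move=> lf; rewrite le_eqVlt => /predU1P[->|st] cg g0 Gg fg.
  by rewrite set_itv1 Rintegral_set1 normr0 subrr.
have intf := rloc_bounded_integrable s t lf.
have mg : measurable_fun [set: R] g by exact: continuous_measurable_fun.
have ff := measurable_funS measurableT (@subsetT _ `[s, t]%classic) lf.1.
rewrite -lee_fin EFin_normr_Rintegral//.
rewrite (le_trans (le_abse_integral _ _ _))//.
  by have /integrableP[] := intf.
have cG : continuous G.
  move=> x; apply: differentiable_continuous; apply/derivable1_diffP.
  by have [] := Gg x.
have <- : (\int[mu]_(x in `[s, t]) (g x)%:E = (G t - G s)%:E)%E.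
  rewrite (@continuous_FTC2 _ g G)//.
  - exact: continuous_subspaceT.
  - split; [by move=> x _; have [] := Gg x| |].
    + exact/cvg_at_right_filter/cG.
    + exact/cvg_at_left_filter/cG.
  - by move=> x _; rewrite derive1E; have [_ ->] := Gg x.
apply: ae_ge0_le_integral => //.
- by apply/measurable_EFinP; apply: measurableT_comp.
- by move=> x _; rewrite lee_fin.
- by apply/measurable_EFinP; exact: measurable_funS mg.
have := ae_and fg (ae_and (ae_neq s) (ae_neq t)).
apply: ae_imp => x /= [{}fg [xs xt]]; rewrite in_itv/= => /andP[sx tx].
by rewrite lee_fin fg// in_itv/= !lt_neqAle sx tx xt eq_sym xs.
Qed.

Lemma rloc_bounded_lipschitz f K : (forall x y, `|f x - f y| <= K * `|x - y|) ->
  rloc_bounded f.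
Proof.
move=> fK.
have K0 : 0 <= K.
  by have := fK 1 0; rewrite subr0 normr1 mulr1; apply: le_trans.
have cf : continuous f.
  move=> x; apply/cvgrPdist_lt => e e0.
  have K1 : 0 < K + 1 by lra.
  near=> y; rewrite (le_lt_trans (fK _ _))//.
  have /lt_le_trans : `|x - y| < e / (K + 1).
    by near: y; apply: cvgr_dist_lt => //; rewrite divr_gt0.
  move=> /(_ _ (lexx _)); rewrite ltr_pdivlMr// => xy.
  by have := normr_ge0 (x - y); nra.
split; first exact: continuous_measurable_fun.
move=> T; exists (`|f 0| + K * T); apply: aeW => x xT.
rewrite -lerBlDl (le_trans (lerB_dist _ _))// (le_trans (fK _ _))// subr0.
by rewrite ler_wpM2l.
Unshelve. all: by end_near. Qed.

Lemma rloc_bounded_cst (c : R) : rloc_bounded (cst c).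
Proof. by split => // T; exists `|c|; exact: aeW. Qed.

Lemma rloc_boundedB f g : rloc_bounded f -> rloc_bounded g ->
  rloc_bounded (fun x => f x - g x).
Proof.
move=> [mf bf] [mg bg]; split; first exact: measurable_funB.
move=> T; have [C fC] := bf T; have [D gD] := bg T; exists (C + D).
move: (ae_and fC gD); apply: ae_imp => x [{}fC {}gD] xT.
by rewrite (le_trans (ler_normB _ _))// lerD ?fC ?gD.
Qed.

Lemma rloc_boundedM f g : rloc_bounded f -> rloc_bounded g ->
  rloc_bounded (fun x => f x * g x).
Proof.
move=> [mf bf] [mg bg]; split; first exact: measurable_funM.
move=> T; have [C fC] := bf T; have [D gD] := bg T; exists (C * D).
move: (ae_and fC gD); apply: ae_imp => x [{}fC {}gD] xT.
by rewrite normrM ler_pM ?fC ?gD.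
Qed.

Lemma rloc_bounded_max f g : rloc_bounded f -> rloc_bounded g ->
  rloc_bounded (fun x => Num.max (f x) (g x)).
Proof.
move=> [mf bf] [mg bg]; split; first exact: measurable_maxr.
move=> T; have [C fC] := bf T; have [D gD] := bg T; exists (Num.max C D).
move: (ae_and fC gD); apply: ae_imp => x [{}fC {}gD] xT.
by rewrite le_max maxEle; case: ifP => _; rewrite ?fC ?gD// orbT.
Qed.

Lemma rloc_bounded_norm f : rloc_bounded f -> rloc_bounded (fun x => `|f x|).
Proof.
move=> [mf bf]; split; first exact: measurableT_comp.
move=> T; have [C fC] := bf T; exists C.
by move: fC; apply: ae_imp => x fC xT; rewrite normr_id fC.
Qed.

Section substitution.
Variables (g : R -> R) (c : R).
Hypotheses (c0 : 0 < c) (mg : measurable_fun [set: R] g).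
Hypothesis gl : forall a b, a < b ->
  (c%:E * mu (g @^-1` `]a, b]) = (b - a)%:E)%E.

(* Both sides are measures of the same measurable sets, hence agree by
   uniqueness of the Lebesgue measure. *)
Let rint_subst_ge0 f (D : set R) : measurable D -> measurable_fun [set: R] f ->
  (forall x, 0 <= f x) ->
  (\int[mu]_(x in D) (f x)%:E = c%:E * \int[mu]_(x in g @^-1` D) (f (g x))%:E)%E.
Proof.
move=> mD mf f0.
pose c' : {nonneg R} := NngNum (ltW c0).
pose pu : {measure set (measurableTypeR R) -> \bar R} :=
  measure_function_pushforward__canonical__measure_function_Measure
    (@lebesgue_measure R)
    (mg : @measurable_fun _ _ (measurableTypeR R) (measurableTypeR R) setT g).
have muE : forall A, measurable A -> mu A = mscale c' pu A.
  apply: lebesgue_measure_unique => X /ocitvP[->|[[a b]/= ab ->]].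
    by rewrite !measure0.
  rewrite lebesgue_measure_itv/= lte_fin ab -EFinB -gl//.
rewrite (eq_measure_integral (mscale c' pu)); last by move=> A mA _; exact: muE.
rewrite ge0_integral_mscale//=; last 2 first.
- by apply/measurable_EFinP; exact: measurable_funS mf.
- by move=> x _; rewrite lee_fin.
congr (_ * _)%E; rewrite ge0_integral_pushforward//.
  by apply/measurable_EFinP; exact: measurable_funS mf.
by move=> x _; rewrite lee_fin.
Qed.

Lemma rint_subst f (D D' : set R) (T : R) : rloc_bounded f -> measurable D ->
  g @^-1` D = D' -> measurable D' ->
  rloc_bounded (f \o g) ->
  (forall x, D x -> `|x| <= T) -> (forall x, D' x -> `|x| <= T) ->
  \int[mu]_(x in D) f x = \int[mu]_(x in D') (c * f (g x)).
Proof.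
move=> lf mD gD mD' lfg DT DT'.
have lN h : rloc_bounded h -> rloc_bounded (fun x => - h x).
  move=> lh; rewrite (_ : (fun x => _) = (fun x => 0 - h x)).
    by apply: rloc_boundedB => //; exact: rloc_bounded_cst.
  by apply/funext => x; rewrite sub0r.
(* Reduction to nonnegative functions, by positive and negative parts. *)
pose P (h : R -> R) (x : R) : R := Num.max (h x) 0.
have lP h : rloc_bounded h -> rloc_bounded (P h).
  by move=> lh; apply: rloc_bounded_max => //; exact: rloc_bounded_cst.
have PE h x : h x = P h x - P (fun y => - h y) x.
  rewrite /P; have [h0|h0] := leP (h x) 0.
    by rewrite max_l ?oppr_ge0// sub0r opprK.
  by rewrite max_r ?oppr_le0 ?ltW// subr0.
have ge0E h : rloc_bounded h -> rloc_bounded (h \o g) -> (forall x, 0 <= h x) ->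
    \int[mu]_(x in D) h x = c * \int[mu]_(x in D') (h (g x)).
  move=> lh lhg h0; rewrite /Rintegral rint_subst_ge0//; last by case: lh.
  rewrite gD fineM//; apply: integrable_fin_num => //.
  exact: (rloc_bounded_integrable_set lhg mD' DT').
rewrite RintegralZl//; last exact: (rloc_bounded_integrable_set lfg mD' DT').
have int h (lh : rloc_bounded h) := rloc_bounded_integrable_set lh mD DT.
have int' h (lh : rloc_bounded h) := rloc_bounded_integrable_set lh mD' DT'.
rewrite (@eq_Rintegral _ _ _ mu D (fun x => P f x - P (fun y => - f y) x) f); last first.
  by move=> x _; rewrite -PE.
rewrite (@eq_Rintegral _ _ _ mu D' (fun x => P (f \o g) x - P (fun y => - f (g y)) x)
  (fun x => f (g x))); last first.
  by move=> x _; rewrite -(PE (f \o g)).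
rewrite RintegralB//; [|exact: (int _ (lP _ lf))|exact: (int _ (lP _ (lN _ lf)))].
rewrite RintegralB//; [|exact: (int' _ (lP _ lfg))|exact: (int' _ (lP _ (lN _ lfg)))].
have max0 h x : 0 <= P h x by rewrite /P le_max lexx orbT.
rewrite ge0E// ?mulrBr ?ge0E//.
- exact/lP/lN.
- exact/(lP _ (lN _ lfg)).
- exact/lP.
- exact/(lP _ lfg).
Qed.

End substitution.

Lemma rint_shift f d s t : rloc_bounded f -> rloc_bounded (fun x => f (x + d)) ->
  \int[mu]_(x in `[s + d, t + d]) f x = \int[mu]_(x in `[s, t]) f (x + d).
Proof.
move=> lf lfd; pose T := `|s| + `|t| + `|d|.
rewrite (@rint_subst (fun x => x + d) 1 _ _ _ f _ `[s, t] T)//.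
- by under eq_Rintegral do rewrite mul1r.
- by apply: measurable_funD.
- move=> a b ab; rewrite (_ : _ @^-1` _ = [set` `]a - d, b - d]]).
    rewrite /mu lebesgue_measure_itv/= lte_fin ltrD2r ab -EFinB mul1e.
    by congr EFin; lra.
  apply/seteqP; split => x /=; rewrite !in_itv/= => /andP[? ?];
  by apply/andP; split; lra.
- by apply/seteqP; split => x /=; rewrite !in_itv/= !lerD2r.
- move=> x /=; rewrite in_itv/= => /andP[? ?]; rewrite /T ler_norml.
  have := ler_norm s; have := ler_norm t; have := ler_norm d.
  have := ler_norm (-s); have := ler_norm (-t); have := ler_norm (-d).
  by rewrite !normrN => ? ? ? ? ? ?; apply/andP; split; lra.
- move=> x /=; rewrite in_itv/= => /andP[? ?]; rewrite /T ler_norml.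
  have := ler_norm s; have := ler_norm t; have := ler_norm d.
  have := ler_norm (-s); have := ler_norm (-t); have := ler_norm (-d).
  by rewrite !normrN => ? ? ? ? ? ?; apply/andP; split; lra.
Qed.
End real_integrals.

(** * Lipschitz functions and their derivatives *)

Section lipschitz.
Context {R : realType}.
Let mu := @lebesgue_measure R.
Implicit Types (f g h : R -> R) (s t : R).

Lemma rint_le_cst f C s t : rloc_bounded f -> s <= t -> 0 <= C ->
  {ae mu, forall x, x \in `]s, t[ -> `|f x| <= C} ->
  `|\int[mu]_(x in `[s, t]) f x| <= C * (t - s).
Proof.
move=> lf st C0 fC; rewrite mulrBr.
apply: (@rint_le R f (cst C) ( *%R C)) => //.
- by move=> x; exact: cvg_cst.
- move=> x; have := @is_deriveZ _ _ _ (id : R -> R) C x 1 1 (is_derive_id _ _).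
  by move=> h; apply: is_derive_eq h _; rewrite /= [LHS]mulr1.
Qed.

Lemma rint_cst (c s t : R) : s <= t ->
  \int[mu]_(x in `[s, t]) c = c * (t - s).
Proof.
move=> st; rewrite (@Rintegral_cst _ _ _ mu)//.
suff h : mu `[s, t] = (t - s)%:E by congr (_ * _); exact: (congr1 fine h).
rewrite /mu lebesgue_measure_itv/= lte_fin.
by case: ltP => [_|ts]; rewrite -?EFinB// (_ : t = s) ?subrr//;
  apply/eqP; rewrite eq_le st ts.
Qed.

Definition clamp s t (x : R) : R := Num.max s (Num.min t x).

Lemma clamp_itv s t x : s <= t -> s <= clamp s t x <= t.
Proof.
move=> st; rewrite /clamp le_max lexx/= ge_max st/=.
by rewrite ge_min lexx.
Qed.

Lemma clamp_id s t x : s <= x -> x <= t -> clamp s t x = x.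
Proof. by move=> sx xt; rewrite /clamp min_r// max_r. Qed.

Lemma clamp_lipschitz s t x y : `|clamp s t x - clamp s t y| <= `|x - y|.
Proof.
have := ler_norm (x - y); have := ler_norm (y - x); rewrite (distrC y x).
have := normr_ge0 (x - y); move: `|x - y| => N N0 Nyx Nxy; rewrite ler_norml /clamp.
case: (lerP t x) => ?; case: (lerP t y) => ?;
by do ?[case: (lerP s _) => ?]; apply/andP; split; lra.
Qed.

Lemma rint_lipschitz_dist h K s d : (forall x y, `|h x - h y| <= K * `|x - y|) ->
  0 < d -> `|\int[mu]_(x in `[s, s + d]) h x - d * h s| <= K * d * d.
Proof.
move=> hK d0; have K0 : 0 <= K.
  by have := hK 1 0; rewrite subr0 normr1 mulr1; apply: le_trans.
have sd : s <= s + d by lra.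
have lh := rloc_bounded_lipschitz hK.
have int := fun f lf => @rloc_bounded_integrable R f s (s + d) lf.
have -> : d * h s = \int[mu]_(x in `[s, s + d]) (cst (h s) x).
  by rewrite rint_cst// mulrC; congr (_ * _); lra.
rewrite -RintegralB//; [|exact: int|exact/int/rloc_bounded_cst].
have lB : rloc_bounded (fun x => h x - cst (h s) x).
  by apply: rloc_boundedB => //; exact: rloc_bounded_cst.
apply: le_trans (@rint_le_cst _ (K * d) _ _ lB sd _ _) _.
- by rewrite mulr_ge0// ltW.
- apply: aeW => x /=; rewrite in_itv/= => /andP[sx xd].
  rewrite (le_trans (hK _ _))// ler_wpM2l// ger0_norm; lra.
- by rewrite le_eqVlt; apply/orP; left; apply/eqP; ring.
Qed.

(** The integral of a difference quotient telescopes to two boundary averages,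
    each of which is close to a value of [h]. *)
Lemma lipschitz_integral h K s d t : (forall x y, `|h x - h y| <= K * `|x - y|) ->
  0 < d -> s <= t ->
  `|\int[mu]_(x in `[s, t]) (h (x + d) - h x) - d * (h t - h s)| <= 2 * K * d * d.
Proof.
move=> hK d0 st.
have lh := rloc_bounded_lipschitz hK.
have lhd : rloc_bounded (fun x => h (x + d)).
  apply: (@rloc_bounded_lipschitz _ _ K) => x y; rewrite (le_trans (hK _ _))//.
  by rewrite (_ : x + d - (y + d) = x - y)//; ring.
rewrite RintegralB//; try exact: rloc_bounded_integrable.
rewrite -rint_shift//.
have Hs := rint_lipschitz_dist s hK d0.
have Ht := rint_lipschitz_dist t hK d0.
have e1 := rint_split lh (_ : s <= s + d) (_ : s + d <= t + d).
have e2 := rint_split lh (_ : s <= t) (_ : t <= t + d).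
move: e1 e2; rewrite -/mu => e1 e2.
have := e2 st _; rewrite e1; [|lra|lra].
move=> /(_ ltac:(lra)).
move: Hs Ht; rewrite -/mu.
move: (Rintegral mu `[s, s + d] _) (Rintegral mu `[t, t + d] _) => A B.
move: (Rintegral mu `[s + d, t + d] _) (Rintegral mu `[s, t] _) => A' B'.
rewrite !ler_norml => /andP[? ?] /andP[? ?] E.
by apply/andP; split; lra.
Qed.

Lemma difference_quotient_cvg h (x d : R) : is_derive x (1 : R) h d ->
  (fun n => n.+1%:R * (h (x + n.+1%:R^-1) - h x)) @ \oo --> d.
Proof.
move=> [hx <-]; move: hx; rewrite /derivable /derive.
set f := (fun k => _ : R) => hx.
have dcvg : @harmonic R @ \oo --> 0^'.
  move=> A A0.
  have : \forall n \near \oo, @harmonic R n != 0 -> A (harmonic n).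
    exact: (@cvg_harmonic R _ A0).
  by rewrite nbhs_simpl; apply: filterS => n; apply; exact: (lt0r_neq0 (harmonic_gt0 n)).
suff -> : (fun n => n.+1%:R * (h (x + n.+1%:R^-1) - h x)) = f \o @harmonic R.
  exact: (cvg_comp _ _ dcvg hx).
apply/funext => n; rewrite /f /harmonic/= invrK.
by rewrite [_ *: 1]mulr1 (addrC x).
Qed.

(** The mean value inequality with derivatives known almost everywhere. It holds
    for Lipschitz functions because their difference quotients are bounded:
    by dominated convergence their integrals are controlled by the derivative,
    and by the telescoping above they tend to the increment. *)
Lemma lipschitz_derive_bound h K e s t : (forall x y, `|h x - h y| <= K * `|x - y|) ->
  0 <= e -> s <= t ->
  {ae mu, forall x, x \in `]s, t[ -> exists2 d : R, is_derive x (1 : R) h d & `|d| <= e} ->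
  `|h t - h s| <= e * (t - s).
Proof.
move=> hK e0 st hd.
have K0 : 0 <= K.
  by have := hK 1 0; rewrite subr0 normr1 mulr1; apply: le_trans.
pose d n : R := n.+1%:R^-1.
have d0 n : 0 < d n by rewrite invr_gt0.
pose q n x : R := n.+1%:R * (h (x + d n) - h x).
(* The excess of the difference quotient over [e] tends to 0; using it spares
   the measurability of the derivative. *)
pose p n x : R := Num.max (`|q n x| - e) 0.
have lh := rloc_bounded_lipschitz hK.
have lhd n : rloc_bounded (fun x => h (x + d n)).
  apply: (@rloc_bounded_lipschitz _ _ K) => x y; rewrite (le_trans (hK _ _))//.
  by rewrite (_ : x + d n - (y + d n) = x - y)//; ring.
have lq n : rloc_bounded (q n).
  by apply: rloc_boundedM; [exact: rloc_bounded_cst|exact: rloc_boundedB].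
have lp n : rloc_bounded (p n).
  apply: rloc_bounded_max; last exact: rloc_bounded_cst.
  by apply: rloc_boundedB; [exact: rloc_bounded_norm|exact: rloc_bounded_cst].
have qK n x : `|q n x| <= K.
  rewrite normrM ger0_norm// -ler_pdivlMl// (le_trans (hK _ _))//.
  by rewrite addrAC subrr add0r gtr0_norm// mulrC.
have p0 n x : 0 <= p n x by rewrite /p le_max lexx orbT.
have pK n x : `|p n x| <= K.
  rewrite ger0_norm// /p ge_max K0 andbT (le_trans _ (qK n x))// gerBl//.
have key n : `|h t - h s| <= e * (t - s) + \int[mu]_(x in `[s, t]) p n x + 2 * K * d n.
  have := lipschitz_integral hK (d0 n) st.
  have qI : \int[mu]_(x in `[s, t]) (h (x + d n) - h x) =
      d n * \int[mu]_(x in `[s, t]) q n x.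
    rewrite -RintegralZl//; last exact: rloc_bounded_integrable.
    by apply: eq_Rintegral => x _; rewrite /q /d mulKf.
  rewrite qI -mulrBr normrM gtr0_norm// [leRHS]mulrC ler_pM2l// => H.
  have qB : `|\int[mu]_(x in `[s, t]) q n x| <=
      e * (t - s) + \int[mu]_(x in `[s, t]) p n x.
    rewrite (le_trans (le_normr_Rintegral _ _))//; first exact: rloc_bounded_integrable.
    have -> : e * (t - s) = \int[mu]_(x in `[s, t]) (cst e x).
      by rewrite rint_cst.
    rewrite -RintegralD//; try exact: rloc_bounded_integrable.
      apply: le_Rintegral => //.
      - exact/rloc_bounded_integrable/rloc_bounded_norm.
      - exact: (integrableD _ (rloc_bounded_integrable _ _ (rloc_bounded_cst e))
          (rloc_bounded_integrable _ _ (lp n))).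
      - by move=> x _; rewrite /p /= -lerBlDl le_max lexx.
    exact/rloc_bounded_integrable/rloc_bounded_cst.
  move: H qB; rewrite !ler_norml => /andP[? ?] /andP[? ?].
  by apply/andP; split; lra.
have pcvg : (fun n => \int[mu]_(x in `[s, t]) p n x) @ \oo --> (0 : R).
  have [] := @dominated_convergence _ _ R mu `[s, t] _ (fun n x => (p n x)%:E)
    (cst 0)%E (cst K%:E).
  - by [].
  - by move=> n; apply/measurable_EFinP; exact: measurable_funS (lp n).1.
  - exact: measurable_cst.
  - move: (ae_and hd (ae_and (ae_neq s) (ae_neq t))); apply: ae_imp.
    move=> x /= [{}hd [xs xt]]; rewrite in_itv/= => /andP[sx tx].
    have [|d' hd' d'e] := hd; first by rewrite in_itv/= !lt_neqAle eq_sym xs xt sx tx.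
    apply: cvg_EFin; first exact: nearW.
    apply/cvgr0Pnorm_lt => eps eps0.
    have /cvgrPdistC_lt/(_ _ eps0) := difference_quotient_cvg hd'.
    apply: filterS => n qd; rewrite /= ger0_norm// /p gt_max eps0 andbT.
    rewrite (le_lt_trans _ qd)//.
    by rewrite (le_trans _ (lerB_dist _ _))// lerB.
  - exact: (rloc_bounded_integrable _ _ (rloc_bounded_cst K)).
  - by apply: aeW => x n _; rewrite /= lee_fin.
  - by move=> _ _; rewrite integral0 => /fine_cvg.
have dcvg : d @ \oo --> (0 : R) by exact: cvg_harmonic.
have Kcvg : (fun n => e * (t - s) + \int[mu]_(x in `[s, t]) p n x + 2 * K * d n) @ \oo
    --> e * (t - s) + 0 + 2 * K * 0.
  by apply: cvgD; [apply: cvgD; [exact: cvg_cst|]|apply: cvgM; [exact: cvg_cst|]].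
move: Kcvg; rewrite mulr0 !addr0 => Kcvg.
rewrite -(cvg_lim (@Rhausdorff R) Kcvg).
by apply: limr_ge; [apply/cvg_ex; exists (e * (t - s))|exact: nearW].
Qed.
End lipschitz.

(** * Integrals of complex functions *)

Section complex_integrals.
Context {R : realType}.
Let mu := @lebesgue_measure R.
Implicit Types (f g : R -> R[i]) (s t u : R) (c z : R[i]).

Local Notation cint s t f := (cintegral `[s, t] f).

Definition loc_bounded f := cmeasurable f /\
  forall T : R, exists C, {ae mu, forall x, `|x| <= T -> cmod (f x) <= C}.

Lemma loc_bounded_Re f : loc_bounded f -> rloc_bounded (fun x => complex.Re (f x)).
Proof.
move=> [[mr mi] bf]; split => // T; have [C fC] := bf T; exists C.
by move: fC; apply: ae_imp => x fC xT; rewrite (le_trans (Re_le_cmod _))// fC.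
Qed.

Lemma loc_bounded_Im f : loc_bounded f -> rloc_bounded (fun x => complex.Im (f x)).
Proof.
move=> [[mr mi] bf]; split => // T; have [C fC] := bf T; exists C.
by move: fC; apply: ae_imp => x fC xT; rewrite (le_trans (Im_le_cmod _))// fC.
Qed.

Lemma loc_bounded_cst c : loc_bounded (fun=> c).
Proof. by split; [exact: cmeasurable_cst|move=> T; exists (cmod c); exact: aeW]. Qed.

Lemma loc_boundedD f g : loc_bounded f -> loc_bounded g ->
  loc_bounded (fun x => f x + g x).
Proof.
move=> [mf bf] [mg bg]; split; first exact: cmeasurableD.
move=> T; have [C fC] := bf T; have [D gD] := bg T; exists (C + D).
move: (ae_and fC gD); apply: ae_imp => x [{}fC {}gD] xT.
by rewrite (le_trans (cmodD _ _))// lerD ?fC ?gD.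
Qed.

Lemma loc_boundedM f g : loc_bounded f -> loc_bounded g ->
  loc_bounded (fun x => f x * g x).
Proof.
move=> [mf bf] [mg bg]; split; first exact: cmeasurableM.
move=> T; have [C fC] := bf T; have [D gD] := bg T; exists (C * D).
move: (ae_and fC gD); apply: ae_imp => x [{}fC {}gD] xT.
by rewrite cmodM ler_pM ?cmod_ge0 ?fC ?gD.
Qed.

Lemma loc_boundedN f : loc_bounded f -> loc_bounded (fun x => - f x).
Proof.
move=> lf; rewrite (_ : (fun x => _) = (fun x => (-1) * f x)).
  by apply: loc_boundedM => //; exact: loc_bounded_cst.
by apply/funext => x; rewrite mulN1r.
Qed.

Lemma loc_bounded_sum n (F : nat -> R -> R[i]) :
  (forall j, (j < n)%N -> loc_bounded (F j)) ->
  loc_bounded (fun x => \sum_(j < n) F j x).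
Proof.
elim: n => [|n IH] Fn.
  by under eq_fun do rewrite big_ord0; exact: loc_bounded_cst.
under eq_fun do rewrite big_ord_recr/=; apply: loc_boundedD; last exact: Fn.
by apply: IH => j jn; apply: Fn; rewrite (ltn_trans jn).
Qed.

Lemma loc_bounded_exp f n : loc_bounded f -> loc_bounded (fun x => f x ^+ n).
Proof.
move=> lf; elim: n => [|n IH].
  by under eq_fun do rewrite expr0; exact: loc_bounded_cst.
by under eq_fun do rewrite exprS; exact: loc_boundedM.
Qed.

Lemma loc_bounded_coef (a : X R) i : loc_bounded (a i).
Proof.
split; first exact: coef_measurable.
have [l l0 al] := coef_bounded a; move=> T; exists (l ^+ i.+1).
by have /ess_supP := al i; apply: ae_imp => x; rewrite lee_fin.
Qed.

(** Lipschitz on bounded sets suffices; this is how indefinite integrals are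
    shown to be integrable again. *)
Lemma loc_bounded_dist f : (forall T : R, exists K, forall x y,
    `|x| <= T -> `|y| <= T -> cmod (f x - f y) <= K * `|x - y|) -> loc_bounded f.
Proof.
move=> fK.
have K0 T : exists2 K, 0 <= K & forall x y,
    `|x| <= T -> `|y| <= T -> cmod (f x - f y) <= K * `|x - y|.
  have [K TK] := fK T; exists `|K| => // x y xT yT.
  by rewrite (le_trans (TK _ _ xT yT))// ler_wpM2r// ler_norm.
have cc (p : R[i] -> R) : (forall z w, `|p z - p w| <= cmod (z - w)) ->
    continuous (fun x => p (f x)).
  move=> pl x; have [K K0' xK] := K0 (`|x| + 1).
  apply/cvgrPdist_lt => e e0.
  have K1 : 0 < K + 1 by lra.
  near=> y; rewrite (le_lt_trans (pl _ _))// (le_lt_trans (xK _ _ _ _))//.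
  - by rewrite lerDl.
  - have : `|x - y| < 1 by near: y; apply: cvgr_dist_lt => //.
    by have := lerB_dist y x; rewrite (distrC y x); lra.
  - have /lt_le_trans : `|x - y| < e / (K + 1).
      by near: y; apply: cvgr_dist_lt => //; rewrite divr_gt0.
    move=> /(_ _ (lexx _)); rewrite ltr_pdivlMr// => xy.
    by have := normr_ge0 (x - y); nra.
split.
  split; apply: continuous_measurable_fun; apply: cc => z w.
    by rewrite -cReN -cReD Re_le_cmod.
  by rewrite -cImN -cImD Im_le_cmod.
move=> T; have [K K0' TK] := K0 T; exists (cmod (f 0) + K * T); apply: aeW => x xT.
have T0 : 0 <= T by rewrite (le_trans _ xT).
rewrite -[f x](subrK (f 0)) (le_trans (cmodD _ _))// addrC lerD2l.
by rewrite (le_trans (TK _ _ _ _)) ?normr0// subr0 ler_wpM2l.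
Unshelve. all: by end_near. Qed.

Lemma cintD s t f g : loc_bounded f -> loc_bounded g ->
  cint s t (fun x => f x + g x) = cint s t f + cint s t g.
Proof.
move=> lf lg; apply: complexP; rewrite /cintegral/= ?[RHS]cReD ?[RHS]cImD/=.
  rewrite -RintegralD//; try exact/rloc_bounded_integrable/loc_bounded_Re.
  by apply: eq_Rintegral => x _; rewrite cReD.
rewrite -RintegralD//; try exact/rloc_bounded_integrable/loc_bounded_Im.
by apply: eq_Rintegral => x _; rewrite cImD.
Qed.

Lemma cintZ s t c f : loc_bounded f ->
  cint s t (fun x => c * f x) = c * cint s t f.
Proof.
move=> lf.
have lr := @rloc_bounded_integrable _ _ s t (loc_bounded_Re lf).
have li := @rloc_bounded_integrable _ _ s t (loc_bounded_Im lf).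
have lc k h : lebesgue_measure.-integrable `[s, t] (EFin \o h) ->
    lebesgue_measure.-integrable `[s, t] (EFin \o (fun x => k * h x)).
  by move=> ih; exact: (@integrableZl _ _ R _ _ _ k (EFin \o h)).
case: c => c1 c2; apply: complexP; rewrite /cintegral/=.
  rewrite -!RintegralZl// -RintegralB//; try exact: lc.
  by apply: eq_Rintegral => x _; case: (f x).
rewrite -!RintegralZl// -RintegralD//; try exact: lc.
by apply: eq_Rintegral => x _; case: (f x).
Qed.

Lemma cintN s t f : loc_bounded f ->
  cint s t (fun x => - f x) = - cint s t f.
Proof.
by move=> lf; rewrite -mulN1r -cintZ//; congr cintegral; apply/funext => x; rewrite mulN1r.
Qed.

Lemma cintB s t f g : loc_bounded f -> loc_bounded g ->
  cint s t (fun x => f x - g x) = cint s t f - cint s t g.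
Proof. by move=> lf lg; rewrite cintD ?cintN//; exact: loc_boundedN. Qed.

Lemma eq_cint s t f g : (forall x, s <= x <= t -> f x = g x) -> cint s t f = cint s t g.
Proof.
move=> fg; rewrite /cintegral; congr (_ +i* _); apply: eq_Rintegral => x;
by rewrite inE/= in_itv/= => /fg ->.
Qed.

Lemma cint_cst0 s t : cint s t (fun=> 0) = 0.
Proof. by rewrite /cintegral/= !Rintegral_cst// !mul0r. Qed.

Lemma cint_sum s t n (F : nat -> R -> R[i]) :
  (forall j, (j < n)%N -> loc_bounded (F j)) ->
  cint s t (fun x => \sum_(j < n) F j x) = \sum_(j < n) cint s t (F j).
Proof.
elim: n => [|n IH] Fn.
  by rewrite big_ord0 -[RHS](cint_cst0 s t); apply: eq_cint => x _; rewrite big_ord0.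
rewrite big_ord_recr/= -IH; last by move=> j jn; apply: Fn; rewrite (ltn_trans jn).
rewrite -cintD; last 2 first.
- by apply: loc_bounded_sum => j jn; apply: Fn; rewrite (ltn_trans jn).
- exact: Fn.
by apply: eq_cint => x _; rewrite big_ord_recr.
Qed.

Lemma cint_split s t u f : loc_bounded f -> s <= t -> t <= u ->
  cint s u f = cint s t f + cint t u f.
Proof.
move=> lf st tu; apply: complexP; rewrite /cintegral/= ?[RHS]cReD ?[RHS]cImD/=.
  exact: (rint_split (loc_bounded_Re lf)).
exact: (rint_split (loc_bounded_Im lf)).
Qed.

Lemma cint_id s f : cint s s f = 0.
Proof. by rewrite /cintegral set_itv1 !Rintegral_set1. Qed.

Lemma cint_gt s t f : t < s -> cint s t f = 0.
Proof. by move=> ts; rewrite /cintegral set_itv_ge ?bnd_simp ?lt_geF// !Rintegral_set0. Qed.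

(** Real and imaginary parts are bounded separately, which costs a factor 2 but
    avoids the triangle inequality for complex integrals. *)
Lemma cint_le s t f (g G : R -> R) : loc_bounded f -> s <= t ->
  continuous g -> (forall x, 0 <= g x) ->
  (forall x : R, is_derive x (1 : R) G (g x)) ->
  {ae mu, forall x, x \in `]s, t[ -> cmod (f x) <= g x} ->
  cmod (cint s t f) <= 2 * (G t - G s).
Proof.
move=> lf st cg g0 Gg fg; rewrite (le_trans (cmod_le_ReIm _))// mulrDl mul1r lerD//=.
  apply: (rint_le (loc_bounded_Re lf)) => //.
  by move: fg; apply: ae_imp => x fg /fg; apply: le_trans; exact: Re_le_cmod.
apply: (rint_le (loc_bounded_Im lf)) => //.
by move: fg; apply: ae_imp => x fg /fg; apply: le_trans; exact: Im_le_cmod.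
Qed.

Lemma cint_le_cst s t f C : loc_bounded f -> s <= t -> 0 <= C ->
  {ae mu, forall x, x \in `]s, t[ -> cmod (f x) <= C} ->
  cmod (cint s t f) <= 2 * C * (t - s).
Proof.
move=> lf st C0 fg; rewrite (le_trans (cmod_le_ReIm _))// -mulrA mulrDl mul1r lerD//=.
  apply: (rint_le_cst (loc_bounded_Re lf)) => //.
  by move: fg; apply: ae_imp => x fg /fg; apply: le_trans; exact: Re_le_cmod.
apply: (rint_le_cst (loc_bounded_Im lf)) => //.
by move: fg; apply: ae_imp => x fg /fg; apply: le_trans; exact: Im_le_cmod.
Qed.

Lemma cint_dist f b T : loc_bounded f -> exists K, forall x y,
  `|x| <= T -> `|y| <= T -> cmod (cint x b f - cint y b f) <= K * `|x - y|.
Proof.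
move=> lf; pose T' := Num.max T `|b|.
have [C0 fC0] := lf.2 T'; pose C := `|C0|.
have fC : {ae mu, forall x, `|x| <= T' -> cmod (f x) <= C}.
  by move: fC0; apply: ae_imp => x fC /fC; move/le_trans; apply; exact: ler_norm.
exists (2 * C).
(* Beyond [b] the interval of integration is empty. *)
have minE x : cint x b f = cint (Num.min x b) b f.
  by case: (leP x b) => // xb; rewrite cint_id cint_gt.
suff W x y : `|x| <= T -> `|y| <= T -> x <= y ->
    cmod (cint x b f - cint y b f) <= 2 * C * `|x - y|.
  move=> x y xT yT; have [xy|/ltW yx] := leP x y; first exact: W.
  by rewrite cmodC distrC W.
move=> xT yT xy; rewrite minE [cint y _ _]minE.
have mxy : Num.min x b <= Num.min y b by rewrite le_min ge_min xy/= ge_min lexx orbT.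
rewrite (cint_split lf mxy); last by rewrite ge_min lexx orbT.
have H : cmod (cint (Num.min x b) (Num.min y b) f) <=
    2 * C * (Num.min y b - Num.min x b).
  apply: (cint_le_cst lf mxy); first exact: normr_ge0.
  move: fC; apply: ae_imp => z fC; rewrite in_itv/= => /andP[z1 z2]; apply: fC.
  rewrite /T' le_max.
  move: z1 z2; rewrite gt_min lt_min => /orP[z1|z1] /andP[z2 z3]; last first.
    by move: z1; rewrite ltNge (ltW z3).
  apply/orP; left; move: xT yT; rewrite !ler_norml => /andP[? ?] /andP[? ?].
  by apply/andP; split; lra.
rewrite addrK (le_trans H)//.
rewrite ler_wpM2l ?mulr_ge0 ?normr_ge0// distrC ger0_norm ?subr_ge0//.
by case: (lerP x b) => xb; case: (lerP y b) => yb; lra.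
Qed.

Lemma loc_bounded_cint f b : loc_bounded f -> loc_bounded (fun s => cint s b f).
Proof. by move=> lf; apply: loc_bounded_dist => T; exact: cint_dist. Qed.

End complex_integrals.

(** * Substitution and differentiation of complex integrals *)

Section substitution.
Context {R : realType}.
Let mu := @lebesgue_measure R.
Variables (g : R -> R) (c M : R).
Hypotheses (c0 : 0 < c) (mg : measurable_fun [set: R] g).
Hypothesis gl : forall a b, a < b ->
  (c%:E * lebesgue_measure (g @^-1` `]a, b]) = (b - a)%:E)%E.
Hypothesis gM : forall x, `|g x| <= 2 * `|x| + M.
Implicit Types f : R -> R[i].

Lemma loc_bounded_comp f : loc_bounded f -> loc_bounded (fun x => f (g x)).
Proof.
move=> [mf bf]; split; first exact: cmeasurable_comp.
move=> T; have [C fC] := bf (2 * T + M); exists C.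
have := lebesgue_null_comp c0 mg gl fC; apply: ae_imp => x /= {}fC xT.
by rewrite fC// (le_trans (gM _))// lerD2r ler_wpM2l.
Qed.

Lemma cint_subst f (s t s' t' : R) : loc_bounded f ->
  (forall x, (s <= g x <= t) = (s' <= x <= t')) ->
  cintegral `[s, t] f = cintegral `[s', t'] (fun x => c%:C * f (g x)).
Proof.
move=> lf st; have lfg := loc_bounded_comp lf.
rewrite (cintZ _ _ _ lfg).
pose T := `|s| + `|t| + `|s'| + `|t'|.
have gD : g @^-1` `[s, t] = `[s', t']%classic.
  by apply/seteqP; split => x /=; rewrite !in_itv/= st.
have inT (a b : R) x : `|a| + `|b| <= T -> x \in `[a, b] -> `|x| <= T.
  rewrite in_itv/= => abT /andP[ax xb]; rewrite (le_trans _ abT)//.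
  have := ler_norm (-a); have := ler_norm b; rewrite normrN ler_norml => ? ?.
  by have := normr_ge0 a; have := normr_ge0 b => ? ?; apply/andP; split; lra.
have stT x : x \in `[s, t] -> `|x| <= T.
  by apply: inT; rewrite /T -addrA lerDl addr_ge0.
have stT' x : x \in `[s', t'] -> `|x| <= T.
  by apply: inT; rewrite /T -addrA lerDr addr_ge0.
have subst h : rloc_bounded h -> rloc_bounded (fun x => h (g x)) ->
    Rintegral mu `[s, t] h = c * Rintegral mu `[s', t'] (fun x => h (g x)).
  move=> lh lhg; rewrite (@rint_subst R g c c0 mg gl h _ `[s', t'] T lh)//.
  by rewrite RintegralZl//; exact: rloc_bounded_integrable.
have := subst _ (loc_bounded_Re lf) (loc_bounded_Re lfg).
have := subst _ (loc_bounded_Im lf) (loc_bounded_Im lfg).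
rewrite /cintegral/= => -> ->; apply: complexP; rewrite /= !mul0r.
  by rewrite subr0.
by rewrite addr0.
Qed.
End substitution.

Section affine_substitution.
Context {R : realType}.
Let mu := @lebesgue_measure R.
Implicit Types (f : R -> R[i]) (d s t : R).

Let double_scale d (a b : R) : a < b ->
  (2%R%:E * lebesgue_measure ((fun x : R => (2 * x + d)%R) @^-1` `]a, b]) = (b - a)%:E)%E.
Proof.
move=> ab; rewrite (_ : _ @^-1` _ = [set` `](a - d) / 2, (b - d) / 2]]).
  rewrite lebesgue_measure_itv/= lte_fin ltr_pM2r ?invr_gt0// ltrD2r ab -EFinB -EFinM.
  by congr EFin; lra.
by apply/seteqP; split => x /=; rewrite !in_itv/= => /andP[? ?];
  apply/andP; split; lra.
Qed.

Let reflect_scale d (a b : R) : a < b ->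
  (1%R%:E * lebesgue_measure ((fun x : R => (d - x)%R) @^-1` `]a, b]) = (b - a)%:E)%E.
Proof.
move=> ab; rewrite (_ : _ @^-1` _ = [set` `[d - b, d - a[]).
  rewrite lebesgue_measure_itv/= lte_fin ltrD2l ltrN2 ab -EFinB mul1e.
  by congr EFin; lra.
by apply/seteqP; split => x /=; rewrite !in_itv/= => /andP[? ?];
  apply/andP; split; lra.
Qed.

Let measurable_double d : measurable_fun [set: R] (fun x => 2 * x + d).
Proof. by apply: measurable_funD => //; exact: measurable_funM. Qed.

Let measurable_reflect d : measurable_fun [set: R] (fun x => d - x).
Proof. exact: measurable_funB. Qed.

Lemma ae_affine d (P : R -> Prop) : {ae lebesgue_measure, forall x, P x} ->
  {ae lebesgue_measure, forall x, P (2 * x + d)}.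
Proof.
apply: (@lebesgue_null_comp R (fun x => 2 * x + d) 2) => //.
exact: double_scale.
Qed.

Lemma cint_double f d s t : loc_bounded f ->
  cintegral `[2 * s + d, 2 * t + d] f = cintegral `[s, t] (fun x => 2 * f (2 * x + d)).
Proof.
move=> lf; rewrite (@cint_subst R (fun x => 2 * x + d) 2 `|d| (ltr0Sn _ _)
  (measurable_double d) (double_scale d) _ f _ _ s t lf)//.
- by apply: eq_cint => x _; rewrite rmorph_nat.
- by move=> x; rewrite (le_trans (ler_normD _ _))// normrM ger0_norm.
- by move=> x; rewrite !lerD2r !ler_pM2l.
Qed.

Lemma cint_reflect f d s t : loc_bounded f ->
  cintegral `[d - t, d - s] f = cintegral `[s, t] (fun x => f (d - x)).
Proof.
move=> lf; rewrite (@cint_subst R (fun x => d - x) 1 `|d| ltr01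
  (measurable_reflect d) (reflect_scale d) _ f _ _ s t lf)//.
- by apply: eq_cint => x _; rewrite mul1r.
- move=> x; rewrite (le_trans (ler_normB _ _))// addrC lerD2r.
  by rewrite ler_peMl// ler1n.
- by move=> x; rewrite !lerD2l !lerN2 andbC.
Qed.

Lemma loc_bounded_double f d : loc_bounded f -> loc_bounded (fun x => f (2 * x + d)).
Proof.
apply: (loc_bounded_comp (ltr0Sn _ 1) (measurable_double d) (double_scale d) (M := `|d|)).
by move=> x; rewrite (le_trans (ler_normD _ _))// normrM ger0_norm.
Qed.

Lemma loc_bounded_reflect f d : loc_bounded f -> loc_bounded (fun x => f (d - x)).
Proof.
apply: (loc_bounded_comp ltr01 (measurable_reflect d) (reflect_scale d) (M := `|d|)).
move=> x; rewrite (le_trans (ler_normB _ _))// addrC lerD2r.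
by rewrite ler_peMl// ler1n.
Qed.

End affine_substitution.

Section complex_derivatives.
Context {R : realType}.
Let mu := @lebesgue_measure R.
Implicit Types (f g : R -> R[i]) (x s t : R) (c d e z : R[i]).

Lemma is_cderive_cst x c : is_cderive x (fun=> c) 0.
Proof. by split; exact: is_derive_cst. Qed.

Lemma is_cderiveD x f g d e : is_cderive x f d -> is_cderive x g e ->
  is_cderive x (fun y => f y + g y) (d + e).
Proof.
move=> [fr fi] [gr gi]; split.
  rewrite (_ : (fun y => _) = (fun y => complex.Re (f y)) + (fun y => complex.Re (g y))).
    by rewrite cReD; exact: is_deriveD.
  by apply/funext => y; rewrite cReD.
rewrite (_ : (fun y => _) = (fun y => complex.Im (f y)) + (fun y => complex.Im (g y))).
  by rewrite cImD; exact: is_deriveD.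
by apply/funext => y; rewrite cImD.
Qed.

Lemma is_cderiveN x f d : is_cderive x f d -> is_cderive x (fun y => - f y) (- d).
Proof.
move=> [fr fi]; split.
  rewrite (_ : (fun y => _) = - (fun y => complex.Re (f y))).
    by rewrite cReN; exact: is_deriveN.
  by apply/funext => y; rewrite cReN.
rewrite (_ : (fun y => _) = - (fun y => complex.Im (f y))).
  by rewrite cImN; exact: is_deriveN.
by apply/funext => y; rewrite cImN.
Qed.

Lemma is_cderiveM x f g d e : is_cderive x f d -> is_cderive x g e ->
  is_cderive x (fun y => f y * g y) (d * g x + f x * e).
Proof.
move=> [fr fi] [gr gi]; split.
  rewrite (_ : (fun y => _) = (fun y => complex.Re (f y)) * (fun y => complex.Re (g y)) -
     (fun y => complex.Im (f y)) * (fun y => complex.Im (g y))); last first.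
    by apply/funext => y; rewrite cReM.
  apply: is_derive_eq.
  by case: (f x) (g x) d e {fr fi gr gi} => [a b] [a' b'] [u v] [u' v'];
    rewrite /GRing.scale/=; ring.
rewrite (_ : (fun y => _) = (fun y => complex.Re (f y)) * (fun y => complex.Im (g y)) +
     (fun y => complex.Im (f y)) * (fun y => complex.Re (g y))); last first.
  by apply/funext => y; rewrite cImM.
apply: is_derive_eq.
by case: (f x) (g x) d e {fr fi gr gi} => [a b] [a' b'] [u v] [u' v'];
  rewrite /GRing.scale/=; ring.
Qed.

Lemma is_cderiveX x f d n : is_cderive x f d ->
  is_cderive x (fun y => f y ^+ n.+1) (n.+1%:R * f x ^+ n * d).
Proof.
move=> fd; elim: n => [|n IH].
  rewrite expr0 !mul1r (_ : (fun y => _) = f)//.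
have := is_cderiveM fd IH.
rewrite (_ : (fun y => f y * f y ^+ n.+1) = (fun y => f y ^+ n.+2)); last first.
  by apply/funext => y; rewrite -exprS.
congr is_cderive; rewrite [in RHS]exprS -[in RHS]natr1 exprS; ring.
Qed.

Lemma is_cderive_sum x n (F : nat -> R -> R[i]) (d : nat -> R[i]) :
  (forall j, (j < n)%N -> is_cderive x (F j) (d j)) ->
  is_cderive x (fun y => \sum_(j < n) F j y) (\sum_(j < n) d j).
Proof.
elim: n => [|n IH] Fd.
  by under eq_fun do rewrite big_ord0; rewrite big_ord0; exact: is_cderive_cst.
under eq_fun do rewrite big_ord_recr/=; rewrite big_ord_recr/=.
apply: is_cderiveD; last exact: Fd.
by apply: IH => j jn; apply: Fd; rewrite (ltn_trans jn).
Qed.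

Lemma near_is_cderive x f g d : (\forall y \near x, f y = g y) ->
  is_cderive x f d -> is_cderive x g d.
Proof.
move=> fg [fr fi]; split.
  by apply: near_eq_is_derive fr; apply: filterS fg => y /= ->.
by apply: near_eq_is_derive fi; apply: filterS fg => y /= ->.
Qed.

Lemma is_cderive_affine x f d (b : R) : is_cderive (2 * x + b) f d ->
  is_cderive x (fun y => f (2 * y + b)) (2 * d).
Proof.
have dg : is_derive x (1 : R) (fun y : R => 2 * y + b) 2.
  have := is_deriveD (is_deriveZ 2 (is_derive_id x (1 : R))) (is_derive_cst b x (1 : R)).
  by move=> h; apply: is_derive_eq h _; rewrite addr0 /= /GRing.scale/= mulr1.
move=> [fr fi]; split.
  have h : is_derive x (1 : R) (fun y => complex.Re (f (2 * y + b))) (complex.Re d * 2).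
    exact: (@is_derive1_comp R (fun y => complex.Re (f y)) (fun y => 2 * y + b) x _ _ fr dg).
  by apply: is_derive_eq h _; case: d {fr fi} => u v /=; ring.
have h : is_derive x (1 : R) (fun y => complex.Im (f (2 * y + b))) (complex.Im d * 2).
  exact: (@is_derive1_comp R (fun y => complex.Im (f y)) (fun y => 2 * y + b) x _ _ fi dg).
by apply: is_derive_eq h _; case: d {fr fi} => u v /=; ring.
Qed.

(** Lebesgue differentiation of an indefinite integral. *)
Lemma ae_is_cderive_cint f s t : loc_bounded f ->
  {ae mu, forall x, s < x -> x < t ->
     is_cderive x (fun y => cintegral `[y, t] f) (- f x)}.
Proof.
move=> lf.
have H h : rloc_bounded h -> {ae mu, forall x, s < x -> x < t ->
    is_derive x (1 : R) (fun y => \int[mu]_(x in `[y, t]) h x) (- h x)}.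
  move=> lh; have int y : mu.-integrable [set` Interval (BLeft s) (BRight y)] (EFin \o h).
    exact: rloc_bounded_integrable.
  have := FTC1 int (rloc_bounded_locally_integrable lh).
  apply: ae_imp => x /= dF sx xt.
  have [|dF1 dF2] := dF; first by rewrite lte_fin.
  set F := (fun y => _) in dF1 dF2.
  have Fd : is_derive x (1 : R) F (h x).
    by apply: (DeriveDef dF1); rewrite -derive1E; exact: dF2.
  have := is_deriveD (is_derive_cst (F t) x (1 : R)) (is_deriveN Fd).
  rewrite add0r; apply: near_eq_is_derive.
  near=> y; rewrite /F; apply/eqP; rewrite subr_eq addrC; apply/eqP.
  have : y \in `]s, t[ by near: y; apply: near_in_itvoo; rewrite in_itv/= sx.
  by rewrite in_itv/= => /andP[/ltW sy /ltW yt]; exact: rint_split.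
have := ae_and (H _ (loc_bounded_Re lf)) (H _ (loc_bounded_Im lf)).
apply: ae_imp => x /= [hr hi] sx xt; split; rewrite ?cReN ?cImN.
  exact: hr.
exact: hi.
Unshelve. all: by end_near. Qed.

Lemma rlipschitz_derive_bound (h : R -> R) (K e s t : R) :
  (forall x y, x \in `[s, t] -> y \in `[s, t] -> `|h x - h y| <= K * `|x - y|) ->
  0 <= e -> s <= t ->
  {ae mu, forall x, x \in `]s, t[ -> exists2 d : R, is_derive x (1 : R) h d & `|d| <= e} ->
  `|h t - h s| <= e * (t - s).
Proof.
move=> hK e0 st hd.
have ct x : clamp s t x \in `[s, t] by rewrite in_itv/= clamp_itv.
rewrite -[in h t](@clamp_id _ s t t)// -[in h s](@clamp_id _ s t s)//.
pose k x := h (clamp s t x); rewrite -/(k t) -/(k s).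
apply: (@lipschitz_derive_bound _ k `|K|) => //.
  move=> x y; rewrite (le_trans (hK _ _ (ct _) (ct _)))//.
  rewrite (le_trans (ler_wpM2r _ (ler_norm K)))//.
  by rewrite ler_wpM2l// clamp_lipschitz.
move: hd; apply: ae_imp => x /= + xst => /(_ xst)[d hd de]; exists d => //.
apply: near_eq_is_derive hd.
have : \forall y \near x, y \in `]s, t[ by exact: near_in_itvoo.
apply: filterS => y; rewrite in_itv/= => /andP[/ltW sy /ltW yt].
by rewrite /k clamp_id.
Qed.

(** The factor 2 comes from bounding real and imaginary parts separately. *)
Lemma cderive_bound f (K e s t : R) :
  (forall x y, x \in `[s, t] -> y \in `[s, t] -> cmod (f x - f y) <= K * `|x - y|) ->
  0 <= e -> s <= t ->
  {ae mu, forall x, x \in `]s, t[ -> exists2 d, is_cderive x f d & cmod d <= e} ->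
  cmod (f t - f s) <= 2 * e * (t - s).
Proof.
move=> fK e0 st fd.
rewrite (le_trans (cmod_le_ReIm _))// cReD cImD cReN cImN -mulrA mulrDl mul1r lerD//.
  apply: (@rlipschitz_derive_bound (fun x => complex.Re (f x)) K) => //.
    move=> x y xst yst; rewrite -cReN -cReD.
    by rewrite (le_trans (Re_le_cmod _))// fK.
  move: fd; apply: ae_imp => x fd /fd[d [dr di] de]; exists (complex.Re d) => //.
  by rewrite (le_trans (Re_le_cmod _)).
apply: (@rlipschitz_derive_bound (fun x => complex.Im (f x)) K) => //.
  move=> x y xst yst; rewrite -cImN -cImD.
  by rewrite (le_trans (Im_le_cmod _))// fK.
move: fd; apply: ae_imp => x fd /fd[d [dr di] de]; exists (complex.Im d) => //.
by rewrite (le_trans (Im_le_cmod _)).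
Qed.
End complex_derivatives.

(** * Iterated integrals as noncommutative power series *)

Section noncommutative_series.
Context {K : comNzRingType}.
Implicit Types (S T U : seq nat -> K) (w : seq nat).

(** Noncommutative power series are encoded as functions on words; this is
    their product. *)
Definition ncmul S T w : K := \sum_(k < (size w).+1) S (take k w) * T (drop k w).

Definition ncone w : K := (w == [::])%:R.

Lemma ncmul_nil S T : ncmul S T [::] = S [::] * T [::].
Proof. by rewrite /ncmul big_ord_recl big_ord0 addr0. Qed.

Lemma ncmul_cons S T i w :
  ncmul S T (i :: w) = S [::] * T (i :: w) + ncmul (fun u => S (i :: u)) T w.
Proof. by rewrite /ncmul big_ord_recl. Qed.

Lemma ncmul_linear (c : K) S T U w :
  ncmul (fun u => c * S u + T u) U w = c * ncmul S U w + ncmul T U w.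
Proof.
rewrite /ncmul mulr_sumr -big_split/=; apply: eq_bigr => k _.
by rewrite mulrDl mulrA.
Qed.

Lemma eq_ncmul S S' T T' : S =1 S' -> T =1 T' -> ncmul S T =1 ncmul S' T'.
Proof. by move=> SS TT w; apply: eq_bigr => k _; rewrite SS TT. Qed.

(** Induction on the word, with [S] generalised: removing the first letter either
    leaves the first factor empty or shortens it. *)
Lemma ncmulA S T U w : ncmul (ncmul S T) U w = ncmul S (ncmul T U) w.
Proof.
elim: w S => [|i w IH] S; first by rewrite !ncmul_nil mulrA.
rewrite !ncmul_cons ncmul_nil mulrDr -IH.
rewrite (@eq_ncmul _ (fun u => S [::] * T (i :: u) + ncmul (fun u => S (i :: u)) T u) _ U)//.
  by rewrite ncmul_linear !addrA mulrA.
by move=> u; rewrite ncmul_cons.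
Qed.

Lemma ncmul1 S w : ncmul S ncone w = S w.
Proof.
elim: w S => [|i w IH] S; first by rewrite ncmul_nil /ncone eqxx mulr1.
by rewrite ncmul_cons IH /ncone mulr0 add0r.
Qed.

Lemma mul1nc S w : ncmul ncone S w = S w.
Proof.
case: w => [|i w]; first by rewrite ncmul_nil /ncone eqxx mul1r.
rewrite ncmul_cons /ncone eqxx mul1r /ncmul big1 ?addr0// => k _.
by rewrite mul0r.
Qed.

End noncommutative_series.

Section iterated_integrals.
Context {R : realType}.
Implicit Types (a b : X R) (w u v : seq nat) (s t : R).

Let pi2_gt0 : 0 < 2 * pi :> R. Proof. by rewrite mulr_gt0// pi_gt0. Qed.

Lemma loc_bounded_iterint a w : loc_bounded (fun s => iterint a s w).
Proof.
elim: w => [|i w IH]/=; first exact: loc_bounded_cst.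
by apply: loc_bounded_cint; apply: loc_boundedM => //; exact: loc_bounded_coef.
Qed.

Lemma iterint_2pi a w : iterint a (2 * pi) w = ncone w.
Proof. by case: w => [|i w] //=; rewrite /ncone ?eqxx//= cint_id. Qed.

(** Endpoints must be exempted: the concatenation of two paths and the
    representative modulo [2 pi] are not given by the expected formulas there. *)
Lemma eq_cint_oo s t (f g : R -> R[i]) : loc_bounded f -> loc_bounded g -> s <= t ->
  (forall x, s < x < t -> f x = g x) -> cintegral `[s, t] f = cintegral `[s, t] g.
Proof.
move=> lf lg st fg; apply/eqP; rewrite -subr_eq0; apply/eqP/cmod_eq0.
rewrite -cintB//; apply/eqP; rewrite eq_le cmod_ge0 andbT.
rewrite -[leRHS](_ : 2 * 0 * (t - s) = 0); last by rewrite mulr0 mul0r.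
apply: cint_le_cst => //.
  by apply: loc_boundedD => //; exact: loc_boundedN.
by apply: aeW => x; rewrite in_itv/= => /fg ->; rewrite subrr cmod0.
Qed.

Lemma cint_ncmul s t (f : R -> R[i]) (S : R -> seq nat -> R[i]) (T : seq nat -> R[i]) w :
  loc_bounded f -> (forall u, loc_bounded (fun y => S y u)) ->
  cintegral `[s, t] (fun y => f y * ncmul (S y) T w) =
  ncmul (fun u => cintegral `[s, t] (fun y => f y * S y u)) T w.
Proof.
move=> lf lS.
have l k : loc_bounded (fun y => T (drop k w) * (f y * S y (take k w))).
  by apply: loc_boundedM; [exact: loc_bounded_cst|exact: loc_boundedM].
rewrite (@eq_cint _ _ _ _
    (fun y => \sum_(k < (size w).+1) T (drop k w) * (f y * S y (take k w)))).
  rewrite (@cint_sum _ s t _ (fun k y => T (drop k w) * (f y * S y (take k w))))//.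
  apply: eq_bigr => k _; rewrite mulrC.
  by rewrite cintZ//; exact: loc_boundedM.
move=> y _; rewrite mulr_sumr; apply: eq_bigr => k _.
by ring.
Qed.

Lemma loc_bounded_ncmul (S : R -> seq nat -> R[i]) (T : seq nat -> R[i]) w :
  (forall u, loc_bounded (fun y => S y u)) ->
  loc_bounded (fun y => ncmul (S y) T w).
Proof.
move=> lS; apply: (@loc_bounded_sum _ _ (fun k y => S y (take k w) * T (drop k w))).
by move=> k _; apply: loc_boundedM => //; exact: loc_bounded_cst.
Qed.

(** Both sides, as series in noncommuting variables [X_i], solve the linear
    equation [B' = - (\sum_i a_i X_i) B] in [t] and agree at [t = 0]. At
    [t = 2 pi] this says that inverting a path inverts its series. *)
Lemma iterint_inv a t w : 0 <= t <= 2 * pi ->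
  iterint a t w = ncmul (iterint (invX a) (2 * pi - t)) (iterint a 0) w.
Proof.
elim: w t => [|i w IH] t /andP[t0 t2]; first by rewrite ncmul_nil mul1r.
rewrite ncmul_cons [iterint (invX a) _ [::]]/= mul1r.
have laB : loc_bounded (fun x => a i x * iterint a x w).
  by apply: loc_boundedM; [exact: loc_bounded_coef|exact: loc_bounded_iterint].
have linv u : loc_bounded (fun y => iterint (invX a) (2 * pi - y) u).
  exact: (@loc_bounded_reflect R (fun s => iterint (invX a) s u) _ (loc_bounded_iterint _ _)).
rewrite [iterint a 0 (i :: w)]/= (cint_split laB t0 t2) -/iterint.
rewrite (@eq_ncmul _ _
  (fun u => - cintegral `[0, t] (fun y => a i y * iterint (invX a) (2 * pi - y) u)) _
  (iterint a 0)) => [|u|//].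
  have -> : ncmul (fun u => - cintegral `[0, t]
      (fun y => a i y * iterint (invX a) (2 * pi - y) u)) (iterint a 0) w =
      - cintegral `[0, t] (fun y => a i y * iterint a y w).
    rewrite (@eq_cint _ 0 t (fun y => a i y * iterint a y w)
       (fun y => a i y * ncmul (iterint (invX a) (2 * pi - y)) (iterint a 0) w)).
      rewrite cint_ncmul//; last exact: loc_bounded_coef.
      by rewrite /ncmul -sumrN; apply: eq_bigr => k _; rewrite mulNr.
    by move=> y /andP[y0 yt]; rewrite IH// y0 (le_trans yt).
  by rewrite /= addrAC subrr add0r.
rewrite /=; have := @cint_reflect R
  (fun x => inv_fun a i x * iterint (invX a) x u) (2 * pi) 0 t.
rewrite subr0 => ->; last first.
  apply: loc_boundedM; last exact: loc_bounded_iterint.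
  exact: (loc_bounded_coef (invX a)).
rewrite -cintN; last by apply: loc_boundedM => //; exact: loc_bounded_coef.
apply: eq_cint => y _; rewrite inv_funE opprB mulNr; congr (- (_ * _)).
by rewrite -[LHS](@coef_periodic _ a) subrK.
Qed.

Lemma ncmul_inv_l a w : ncmul (iterint (invX a) 0) (iterint a 0) w = ncone w.
Proof.
have := @iterint_inv a (2 * pi) w; rewrite lexx ltW//= => /(_ isT).
by rewrite subrr iterint_2pi => <-.
Qed.

Lemma iterint_invK a t w : iterint (invX (invX a)) t w = iterint a t w.
Proof.
elim: w t => //= i w IH t; apply: eq_cint => x _; rewrite IH; congr (_ * _).
by rewrite !inv_funE/= inv_funE !opprK.
Qed.

Lemma ncmul_inv_r a w : ncmul (iterint a 0) (iterint (invX a) 0) w = ncone w.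
Proof.
rewrite -(ncmul_inv_l (invX a)); apply: eq_ncmul => // u.
by rewrite iterint_invK.
Qed.

Lemma red_id t : 0 < t <= 2 * pi -> red t = t.
Proof.
move=> /andP[t0 t2]; rewrite /red (@ceil_def _ _ 1) ?subrr ?mul0r ?subr0//.
by rewrite divr_gt0//= ler_pdivrMr// mul1r.
Qed.

Let pi_gt0' : 0 < pi :> R. Proof. exact: pi_gt0. Qed.

(** On the second half only the second path is seen. *)
Lemma iterint_cat_right a b s w : pi <= s <= 2 * pi ->
  iterint (catX a b) s w = iterint b (2 * s - 2 * pi) w.
Proof.
elim: w s => //= i w IH s /andP[s1 s2].
have lb : loc_bounded (fun x => b i x * iterint b x w).
  by apply: loc_boundedM; [exact: loc_bounded_coef|exact: loc_bounded_iterint].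
rewrite [X in cintegral `[_, X] (fun x => b i x * _)](_ : _ = 2 * (2 * pi) - 2 * pi);
  last by ring.
rewrite cint_double//; apply: eq_cint_oo => //.
- apply: loc_boundedM; last exact: loc_bounded_iterint.
  exact: (loc_bounded_coef (catX a b)).
- apply: loc_boundedM; first exact: loc_bounded_cst.
  exact: loc_bounded_double lb.
move=> x /andP[sx x2]; rewrite IH; last by rewrite ltW ?(le_lt_trans s1)// ltW.
rewrite mulrA; congr (_ * _); rewrite cat_funE red_id; last first.
  by rewrite (ltW x2) andbT (lt_trans _ (le_lt_trans s1 sx)).
rewrite leNgt (le_lt_trans s1 sx)/=; congr (_ * _).
by rewrite -[RHS](@coef_periodic _ b) subrK.
Qed.

(** Chen's formula. The left endpoint moves in the first path so that induction
    on the word applies: integrating the formula for [w] against the first path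
    gives the one for [i :: w], the words read entirely in the second path being
    provided by the previous lemma. *)
Lemma iterint_cat_left a b s w : 0 <= s <= pi ->
  iterint (catX a b) s w = ncmul (iterint a (2 * s)) (iterint b 0) w.
Proof.
have pi2 : pi <= 2 * pi :> R by have := pi_gt0'; lra.
elim: w s => [|i w IH] s /andP[s0 s1]; first by rewrite ncmul_nil mul1r.
have la : forall u, loc_bounded (fun x => a i x * iterint a x u).
  by move=> u; apply: loc_boundedM; [exact: loc_bounded_coef|exact: loc_bounded_iterint].
have lc : loc_bounded (fun x => catX a b i x * iterint (catX a b) x w).
  apply: loc_boundedM; last exact: loc_bounded_iterint.
  exact: (loc_bounded_coef (catX a b)).
rewrite ncmul_cons mul1r [iterint (catX a b) _ _]/= (cint_split lc s1 pi2) addrC.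
congr (_ + _).
  have := @iterint_cat_right a b pi (i :: w); rewrite lexx pi2 => /(_ isT) /= ->.
  by rewrite subrr.
rewrite -[RHS]cint_ncmul; [|exact: loc_bounded_coef|by move=> u; exact: loc_bounded_iterint].
have lN : loc_bounded (fun y => a i y * ncmul (iterint a y) (iterint b 0) w).
  apply: loc_boundedM; first exact: loc_bounded_coef.
  by apply: loc_bounded_ncmul => u; exact: loc_bounded_iterint.
have := cint_double 0 s pi lN; rewrite !addr0 => ->.
apply: eq_cint_oo => //.
  by apply: loc_boundedM; [exact: loc_bounded_cst|exact: loc_bounded_double lN].
move=> x /andP[sx xpi]; rewrite IH; last by rewrite (ltW xpi) ltW// (le_lt_trans s0).
rewrite mulrA addr0; congr (_ * _); rewrite /= cat_funE red_id; last first.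
  by rewrite (le_lt_trans s0)//= ltW// (lt_le_trans xpi).
by rewrite (ltW xpi).
Qed.

Lemma iterint_cat a b w : iterint (catX a b) 0 w = ncmul (iterint a 0) (iterint b 0) w.
Proof. by rewrite iterint_cat_left ?mulr0// lexx ltW. Qed.

(** A series with constant term 1 is invertible, so a product [S(a) S(b)^-1] is 1
    exactly when [S(a) = S(b)]. *)
Lemma eqvX_iterint a b : eqvX a b <-> iterint a 0 =1 iterint b 0.
Proof.
split=> [ab w|ab [w w0]]; last first.
  rewrite /basic_integral/= iterint_cat (eq_ncmul ab (frefl _)) ncmul_inv_r.
  by rewrite /ncone (negbTE w0).
have abE : ncmul (iterint a 0) (iterint (invX b) 0) =1 ncone.
  move=> u; rewrite -iterint_cat; case: u => [|i u].
    by rewrite /ncone eqxx.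
  exact: (ab (exist _ (i :: u) isT)).
have -> : iterint a 0 w =
    ncmul (iterint a 0) (ncmul (iterint (invX b) 0) (iterint b 0)) w.
  by rewrite (eq_ncmul (frefl _) (ncmul_inv_l b)) ncmul1.
by rewrite -ncmulA (eq_ncmul abE (frefl _)) mul1nc.
Qed.

Lemma eqv_class_eq a b : eqvX a b -> eqv_class a = eqv_class b.
Proof.
move=> /eqvX_iterint ab; apply/seteqP; split => c /= /eqvX_iterint h;
  by apply/eqvX_iterint => w; rewrite -h ab.
Qed.

(** The functions defining the topology of G(X), with the empty word added to
    obtain a full noncommutative series. *)
Definition giter (g : GX R) w := iterint (reprX g) 0 w.

Lemma giter_classX a : giter (classX a) =1 iterint a 0.
Proof.
have := reprXK (classX a); move=> /(congr1 (@sval _ _))/= E.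
have : eqv_class (reprX (classX a)) a.
  by rewrite E; apply/eqvX_iterint.
by move=> /eqvX_iterint.
Qed.

(** The iterated integrals separate the points of G(X). *)
Lemma GX_eqP (g h : GX R) : giter g =1 giter h -> g = h.
Proof.
move=> gh; rewrite -(reprXK g) -(reprXK h).
have E : eqv_class (reprX g) = eqv_class (reprX h) by apply/eqv_class_eq/eqvX_iterint.
rewrite /classX; move: (ex_intro _ _ _) (ex_intro _ _ _); rewrite E => p q.
by congr exist; exact: Prop_irrelevance.
Qed.

Lemma giter_mulG (g h : GX R) : giter (mulG g h) =1 ncmul (giter g) (giter h).
Proof. by move=> w; rewrite giter_classX iterint_cat. Qed.

End iterated_integrals.

(** * Coefficients of the flow *)

Section flow_coefficients.
Context {K : comNzRingType}.
Implicit Types (S T : seq nat -> K).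

(** Recursion on the first letter of the words, bounded by [m] because the
    remaining weight [n' - i] is not structurally smaller than [n]. *)
Fixpoint flow_coef_rec (m : nat) S (n : nat) : K :=
  if n is n'.+1 then
    if m is m'.+1 then
      \sum_(i < n) (n - i)%:R * flow_coef_rec m' (fun w => S (nat_of_ord i :: w)) (n' - i)
    else 0
  else S [::].

(** The linear combination of the values of [S] on the words of weight [n]
    that gives the coefficient of [r ^ n.+1] in the first return map, a letter [i]
    having weight [i.+1]. The word [i1 ... ik] stands for the operator
    [D_i1 ... D_ik] with [D_i = r ^ i.+2 d/dr], and is weighted by the coefficient
    of [D_i1 ... D_ik r]. *)
Definition flow_coef S n := flow_coef_rec n S n.

Lemma flow_coef_recE m n S : (n <= m)%N -> flow_coef_rec m S n = flow_coef S n.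
Proof.
rewrite /flow_coef; elim/ltn_ind: n m S => -[|n] IH [|m] S //= nm.
apply: eq_bigr => i _; congr (_ * _).
by rewrite IH ?ltnS ?leq_subr ?(leq_trans (leq_subr _ _))// [RHS]IH// ?ltnS ?leq_subr.
Qed.

Lemma flow_coef0 S : flow_coef S 0 = S [::].
Proof. by []. Qed.

Lemma flow_coefS S n : flow_coef S n.+1 =
  \sum_(i < n.+1) (n.+1 - i)%:R * flow_coef (fun w => S (nat_of_ord i :: w)) (n - i).
Proof.
by rewrite /flow_coef/=; apply: eq_bigr => i _; rewrite flow_coef_recE ?leq_subr.
Qed.

Lemma eq_flow_coef S T n : S =1 T -> flow_coef S n = flow_coef T n.
Proof.
elim/ltn_ind: n S T => -[|n] IH S T ST; first exact: ST.
rewrite !flow_coefS; apply: eq_bigr => i _; congr (_ * _).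
by apply: IH => [|w]; rewrite ?ltnS ?leq_subr.
Qed.

Lemma flow_coef_zero S n : S =1 (fun=> 0) -> flow_coef S n = 0.
Proof.
elim/ltn_ind: n S => -[|n] IH S S0; first exact: S0.
by rewrite flow_coefS big1// => i _; rewrite IH ?mulr0// ?ltnS ?leq_subr.
Qed.

Lemma flow_coef_ncone n : flow_coef (@ncone K) n = (n == 0)%:R.
Proof.
case: n => [|n]; first by rewrite flow_coef0 /ncone eqxx.
by rewrite flow_coefS big1// => i _; rewrite flow_coef_zero ?mulr0.
Qed.

End flow_coefficients.

Section flow_coefficients_complex.
Context {R : realType}.
Implicit Types (a : X R) (s t : R).

Lemma loc_bounded_flow_coef (S : R -> seq nat -> R[i]) n :
  (forall u, loc_bounded (fun y => S y u)) ->
  loc_bounded (fun y => flow_coef (S y) n).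
Proof.
elim/ltn_ind: n S => -[|n] IH S lS; first exact: lS.
under eq_fun do rewrite flow_coefS.
apply: (@loc_bounded_sum _ _
  (fun i y => (n.+1 - i)%:R * flow_coef (fun w => S y (i :: w)) (n - i))).
move=> i _; apply: loc_boundedM; first exact: loc_bounded_cst.
by apply: (IH _ _ (fun y w => S y (i :: w))); rewrite ?ltnS ?leq_subr.
Qed.

Lemma cint_flow_coef s t (f : R -> R[i]) (S : R -> seq nat -> R[i]) n :
  loc_bounded f -> (forall u, loc_bounded (fun y => S y u)) ->
  flow_coef (fun w => cintegral `[s, t] (fun y => f y * S y w)) n =
  cintegral `[s, t] (fun y => f y * flow_coef (S y) n).
Proof.
move=> lf; elim/ltn_ind: n S => -[|n] IH S lS; first by [].
rewrite flow_coefS.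
have lSi i : loc_bounded (fun y => flow_coef (fun w => S y (i :: w)) (n - i)).
  exact: (@loc_bounded_flow_coef (fun y w => S y (i :: w))).
rewrite (@eq_cint _ s t _ (fun y => \sum_(i < n.+1)
    (n.+1 - i)%:R * (f y * flow_coef (fun w => S y (nat_of_ord i :: w)) (n - i)))).
  rewrite (@cint_sum _ s t _ (fun i y =>
    (n.+1 - i)%:R * (f y * flow_coef (fun w => S y (i :: w)) (n - i)))); last first.
    by move=> i _; apply: loc_boundedM; [exact: loc_bounded_cst|exact: loc_boundedM].
  apply: eq_bigr => i _; rewrite cintZ; last exact: loc_boundedM.
  congr (_ * _); apply: (IH _ _ (fun y w => S y (nat_of_ord i :: w))) => //.
  by rewrite ltnS leq_subr.
move=> y _; rewrite flow_coefS mulr_sumr; apply: eq_bigr => i _; ring.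
Qed.

(** The coefficients of the map sending the value at time [s] of a solution to
    its value at time [2 pi]. *)
Definition transport a n s : R[i] := flow_coef (iterint a s) n.

Lemma transport0 a s : transport a 0 s = 1.
Proof. by []. Qed.

Lemma loc_bounded_transport a n : loc_bounded (transport a n).
Proof. by apply: loc_bounded_flow_coef => u; exact: loc_bounded_iterint. Qed.

Lemma transportS_sum a n s : transport a n.+1 s = \sum_(i < n.+1)
  (n.+1 - i)%:R * cintegral `[s, 2 * pi] (fun x => a i x * transport a (n - i) x).
Proof.
rewrite /transport flow_coefS; apply: eq_bigr => i _; congr (_ * _).
by rewrite /= cint_flow_coef//; [exact: loc_bounded_coef|exact: loc_bounded_iterint].
Qed.

(** The transport equation [d/ds Psi_s = - (\sum_i a_i r ^ i.+2) d/dr Psi_s],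
    coefficient by coefficient and integrated. *)
Lemma transportS a n s : transport a n.+1 s = cintegral `[s, 2 * pi]
  (fun x => \sum_(i < n.+1) (n.+1 - i)%:R * (a i x * transport a (n - i) x)).
Proof.
have l i : loc_bounded (fun x => a i x * transport a (n - i) x).
  by apply: loc_boundedM; [exact: loc_bounded_coef|exact: loc_bounded_transport].
rewrite (@cint_sum _ s _ _ (fun i x => (n.+1 - i)%:R * (a i x * transport a (n - i) x))).
  by rewrite transportS_sum; apply: eq_bigr => i _; rewrite cintZ.
by move=> i _; apply: loc_boundedM => //; exact: loc_bounded_cst.
Qed.

Lemma transport_2pi a n : transport a n (2 * pi) = (n == 0)%:R.
Proof. by case: n => [|n]; rewrite ?transport0// transportS cint_id. Qed.

Lemma coef_ae_bound a : exists2 l : R, 0 < l &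
  {ae lebesgue_measure, forall x, forall i, cmod (a i x) <= l ^+ i.+1}.
Proof.
have [l l0 al] := coef_bounded a; exists l => //.
apply: ae_foralln => i; have /ess_supP := al i.
by apply: ae_imp => x; rewrite lee_fin.
Qed.

Lemma sum_half n : \sum_(i < n) 2^-1 ^+ i.+1 <= 1 :> R.
Proof.
suff -> : \sum_(i < n) 2^-1 ^+ i.+1 = 1 - 2^-1 ^+ n :> R.
  by rewrite gerBl exprn_ge0.
elim: n => [|n IH]; first by rewrite big_ord0 expr0 subrr.
by rewrite big_ord_recr/= IH !exprS; field.
Qed.

(** The recursion loses a factor [n] at each step, which the integral of an
    exponential of rate [2 n] gives back; the factor [2 ^+ n] absorbs the
    convolution with the geometric bounds on the coefficients. *)
Lemma transport_bound_exp a (l : R) n s : 0 < l ->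
  {ae lebesgue_measure, forall x, forall i, cmod (a i x) <= l ^+ i.+1} ->
  0 <= s <= 2 * pi ->
  cmod (transport a n s) <= (2 * l) ^+ n * expR (2 * n%:R * (2 * pi - s)).
Proof.
move=> l0 al; elim/ltn_ind: n s => -[|n] IH s /andP[s0 s2].
  by rewrite transport0 cmod1 expr0 mul1r mulr0 mul0r expR0.
rewrite transportS; set k : R := 2 * n.+1%:R.
have k0 : 0 < k by rewrite mulr_gt0.
have l20 : 0 <= 2 * l by rewrite mulr_ge0// ltW.
(* [g] dominates the integrand of [transportS], and [G] is a primitive of [g]. *)
pose g x := (2 * l) ^+ n.+1 * n.+1%:R * expR (k * (2 * pi - x)).
pose G x := - (2^-1 * (2 * l) ^+ n.+1 * expR (k * (2 * pi - x))).
have lt : loc_bounded (fun x => \sum_(i < n.+1) (n.+1 - i)%:R * (a i x * transport a (n - i) x)).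
  apply: (@loc_bounded_sum _ _ (fun i x => (n.+1 - i)%:R * (a i x * transport a (n - i) x))).
  move=> i _; apply: loc_boundedM; first exact: loc_bounded_cst.
  by apply: loc_boundedM; [exact: loc_bounded_coef|exact: loc_bounded_transport].
have expD (x : R) : is_derive x (1 : R) (fun y => expR (k * (2 * pi - y)))
    (expR (k * (2 * pi - x)) * - k).
  have h1 : is_derive x (1 : R) (fun y : R => k * (2 * pi - y)) (- k).
    have := is_deriveZ k (is_deriveB (is_derive_cst (2 * pi : R) x (1 : R))
      (is_derive_id x (1 : R))).
    by move=> h; apply: is_derive_eq h _; rewrite /GRing.scale/=; ring.
  exact: (@is_derive1_comp R expR (fun y => k * (2 * pi - y)) x _ _ _ h1).
have Gg (x : R) : is_derive x (1 : R) G (g x).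
  have := is_deriveN (is_deriveZ (2^-1 * (2 * l) ^+ n.+1) (expD x)).
  by move=> h; apply: is_derive_eq h _; rewrite /GRing.scale/= /g /k; field.
have cg : continuous g.
  move=> x; apply: differentiable_continuous; apply/derivable1_diffP.
  by have [] := is_deriveZ ((2 * l) ^+ n.+1 * n.+1%:R) (expD x).
have g0 x : 0 <= g x by rewrite /g !mulr_ge0 ?exprn_ge0 ?expR_ge0.
apply: le_trans (cint_le lt s2 cg g0 Gg _) _.
- move: al; apply: ae_imp => x al; rewrite in_itv/= => /andP[sx x2].
  apply: (@le_trans _ _ (\sum_(i < n.+1) g x * 2^-1 ^+ i.+1)); last first.
    by rewrite -mulr_sumr ler_piMr ?sum_half.
  apply: cmod_sum => i; rewrite !cmodM cmod_nat.
  have tb : cmod (transport a (n - i) x) <= (2 * l) ^+ (n - i) * expR (k * (2 * pi - x)).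
    apply: le_trans (IH (n - i)%N _ x _) _; first by rewrite ltnS leq_subr.
      by rewrite (ltW x2) (le_trans s0)// ltW.
    rewrite ler_wpM2l ?exprn_ge0// ler_expR /k ler_wpM2r ?subr_ge0 ?(ltW x2)//.
    by rewrite ler_wpM2l// ler_nat (leq_trans (leq_subr _ _)).
  apply: (@le_trans _ _ (n.+1%:R * (l ^+ i.+1 *
      ((2 * l) ^+ (n - i) * expR (k * (2 * pi - x)))))).
    by rewrite ler_pM ?mulr_ge0 ?cmod_ge0 ?ler_nat ?leq_subr// ler_pM ?cmod_ge0.
  rewrite /g le_eqVlt; apply/orP; left; apply/eqP.
  have -> : (2 * l) ^+ n.+1 = (2 * l) ^+ i.+1 * (2 * l) ^+ (n - i).
    by rewrite -exprD addSn subnKC// -ltnS.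
  have -> : l ^+ i.+1 = (2 * l) ^+ i.+1 * 2^-1 ^+ i.+1.
    by rewrite -exprMn mulrAC divff ?mul1r.
  ring.
rewrite /G subrr mulr0 expR0; have := expR_gt0 (k * (2 * pi - s)).
have := exprn_ge0 n.+1 l20; move: (expR _) ((2 * l) ^+ _) => E L L0 E0.
nra.
Qed.

End flow_coefficients_complex.

(** * Convergent power series *)

Section convergent_series.
Context {R : realType}.
Implicit Types (a : X R) (f g : Gc R) (r s : R[i]).

Lemma power_series_cvg (c : nat -> R[i]) (L : R) r :
  (forall k, cmod (c k) <= L ^+ k.+1) -> 0 <= L -> L * cmod r <= 2^-1 ->
  exists2 s, series (fun k => c k * r ^+ k.+2) @ \oo --> s &
    forall n, cmod (s - series (fun k => c k * r ^+ k.+2) n) <=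
      2 * cmod r * (L * cmod r) ^+ n.+1.
Proof.
move=> cL L0 rL.
have [|n|s s1 s2] := @geometric_series_cvg R (fun k => c k * r ^+ k.+2)
    (cmod r * (L * cmod r)) (L * cmod r).
- by rewrite mulr_ge0 ?cmod_ge0.
- rewrite cmodM cmodX.
  have -> : cmod r * (L * cmod r) * (L * cmod r) ^+ n = L ^+ n.+1 * cmod r ^+ n.+2.
    by rewrite exprMn !exprS; ring.
  by rewrite ler_wpM2r ?exprn_ge0 ?cmod_ge0.
- by exists s => // n; rewrite (le_trans (s2 n))// exprS !mulrA.
Qed.

Lemma Gc_coef_le f : exists2 L : R, 1 <= L & forall k, cmod (f k) <= L ^+ k.+1.
Proof.
have [L L1 fL] := Gc_coef_bound f; exists L => // k.
by rewrite (le_trans _ (fL k))// ler_peMl ?cmod_ge0// ler1n.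
Qed.

Lemma Gc_eval_bound f (L : R) r : (forall k, cmod (f k) <= L ^+ k.+1) ->
  0 <= L -> L * cmod r <= 2^-1 ->
  forall n, cmod (Gc_eval f r - (r + series (fun k => f k * r ^+ k.+2) n)) <=
    2 * cmod r * (L * cmod r) ^+ n.+1.
Proof.
move=> fL L0 rL n; have [s s1 s2] := power_series_cvg fL L0 rL.
rewrite /Gc_eval (cvg_lim (@complex_hausdorff R) s1).
by rewrite (_ : r + s - _ = s - series (fun k => f k * r ^+ k.+2) n)//; ring.
Qed.

Lemma Gc_eqP f g : dcoef f =1 dcoef g -> f = g.
Proof.
case: f g => [f fc] [g gc]/= /funext fg; case: _ / fg gc => gc.
by congr MkGc; exact: Prop_irrelevance.
Qed.

(** The identity theorem. If the coefficients of index less than [n] agree, the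
    difference of the sums is [(f n - g n) r ^+ n.+2] up to an error of order
    [r ^+ n.+3], and letting the radius tend to 0 forces [f n = g n]. *)
Lemma Gc_eval_inj f g :
  (\forall r \near (0 : R[i]), Gc_eval f r = Gc_eval g r) -> f = g.
Proof.
move=> /near0_cmodP[e e0 efg].
have [Lf Lf1 fL] := Gc_coef_le f; have [Lg Lg1 gL] := Gc_coef_le g.
pose L := Lf + Lg.
have L0 : 0 < L by rewrite /L; lra.
have {}fL k : cmod (f k) <= L ^+ k.+1.
  by rewrite (le_trans (fL k))// lerXn2r ?nnegrE /L; lra.
have {}gL k : cmod (g k) <= L ^+ k.+1.
  by rewrite (le_trans (gL k))// lerXn2r ?nnegrE /L; lra.
apply: Gc_eqP; elim/ltn_ind => n IH.
apply/eqP; rewrite -subr_eq0; apply/eqP/cmod_eq0/eqP; rewrite eq_le cmod_ge0 andbT.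
suff H (t : R) : 0 < t -> t < e -> L * t <= 2^-1 -> cmod (f n - g n) <= 4 * L ^+ n.+2 * t.
  have LX : 0 < 4 * L ^+ n.+2 by rewrite mulr_gt0// exprn_gt0.
  apply/ler_addgt0Pr => d d0; rewrite add0r.
  (* Small enough for both series to converge and for the error to be below [d]. *)
  pose t := Num.min (e / 2) (Num.min (2^-1 / L) (d / (4 * L ^+ n.+2))).
  have t0 : 0 < t by rewrite !lt_min !divr_gt0.
  have te : t < e by rewrite /t gt_min; apply/orP; left; lra.
  have tL : L * t <= 2^-1.
    by rewrite mulrC -ler_pdivlMr// /t !ge_min lexx/= orbT.
  rewrite (le_trans (H t t0 te tL))// mulrC -ler_pdivlMr//.
  by rewrite /t !ge_min lexx !orbT.
move=> t0 te tL; have tE : cmod t%:C = t by rewrite cmodR ger0_norm// ltW.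
have fB := @Gc_eval_bound f L t%:C fL (ltW L0); rewrite tE in fB.
have gB := @Gc_eval_bound g L t%:C gL (ltW L0); rewrite tE in gB.
have tX : 0 < t ^+ n.+2 by rewrite exprn_gt0.
have tn : cmod (t%:C ^+ n.+2) = t ^+ n.+2 by rewrite cmodX tE.
rewrite -(ler_pM2r tX) -[X in _ * X <= _]tn -cmodM.
move: (fB tL n.+1) (gB tL n.+1); rewrite -efg ?tE// /series/= !big_nat_recr//=.
have -> : \sum_(0 <= k < n) g k * t%:C ^+ k.+2 = \sum_(0 <= k < n) f k * t%:C ^+ k.+2.
  by rewrite !big_mkord; apply: eq_bigr => k _; rewrite IH.
move: (\sum_(0 <= k < n) _) => S fB' gB'.
have -> : (f n - g n) * t%:C ^+ n.+2 =
  (Gc_eval f t%:C - (t%:C + (S + g n * t%:C ^+ n.+2))) -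
  (Gc_eval f t%:C - (t%:C + (S + f n * t%:C ^+ n.+2))) by ring.
rewrite (le_trans (cmodB _ _))// (le_trans (lerD gB' fB'))// exprMn.
by rewrite le_eqVlt; apply/orP; left; apply/eqP; ring.
Qed.

Lemma transport_bound a (l : R) : 0 < l ->
  {ae lebesgue_measure, forall x, forall i, cmod (a i x) <= l ^+ i.+1} ->
  exists2 M : R, l <= M & forall n (s : R), 0 <= s <= 2 * pi ->
    cmod (transport a n s) <= M ^+ n.
Proof.
move=> l0 al; have p0 := pi_gt0 R.
pose E : R := expR (2 * (2 * pi)).
have E1 : 1 <= E by rewrite -expR0 ler_expR !mulr_ge0// ltW.
exists (2 * l * E); first by nra.
move=> n s s02; rewrite (le_trans (transport_bound_exp n l0 al s02))//.
have l20 : 0 <= 2 * l by rewrite mulr_ge0// ltW.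
rewrite [leRHS]exprMn ler_wpM2l ?exprn_ge0//.
rewrite /E -expRM_natl ler_expR (mulrC 2) -mulrA ler_wpM2l//.
by move: s02 => /andP[s0 s2]; lra.
Qed.

Definition return_coef a k : R[i] := flow_coef (iterint a 0) k.+1.

Lemma return_coef_bound a : exists2 L : R, 0 < L & forall k, cmod (return_coef a k) <= L ^+ k.+1.
Proof.
have [l l0 al] := coef_ae_bound a.
have [M lM aM] := transport_bound l0 al; exists M; first exact: lt_le_trans lM.
by move=> k; apply: (aM k.+1 0); rewrite lexx mulr_ge0// ltW// pi_gt0.
Qed.

Lemma return_map_subproof a : \forall r \near (0 : R[i]),
  cvgn (series (fun k => return_coef a k * r ^+ k.+2)).
Proof.
have [L L0 aL] := return_coef_bound a.
apply/near0_cmodP; exists (2 * L)^-1; first by rewrite invr_gt0 mulr_gt0.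
move=> r rL; have [|s s1 _] := power_series_cvg aL (ltW L0) (_ : L * cmod r <= 2^-1).
  by rewrite mulrC -ler_pdivlMr// -invfM ltW.
by apply/cvg_ex; exists s.
Qed.

Definition return_map a : Gc R := MkGc (return_map_subproof a).

End convergent_series.

(** * A priori bounds on solutions *)

Section lipschitz_functions.
Context {R : realType}.
Implicit Types (f g : R -> R[i]) (T : R).

Definition clipschitz_on T f := exists2 K : R, 0 <= K & forall x y,
  x \in `[0, T] -> y \in `[0, T] -> cmod (f x - f y) <= K * `|x - y|.

Lemma clipschitz_on_bounded T f : clipschitz_on T f -> exists2 C, 0 <= C &
  forall x, x \in `[0, T] -> cmod (f x) <= C.
Proof.
move=> [K K0 fK]; exists (cmod (f 0) + K * `|T|); first by rewrite addr_ge0 ?cmod_ge0 ?mulr_ge0.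
move=> x; rewrite in_itv/= => /andP[x0 xT].
rewrite -[f x](subrK (f 0)) (le_trans (cmodD _ _))// addrC lerD2l.
rewrite (le_trans (fK _ _ _ _)) ?in_itv/= ?x0 ?xT ?lexx ?(le_trans x0)//.
by rewrite subr0 ler_wpM2l// ger0_norm// (le_trans xT)// ler_norm.
Qed.

Lemma clipschitz_on_cst T (c : R[i]) : clipschitz_on T (fun=> c).
Proof. by exists 0 => // x y _ _; rewrite subrr cmod0 mul0r. Qed.

Lemma clipschitz_onD T f g : clipschitz_on T f -> clipschitz_on T g ->
  clipschitz_on T (fun x => f x + g x).
Proof.
move=> [K K0 fK] [L L0 gL]; exists (K + L); first exact: addr_ge0.
move=> x y xT yT; rewrite (_ : _ - _ = (f x - f y) + (g x - g y)); last by ring.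
by rewrite (le_trans (cmodD _ _))// mulrDl lerD ?fK ?gL.
Qed.

Lemma clipschitz_onM T f g : clipschitz_on T f -> clipschitz_on T g ->
  clipschitz_on T (fun x => f x * g x).
Proof.
move=> lf lg; have [C C0 fC] := clipschitz_on_bounded lf.
have [D D0 gD] := clipschitz_on_bounded lg.
move: lf lg => [K K0 fK] [L L0 gL].
exists (K * D + C * L); first by rewrite addr_ge0// mulr_ge0.
move=> x y xT yT; rewrite (_ : _ - _ = (f x - f y) * g x + f y * (g x - g y)); last by ring.
rewrite (le_trans (cmodD _ _))// [leRHS]mulrDl !cmodM lerD//.
  by rewrite mulrAC ler_pM ?cmod_ge0 ?fK ?gD.
by rewrite -mulrA ler_pM ?cmod_ge0 ?fC ?gL.
Qed.

Lemma clipschitz_on_exp T f n : clipschitz_on T f -> clipschitz_on T (fun x => f x ^+ n).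
Proof.
move=> lf; elim: n => [|n IH].
  by under eq_fun do rewrite expr0; exact: clipschitz_on_cst.
by under eq_fun do rewrite exprS; exact: clipschitz_onM.
Qed.

Lemma clipschitz_on_sum T n (F : nat -> R -> R[i]) :
  (forall j, (j < n)%N -> clipschitz_on T (F j)) ->
  clipschitz_on T (fun x => \sum_(j < n) F j x).
Proof.
elim: n => [|n IH] Fn.
  by under eq_fun do rewrite big_ord0; exact: clipschitz_on_cst.
under eq_fun do rewrite big_ord_recr/=; apply: clipschitz_onD; last exact: Fn.
by apply: IH => j jn; apply: Fn; rewrite (ltn_trans jn).
Qed.

Lemma clipschitz_on_cint T b f : loc_bounded f -> clipschitz_on T (fun x => cintegral `[x, b] f).
Proof.
move=> lf; have [K fK] := cint_dist b T lf; exists `|K| => // x y.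
rewrite !in_itv/= => /andP[x0 xT] /andP[y0 yT].
apply: le_trans (fK x y _ _) _; rewrite ?(ger0_norm x0) ?(ger0_norm y0)//.
by rewrite ler_wpM2r// ler_norm.
Qed.

Lemma cderive_bound_on T f (e t : R) : clipschitz_on T f -> 0 <= t <= T -> 0 <= e ->
  {ae lebesgue_measure, forall x, x \in `]0, t[ -> exists2 d, is_cderive x f d & cmod d <= e} ->
  cmod (f t - f 0) <= 2 * e * t.
Proof.
move=> [K K0 fK] /andP[t0 tT] e0 fd; rewrite -[X in _ * X](subr0 t).
apply: (cderive_bound (K := K)) => // x y; rewrite !in_itv/= => /andP[x0 xt] /andP[y0 yt].
by rewrite fK// in_itv/= ?x0 ?y0 (le_trans _ tT).
Qed.

Lemma le_geometric (x y C : R) : (forall n, x <= y + C * 2^-1 ^+ n) -> x <= y.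
Proof.
move=> xy; have h2 : `|2^-1 : R| < 1 by rewrite ger0_norm//; lra.
have h : (fun n => y + C * 2^-1 ^+ n) @ \oo --> y + 0.
  by apply: cvgD; [exact: cvg_cst|exact: cvg_geometric].
rewrite -[y]addr0 -(cvg_lim (@Rhausdorff R) h); apply: limr_ge.
  by apply/cvg_ex; exists (y + 0).
exact: nearW.
Qed.

End lipschitz_functions.

Section flows.
Context {R : realType}.
Implicit Types (a : X R) (r s : R[i]) (v : R -> R[i]) (l x : R).

Lemma flow_lipschitz a r v : is_flow a r v -> clipschitz_on (2 * pi) v.
Proof.
move=> [_ [K vK] _]; exists `|K| => // x y xT yT.
by rewrite (le_trans (vK _ _ xT yT))// ler_wpM2r// ler_norm.
Qed.

Lemma flow_series_tail a l x z s : 0 <= l -> (forall i, cmod (a i x) <= l ^+ i.+1) ->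
  l * cmod z <= 2^-1 -> series (fun i => a i x * z ^+ i.+2) @ \oo --> s ->
  forall n, cmod (s - \sum_(i < n) a i x * z ^+ i.+2) <= 2 * cmod z * (l * cmod z) ^+ n.+1.
Proof.
move=> l0 al lz sz n; have [s' s'1 s'2] := power_series_cvg al l0 lz.
have -> : s = s' by exact: (cvg_unique (@complex_hausdorff R) sz s'1).
by have := s'2 n; rewrite /series/= big_mkord.
Qed.

(** Solutions that start close to 0 stay close to 0. As long as [|v| <= rho] the
    derivative is at most [2 l rho ^ 2], so that [|v|] cannot exceed [3 rho / 4];
    being Lipschitz, [v] needs a time [d] that does not depend on the position to
    go from there to [rho], and [[0, 2 pi]] is covered in steps of length [d].
    The constant 32 leaves room for the factor 2 of complex integrals. *)
Lemma flow_small a l (rho : R) r v : 0 < l -> 0 < rho -> 32 * pi * l * rho <= 1 ->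
  {ae lebesgue_measure, forall x, forall i, cmod (a i x) <= l ^+ i.+1} ->
  cmod r <= rho / 2 -> is_flow a r v ->
  forall x, 0 <= x <= 2 * pi -> cmod (v x) <= rho.
Proof.
move=> l0 rho0 hl al rr fv; have lv := flow_lipschitz fv.
have p2 := pi_ge2 R; have lrho0 : 0 < l * rho by rewrite mulr_gt0.
have lr : l * rho <= 64^-1.
  have : 0 <= (pi - 2) * (l * rho) by rewrite mulr_ge0 ?subr_ge0// ltW.
  by move: hl; rewrite -(mulrA _ l); move: (l * rho) => y; lra.
have [K K0 vK] := lv; have [v0 _ vd] := fv.
pose d := rho / (4 * (K + 1)).
have K1 : 0 < 4 * (K + 1) by lra.
have d0 : 0 < d by rewrite divr_gt0.
have Kd : K * d <= rho / 4.
  by rewrite /d mulrA ler_pdivrMr//; nra.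
suff step n : forall y, 0 <= y <= 2 * pi -> y <= n%:R * d -> cmod (v y) <= 3 * rho / 4.
  move=> x x02; have [n nx] : exists n : nat, x / d <= n%:R.
    exists (Num.bound (x / d)); apply/ltW/archi_boundP.
    by rewrite divr_ge0 ?(ltW d0)//; case/andP: x02.
  rewrite (le_trans (step n x x02 _))//; last by lra.
  by rewrite -ler_pdivrMr.
elim: n => [|n IH] y /andP[y0 y2] yn.
  have -> : y = 0 by apply/eqP; rewrite eq_le y0 andbT (le_trans yn)// mul0r.
  by rewrite v0 (le_trans rr)//; lra.
have small z : 0 <= z <= y -> cmod (v z) <= rho.
  move=> /andP[z0 zy]; have [zn|nz] := leP z (n%:R * d).
    by rewrite (le_trans (IH z _ zn)) ?z0 ?(le_trans zy)//; lra.
  have nd0 : 0 <= n%:R * d by rewrite mulr_ge0// ltW.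
  have nd2 : n%:R * d <= 2 * pi by rewrite (le_trans (ltW nz))// (le_trans zy).
  rewrite -[v z](subrK (v (n%:R * d))) (le_trans (cmodD _ _))//.
  rewrite -[leRHS](_ : rho / 4 + 3 * rho / 4 = _); last by field.
  rewrite lerD//; last by rewrite IH// nd0 nd2.
  rewrite (le_trans (vK _ _ _ _)) ?in_itv/= ?nd0 ?nd2 ?z0 ?(le_trans zy)//.
  rewrite (le_trans _ Kd)// ler_wpM2l// ger0_norm; last by rewrite subr_ge0 ltW.
  rewrite lerBlDr (le_trans zy)// (le_trans yn)// -natr1 mulrDl mul1r addrC//.
have e0 : 0 <= 2 * rho * (l * rho) by rewrite !mulr_ge0 ?ltW.
have := cderive_bound_on lv (_ : 0 <= y <= 2 * pi) e0.
rewrite y0 y2 v0 => /(_ isT) H.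
rewrite -[v y](subrK r) (le_trans (cmodD _ _))//.
have {}H : cmod (v y - r) <= 2 * (2 * rho * (l * rho)) * y.
  apply: H; move: (ae_and al vd); apply: ae_imp => x /= [{}al {}vd].
  rewrite in_itv/= => /andP[x0 xy].
  have [|s vs sx] := vd; first by rewrite in_itv/= x0 (lt_le_trans xy).
  exists s => //.
  have vx : cmod (v x) <= rho by rewrite small// !ltW.
  have lvx : l * cmod (v x) <= l * rho by rewrite ler_wpM2l// ltW.
  have l2 : l * cmod (v x) <= 2^-1 by rewrite (le_trans lvx)// (le_trans lr)//; lra.
  have := flow_series_tail (ltW l0) al l2 sx 0.
  rewrite big_ord0 subr0 expr1 => /le_trans; apply.
  by rewrite ler_pM ?mulr_ge0 ?cmod_ge0 ?ler_wpM2l// ltW.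
rewrite (le_trans (lerD H rr))//.
have : 2 * (2 * rho * (l * rho)) * y <= rho * (32 * pi * l * rho) / 4.
  have : 0 <= (rho * (l * rho)) * (2 * pi - y) by rewrite mulr_ge0 ?subr_ge0// mulr_ge0 ?ltW.
  lra.
have : rho * (32 * pi * l * rho) <= rho by rewrite ler_piMr// ltW.
lra.
Qed.

End flows.

(** * Endpoints of solutions *)

Section flow_endpoint.
Context {R : realType}.
Implicit Types (a : X R) (r s : R[i]) (v : R -> R[i]) (l x : R).

Definition dtransport a n x : R[i] :=
  if n is m.+1 then - \sum_(i < m.+1) (m.+1 - i)%:R * (a i x * transport a (m - i) x)
  else 0.

Lemma ae_is_cderive_transport a : {ae lebesgue_measure, forall x,
  0 < x -> x < 2 * pi -> forall n, is_cderive x (transport a n) (dtransport a n x)}.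
Proof.
have : {ae lebesgue_measure, forall x, forall n, 0 < x -> x < 2 * pi ->
    is_cderive x (transport a n) (dtransport a n x)}.
  apply: ae_foralln => -[|n].
    by apply: aeW => x _ _; exact: is_cderive_cst.
  rewrite (funext (transportS a n)); apply: ae_is_cderive_cint.
  apply: (@loc_bounded_sum _ _ (fun i x => (n.+1 - i)%:R * (a i x * transport a (n - i) x))).
  move=> i _; apply: loc_boundedM; first exact: loc_bounded_cst.
  by apply: loc_boundedM; [exact: loc_bounded_coef|exact: loc_bounded_transport].
by apply: ae_imp => x H x0 x2 n; exact: H.
Qed.

(** The cancellation behind the conservation of [Psi_x (v x)]: in degree at most
    [N] the derivative of the coefficients compensates that of the powers of the
    solution, and only products of total degree above [N] remain. *)
Lemma dtransport_telescope a x (z : R[i]) N :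
  \sum_(n < N) dtransport a n x * z ^+ n.+1 =
  - \sum_(m < N) m.+1%:R * transport a m x * z ^+ m *
      \sum_(i < N - m.+1) a i x * z ^+ i.+2.
Proof.
elim: N => [|N IH]; first by rewrite !big_ord0 oppr0.
rewrite big_ord_recr/= IH [in RHS]big_ord_recr/= subnn big_ord0 mulr0 addr0.
have -> : \sum_(m < N) m.+1%:R * transport a m x * z ^+ m *
    (\sum_(i < N.+1 - m.+1) a i x * z ^+ i.+2) =
  \sum_(m < N) m.+1%:R * transport a m x * z ^+ m *
    (\sum_(i < N - m.+1) a i x * z ^+ i.+2) +
  \sum_(m < N) m.+1%:R * transport a m x * a (N - m.+1)%N x * z ^+ N.+1.
  rewrite -big_split/=; apply: eq_bigr => m _.
  rewrite subSS -(subnSK (ltn_ord m)) big_ord_recr/= mulrDr; congr (_ + _).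
  have -> : z ^+ N.+1 = z ^+ m * z ^+ (N - m.+1).+2.
    by rewrite -exprD addnS subnSK// subnKC// ltnW.
  ring.
rewrite opprD; congr (_ + _); case: N {IH} => [|N]; first by rewrite big_ord0 mul0r oppr0.
rewrite /dtransport mulNr; congr (- _); rewrite mulr_suml.
rewrite (reindex_inj rev_ord_inj)/=; apply: eq_bigr => m _.
have mN : (m <= N)%N by rewrite -ltnS.
rewrite !subSS subSn ?leq_subr// subKn//; ring.
Qed.

Lemma transport_series_derive a x v s n : is_cderive x v s ->
  (forall n, is_cderive x (transport a n) (dtransport a n x)) ->
  is_cderive x (fun y => \sum_(k < n) transport a k y * v y ^+ k.+1)
    (\sum_(m < n) m.+1%:R * transport a m x * v x ^+ m *
      (s - \sum_(i < n - m.+1) a i x * v x ^+ i.+2)).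
Proof.
move=> vs ta.
have := @is_cderive_sum _ x n (fun k y => transport a k y * v y ^+ k.+1)
  (fun k => dtransport a k x * v x ^+ k.+1 + transport a k x * (k.+1%:R * v x ^+ k * s)).
move=> /(_ (fun k _ => is_cderiveM (ta k) (is_cderiveX k vs))).
congr is_cderive; rewrite big_split/= dtransport_telescope -sumrN -big_split/=.
by apply: eq_bigr => m _; ring.
Qed.

(** Along a solution [v], the partial sums of
    [\sum_n transport a n x * v x ^+ n.+1] have derivatives tending to 0
    uniformly, by the cancellation above. At [0] these sums tend to the value of
    the return map, and at [2 * pi] they are [v (2 * pi)]. *)
Lemma flow_end a : exists2 rho : R, 0 < rho & forall r v, cmod r < rho ->
  is_flow a r v -> v (2 * pi) = Gc_eval (return_map a) r.
Proof.
have [l l0 al] := coef_ae_bound a.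
have [M lM aM] := transport_bound l0 al.
have M0 : 0 < M by exact: lt_le_trans lM.
have p2 := pi_ge2 R; have p0 : 0 < pi :> R by exact: pi_gt0.
pose rho := (32 * pi * M)^-1.
have rho0 : 0 < rho by rewrite invr_gt0 !mulr_gt0.
have hM : 32 * pi * M * rho = 1 by rewrite divff// gt_eqF// !mulr_gt0.
have hl : 32 * pi * l * rho <= 1.
  apply: (@le_trans _ _ (32 * pi * M * rho)); last by rewrite hM.
  by rewrite ler_pM2r// ler_pM2l// mulr_gt0.
have Mr : M * rho <= 64^-1.
  have : 0 <= (pi - 2) * (M * rho) by rewrite mulr_ge0 ?subr_ge0// mulr_ge0 ?ltW.
  by lra.
exists (rho / 2); first by rewrite divr_gt0.
move=> r v rr fv; have lv := flow_lipschitz fv; have [v0 _ vd] := fv.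
have vrho := flow_small l0 rho0 hl al (ltW rr) fv.
pose h N y := \sum_(k < N) transport a k y * v y ^+ k.+1.
have lh N : clipschitz_on (2 * pi) (h N).
  apply: (@clipschitz_on_sum _ _ _ (fun k y => transport a k y * v y ^+ k.+1)) => k _.
  apply: clipschitz_onM; last exact: clipschitz_on_exp.
  case: k => [|k]; first exact: clipschitz_on_cst.
  rewrite (funext (transportS a k)); apply: clipschitz_on_cint.
  apply: (@loc_bounded_sum _ _ (fun i x => (k.+1 - i)%:R * (a i x * transport a (k - i) x))).
  move=> i _; apply: loc_boundedM; first exact: loc_bounded_cst.
  by apply: loc_boundedM; [exact: loc_bounded_coef|exact: loc_bounded_transport].
have hb N : cmod (h N (2 * pi) - h N 0) <= 2 * (2 * rho * 2^-1 ^+ N) * (2 * pi).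
  apply: (cderive_bound_on (lh N)).
  - by rewrite lexx mulr_ge0// ltW.
  - by rewrite !mulr_ge0// ltW.
  move: (ae_and al (ae_and vd (ae_is_cderive_transport a))); apply: ae_imp => x /=.
  move=> [{}al [{}vd ta]] xI; have [s vs sx] := vd xI.
  move: xI; rewrite in_itv/= => /andP[x0 x2].
  eexists; first exact: transport_series_derive vs (ta x0 x2).
  have vx : cmod (v x) <= rho by rewrite vrho// !ltW.
  have lvx : l * cmod (v x) <= 4^-1.
    rewrite (le_trans (ler_wpM2l (ltW l0) vx))//.
    by rewrite (le_trans (ler_wpM2r (ltW rho0) lM))// (le_trans Mr)//; lra.
  have lvx2 : l * cmod (v x) <= 2^-1 by rewrite (le_trans lvx)//; lra.
  apply: (@le_trans _ _ (\sum_(m < N) 2 * rho * 4^-1 ^+ N)).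
    apply: cmod_sum => m; rewrite !cmodM cmodX cmod_nat.
    have tail := flow_series_tail (ltW l0) al lvx2 sx (N - m.+1).
    rewrite subnSK// in tail.
    have pow : m.+1%:R * cmod (transport a m x) * cmod (v x) ^+ m <= 4^-1 ^+ m.
      apply: (@le_trans _ _ (2 ^+ m * M ^+ m * rho ^+ m)).
        rewrite ler_pM ?exprn_ge0 ?mulr_ge0 ?cmod_ge0// ?ler_pM ?cmod_ge0//.
        - by rewrite -natrX ler_nat ltn_expl.
        - by rewrite aM// !ltW.
        - by rewrite lerXn2r ?nnegrE ?cmod_ge0 ?(ltW rho0).
      rewrite -!exprMn lerXn2r ?nnegrE ?mulr_ge0 ?ltW//; lra.
    rewrite -[X in 4^-1 ^+ X](subnKC (ltnW (ltn_ord m))) exprD mulrCA.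
    rewrite ler_pM ?mulr_ge0 ?exprn_ge0 ?cmod_ge0//.
    rewrite (le_trans tail)// ler_pM ?mulr_ge0 ?exprn_ge0 ?mulr_ge0 ?cmod_ge0 ?(ltW l0)//.
      by rewrite ler_pM2l.
    by rewrite lerXn2r ?nnegrE ?mulr_ge0 ?cmod_ge0 ?(ltW l0).
  rewrite sumr_const card_ord -[leLHS]mulr_natl mulrCA ler_wpM2l ?mulr_ge0 ?(ltW rho0)//.
  have -> : 4^-1 = 2^-1 * 2^-1 :> R by field.
  rewrite exprMn mulrA ler_piMl ?exprn_ge0// -ler_pdivlMr ?exprn_gt0//.
  by rewrite mul1r -exprVn invrK -natrX ler_nat ltnW// ltn_expl.
apply/eqP; rewrite -subr_eq0; apply/eqP/cmod_eq0/eqP; rewrite eq_le cmod_ge0 andbT.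
apply: (@le_geometric _ _ _ (4 * rho * pi + 2 * rho)) => n; rewrite add0r.
have h2 : h n.+1 (2 * pi) = v (2 * pi).
  rewrite /h big_ord_recl transport_2pi expr1 mul1r big1 ?addr0// => k _.
  by rewrite transport_2pi mul0r.
have h0 : h n.+1 0 = r + series (fun k => return_map a k * r ^+ k.+2) n.
  rewrite /h big_ord_recl transport0 mul1r expr1 v0 /series/= big_mkord.
  by congr (_ + _); apply: eq_bigr => k _.
have := hb n.+1; rewrite h2 h0 => H1.
have aL k : cmod (return_map a k) <= M ^+ k.+1.
  by apply: (aM k.+1 0); rewrite lexx mulr_ge0 ?ltW.
have rr' : cmod r <= rho by lra.
have Mr2 : M * cmod r <= 2^-1.
  by rewrite (le_trans (ler_wpM2l (ltW M0) rr'))// (le_trans Mr)//; lra.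
have := Gc_eval_bound aL (ltW M0) Mr2 n.
move: (Gc_eval _ _) (r + _) H1 => G S H1 H2.
rewrite (_ : v (2 * pi) - G = (v (2 * pi) - S) - (G - S)); last by ring.
rewrite (le_trans (cmodB _ _))// [leRHS]mulrDl lerD//.
  rewrite (le_trans H1)// exprS le_eqVlt; apply/orP; left; apply/eqP.
  by move: (2^-1 ^+ n) => q; field.
rewrite (le_trans H2)// exprS.
have h3 : (M * cmod r) ^+ n <= 2^-1 ^+ n.
  by rewrite lerXn2r ?nnegrE ?mulr_ge0 ?cmod_ge0 ?(ltW M0).
rewrite -mulrA -[leRHS]mulrA ler_wpM2l//.
rewrite ler_pM ?mulr_ge0 ?exprn_ge0 ?mulr_ge0 ?cmod_ge0 ?(ltW M0)//.
rewrite (le_trans (ler_pM _ _ Mr2 h3)) ?mulr_ge0 ?exprn_ge0 ?mulr_ge0 ?cmod_ge0 ?(ltW M0)//.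
by rewrite ler_piMl ?exprn_ge0//; lra.
Qed.
End flow_endpoint.

(** * Existence of solutions *)

Section picard.
Context {R : realType}.
Implicit Types (a : X R) (r s z w : R[i]) (u v : R -> R[i]) (x y : R).

Lemma measurable_cmod (f : R -> R[i]) : cmeasurable f ->
  measurable_fun [set: R] (fun x => cmod (f x)).
Proof.
move=> [fr fi].
rewrite (_ : (fun x => _) = (fun x => Num.sqrt (complex.Re (f x) ^+ 2 + complex.Im (f x) ^+ 2))).
  apply: (measurableT_comp (continuous_measurable_fun (@sqrt_continuous R))).
  by apply: measurable_funD; apply: measurable_funX.
by apply/funext => x; case: (f x).
Qed.

Lemma cmeasurable_cvg (F : nat -> R -> R[i]) (f : R -> R[i]) :
  (forall n, cmeasurable (F n)) -> (forall x, (fun n => F n x) @ \oo --> f x) ->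
  cmeasurable f.
Proof.
move=> mF Ff; split.
  apply: (@measurable_fun_cvg _ _ R setT (fun n x => complex.Re (F n x))).
    by move=> n; have [] := mF n.
  by move=> x _; exact: (Re_Im_cvg (Ff x)).1.
apply: (@measurable_fun_cvg _ _ R setT (fun n x => complex.Im (F n x))).
  by move=> n; have [] := mF n.
by move=> x _; exact: (Re_Im_cvg (Ff x)).2.
Qed.

Lemma expr_dist z w (rho : R) k : cmod z <= rho -> cmod w <= rho ->
  cmod (z ^+ k.+1 - w ^+ k.+1) <= k.+1%:R * rho ^+ k * cmod (z - w).
Proof.
move=> zr wr; have rho0 : 0 <= rho by rewrite (le_trans (cmod_ge0 z)).
elim: k => [|k IH]; first by rewrite !expr1 expr0 !mul1r.
rewrite (_ : _ - _ = z * (z ^+ k.+1 - w ^+ k.+1) + (z - w) * w ^+ k.+1); last first.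
  by rewrite !(exprS _ k.+1); ring.
rewrite (le_trans (cmodD _ _))// !cmodM cmodX.
have H1 : cmod z * cmod (z ^+ k.+1 - w ^+ k.+1) <= rho * (k.+1%:R * rho ^+ k * cmod (z - w)).
  by rewrite ler_pM ?cmod_ge0.
have H2 : cmod (z - w) * cmod w ^+ k.+1 <= cmod (z - w) * rho ^+ k.+1.
  by rewrite ler_wpM2l ?cmod_ge0// lerXn2r ?nnegrE ?cmod_ge0.
rewrite (le_trans (lerD H1 H2))// le_eqVlt; apply/orP; left; apply/eqP.
by rewrite -[in RHS]natr1 exprS; ring.
Qed.

Variables (alpha : nat -> R -> R[i]) (l rho : R).
Hypotheses (l0 : 0 < l) (rho0 : 0 < rho) (hl : 32 * pi * l * rho <= 1).
Hypothesis malpha : forall i, cmeasurable (alpha i).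
Hypothesis alphal : forall i x, cmod (alpha i x) <= l ^+ i.+1.

Let lrho : l * rho <= 64^-1.
Proof.
have p2 := pi_ge2 R.
have : 0 <= (pi - 2) * (l * rho) by rewrite mulr_ge0 ?subr_ge0// mulr_ge0 ?ltW.
by have := hl; lra.
Qed.

Let pl : pi * (l * rho) <= 32^-1.
Proof. by have := hl; lra. Qed.

Let pi0 : 0 < pi :> R. Proof. exact: pi_gt0. Qed.

Definition vfield x z : R[i] := limn (series (fun i => alpha i x * z ^+ i.+2)).

Lemma vfield_cvg x z : cmod z <= rho ->
  series (fun i => alpha i x * z ^+ i.+2) @ \oo --> vfield x z.
Proof.
move=> zr; have [|s s1 _] := @power_series_cvg R (alpha^~ x) l z (alphal^~ x) (ltW l0).
  by rewrite (le_trans (ler_wpM2l (ltW l0) zr))// (le_trans lrho)//; lra.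
by rewrite /vfield (cvg_lim (@complex_hausdorff R) s1).
Qed.

Lemma vfield_bound x z : cmod z <= rho -> cmod (vfield x z) <= 2 * l * rho * rho.
Proof.
move=> zr; have lz : l * cmod z <= 2^-1.
  by rewrite (le_trans (ler_wpM2l (ltW l0) zr))// (le_trans lrho)//; lra.
have [s s1 /(_ 0%N)] := @power_series_cvg R (alpha^~ x) l z (alphal^~ x) (ltW l0) lz.
rewrite /vfield (cvg_lim (@complex_hausdorff R) s1) /series/= big_mkord big_ord0 subr0.
move/le_trans; apply; rewrite expr1.
have := ler_wpM2l (ltW l0) (ler_pM (cmod_ge0 z) (cmod_ge0 z) zr zr).
lra.
Qed.

(** The vector field vanishes to second order at 0, so its Lipschitz constant on
    the disk of radius [rho] is proportional to [rho]: for small [rho] the Picard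
    operator is a contraction on the whole interval [[0, 2 pi]] at once. *)
Lemma vfield_lipschitz x z w : cmod z <= rho -> cmod w <= rho ->
  cmod (vfield x z - vfield x w) <= 4 * l * rho * cmod (z - w).
Proof.
move=> zr wr; have cz := @vfield_cvg x z zr; have cw := @vfield_cvg x w wr.
have q0 : 0 <= 2 * (l * rho) by rewrite !mulr_ge0 ?ltW.
have [||s s1 s2] := @geometric_series_cvg R
    (fun i => alpha i x * z ^+ i.+2 - alpha i x * w ^+ i.+2)
    (2 * (l * rho) * cmod (z - w)) (2 * (l * rho)).
- by rewrite q0/= (le_trans (ler_wpM2l _ lrho))//; lra.
- move=> n; rewrite -mulrBr cmodM.
  have H := expr_dist n.+1 zr wr.
  rewrite (le_trans (ler_pM (cmod_ge0 _) (cmod_ge0 _) (alphal n x) H))//.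
  have H2 : n.+2%:R <= 2 ^+ n.+1 :> R by rewrite -natrX ler_nat ltn_expl.
  have -> : 2 * (l * rho) * cmod (z - w) * (2 * (l * rho)) ^+ n =
      2 ^+ n.+1 * (l ^+ n.+1 * rho ^+ n.+1 * cmod (z - w)).
    by rewrite !exprMn !exprS; ring.
  rewrite [leLHS](_ : _ = n.+2%:R * (l ^+ n.+1 * rho ^+ n.+1 * cmod (z - w))); last by ring.
  apply: ler_wpM2r H2.
  by rewrite !mulr_ge0 ?exprn_ge0 ?cmod_ge0 ?(ltW l0) ?(ltW rho0).
have E : vfield x z - vfield x w = s.
  apply: (cvg_unique (@complex_hausdorff R) _ s1).
  have -> : series (fun i => alpha i x * z ^+ i.+2 - alpha i x * w ^+ i.+2) =
      (fun n => series (fun i => alpha i x * z ^+ i.+2) n -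
                series (fun i => alpha i x * w ^+ i.+2) n).
    by apply/funext => n; rewrite /series/= sumrB.
  exact: (cvgB cz cw).
have := s2 0%N; rewrite E /series/= big_mkord big_ord0 subr0 expr0 mulr1.
by move/le_trans; apply; rewrite le_eqVlt; apply/orP; left; apply/eqP; ring.
Qed.

Lemma loc_bounded_vfield u : loc_bounded u -> (forall x, cmod (u x) <= rho) ->
  loc_bounded (fun x => vfield x (u x)).
Proof.
move=> [mu _] ur; split; last first.
  by move=> T; exists (2 * l * rho * rho); apply: aeW => x _; exact: vfield_bound.
apply: (@cmeasurable_cvg (fun n x => series (fun i => alpha i x * u x ^+ i.+2) n)) => [n|x].
  rewrite /series/=; under eq_fun do rewrite big_mkord.
  apply: (@cmeasurable_sum _ _ (fun i x => alpha i x * u x ^+ i.+2)) => i _.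
  apply: cmeasurableM => //; elim: i.+2 => [|k IH].
    by under eq_fun do rewrite expr0; exact: cmeasurable_cst.
  by under eq_fun do rewrite exprS; exact: cmeasurableM.
exact: vfield_cvg.
Qed.

(** Clamping the upper endpoint keeps the iterates bounded and Lipschitz on the
    whole line. *)
Definition picard r u x : R[i] :=
  r + cintegral `[0, clamp 0 (2 * pi) x] (fun y => vfield y (u y)).

Let p2ge0 : 0 <= 2 * pi :> R. Proof. by rewrite mulr_ge0 ?ltW. Qed.

Lemma picard_lipschitz r u : loc_bounded u -> (forall x, cmod (u x) <= rho) ->
  forall x y, cmod (picard r u x - picard r u y) <= 2 * (2 * l * rho * rho) * `|x - y|.
Proof.
move=> lu ur x y; have lf := loc_bounded_vfield lu ur.
have C0 : 0 <= 2 * l * rho * rho by rewrite !mulr_ge0 ?ltW.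
wlog xy : x y / clamp 0 (2 * pi) x <= clamp 0 (2 * pi) y.
  move=> H; case: (leP (clamp 0 (2 * pi) x) (clamp 0 (2 * pi) y)) => [/H//|/ltW/H].
  by rewrite cmodC distrC.
have /andP[cx0 cx1] := clamp_itv x p2ge0; have /andP[cy0 cy1] := clamp_itv y p2ge0.
rewrite cmodC /picard (cint_split lf cx0 xy).
rewrite (_ : _ - _ = cintegral `[clamp 0 (2 * pi) x, clamp 0 (2 * pi) y]
  (fun y => vfield y (u y))); last by ring.
apply: le_trans (cint_le_cst lf xy C0 _) _.
  by apply: aeW => z _; exact: vfield_bound.
apply: ler_wpM2l; first by rewrite mulr_ge0.
by apply: le_trans (clamp_lipschitz 0 (2 * pi) x y); rewrite distrC ler_norm.
Qed.

Lemma cint_clamp_le (f : R -> R[i]) (C : R) x : loc_bounded f -> 0 <= C ->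
  (forall y, cmod (f y) <= C) ->
  cmod (cintegral `[0, clamp 0 (2 * pi) x] f) <= 4 * pi * C.
Proof.
move=> lf C0 fC; have /andP[c0 c1] := clamp_itv x p2ge0.
apply: le_trans (cint_le_cst lf c0 C0 _) _; first exact: aeW.
rewrite subr0; have : C * clamp 0 (2 * pi) x <= C * (2 * pi) by rewrite ler_wpM2l.
lra.
Qed.

Lemma picard_bound r u : cmod r <= rho / 2 -> loc_bounded u ->
  (forall x, cmod (u x) <= rho) -> forall x, cmod (picard r u x) <= rho.
Proof.
move=> rr lu ur x; rewrite (le_trans (cmodD _ _))//.
have C0 : 0 <= 2 * l * rho * rho by rewrite !mulr_ge0 ?ltW.
have H := cint_clamp_le x (loc_bounded_vfield lu ur) C0 (fun y => vfield_bound y (ur y)).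
have H2 : 4 * pi * (2 * l * rho * rho) <= rho / 4.
  have : rho * (pi * (l * rho)) <= rho * 32^-1 by rewrite ler_wpM2l// ltW.
  lra.
by rewrite (le_trans (lerD rr (le_trans H H2)))//; have := rho0; lra.
Qed.

Lemma picard_contraction r u v (C : R) : loc_bounded u -> loc_bounded v ->
  (forall x, cmod (u x) <= rho) -> (forall x, cmod (v x) <= rho) -> 0 <= C ->
  (forall x, cmod (u x - v x) <= C) ->
  forall x, cmod (picard r u x - picard r v x) <= 2^-1 * C.
Proof.
move=> lu lv ur vr C0 uv x.
have lfu := loc_bounded_vfield lu ur; have lfv := loc_bounded_vfield lv vr.
have -> : picard r u x - picard r v x =
    cintegral `[0, clamp 0 (2 * pi) x] (fun y => vfield y (u y)) -
    cintegral `[0, clamp 0 (2 * pi) x] (fun y => vfield y (v y)).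
  by rewrite /picard opprD addrACA subrr add0r.
rewrite -cintB//.
have D0 : 0 <= 4 * l * rho by rewrite !mulr_ge0 ?ltW.
have {}D0 := (D0, mulr_ge0 D0 C0).
apply: le_trans (cint_clamp_le x _ D0.2 _) _.
- by apply: loc_boundedD => //; exact: loc_boundedN.
- move=> y; rewrite (le_trans (vfield_lipschitz _ (ur y) (vr y)))//.
  exact: ler_wpM2l D0.1 _ _ (uv y).
have : C * (pi * (l * rho)) <= C * 32^-1 by rewrite ler_wpM2l.
lra.
Qed.

Lemma picard_fixpoint r : cmod r <= rho / 2 -> exists u,
  [/\ loc_bounded u, forall x, cmod (u x) <= rho & forall x, u x = picard r u x].
Proof.
move=> rr.
pose u n := iter n (picard r) (fun=> r).
have uP n : loc_bounded (u n) /\ forall x, cmod (u n x) <= rho.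
  elim: n => [|n [lu ur]].
    split; [exact: loc_bounded_cst|move=> x /=].
    by rewrite (le_trans rr)//; have := rho0; lra.
  split; last exact: picard_bound.
  apply: loc_bounded_dist => T; exists (2 * (2 * l * rho * rho)) => x y _ _.
  exact: picard_lipschitz.
have ud n x : cmod (u n.+1 x - u n x) <= rho * 2^-1 ^+ n.
  elim: n x => [|n IH] x.
    rewrite expr0 mulr1 /= /picard addrAC subrr add0r.
    have C0 : 0 <= 2 * l * rho * rho by rewrite !mulr_ge0 ?ltW.
    have [lu ur] := uP 0%N.
    have := cint_clamp_le x (loc_bounded_vfield lu ur) C0 (fun y => vfield_bound y (ur y)).
    have : rho * (pi * (l * rho)) <= rho * 32^-1 by rewrite ler_wpM2l// ltW.
    have := rho0; rewrite /=; lra.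
  have [lu ur] := uP n; have [lu1 ur1] := uP n.+1.
  have C0 : 0 <= rho * 2^-1 ^+ n by rewrite mulr_ge0 ?exprn_ge0// ltW.
  by rewrite exprS mulrCA; exact: (picard_contraction r lu1 lu ur1 ur C0 IH x).
have h2 : 0 <= (2^-1 : R) <= 2^-1 by rewrite lexx andbT invr_ge0.
pose U x := limn (fun n => u n x).
have UP x : (fun n => u n x) @ \oo --> U x /\
    forall n, cmod (U x - u n x) <= 2 * rho * 2^-1 ^+ n.
  have [s s1 s2] := geometric_cvg h2 (ud^~ x).
  by rewrite /U (cvg_lim (@complex_hausdorff R) s1).
have Ur x : cmod (U x) <= rho.
  apply: (@le_geometric _ _ _ (2 * rho)) => n.
  rewrite -[U x](subrK (u n x)) (le_trans (cmodD _ _))// addrC lerD//.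
    exact: (uP n).2.
  exact: (UP x).2.
have lU : loc_bounded U.
  apply: loc_bounded_dist => T; exists (2 * (2 * l * rho * rho)) => x y _ _.
  apply: (@le_geometric _ _ _ (4 * rho)) => -[|n].
    have : cmod (U x - U y) <= cmod (U x) + cmod (U y) by exact: cmodB.
    have := Ur x; have := Ur y; rewrite expr0 mulr1.
    have C1 : 0 <= 2 * (2 * l * rho * rho) by rewrite !mulr_ge0 ?ltW.
    have := mulr_ge0 C1 (normr_ge0 (x - y)); have := rho0.
    lra.
  have -> : U x - U y = (U x - u n.+1 x) + (u n.+1 x - u n.+1 y) + (u n.+1 y - U y) by ring.
  have [lu ur] := uP n.
  have H1 := (UP x).2 n.+1; have H2 := (UP y).2 n.+1.
  have H3 := picard_lipschitz r lu ur x y.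
  rewrite (le_trans (cmodD _ _))// (le_trans (lerD (cmodD _ _) (lexx _)))//.
  rewrite (cmodC _ (U y)); move: H1 H2 H3; rewrite -/(u n.+1 x) -/(u n.+1 y).
  lra.
exists U; split => // x.
apply/eqP; rewrite -subr_eq0; apply/eqP/cmod_eq0/eqP; rewrite eq_le cmod_ge0 andbT.
apply: (@le_geometric _ _ _ (2 * rho)) => n; rewrite add0r.
have [lu ur] := uP n.
have H1 := (UP x).2 n.+1.
have H2 := @picard_contraction r U (u n) (2 * rho * 2^-1 ^+ n) lU lu Ur ur _
  (fun x => (UP x).2 n) x.
rewrite (_ : U x - _ = (U x - u n.+1 x) - (picard r U x - u n.+1 x)); last by ring.
rewrite (le_trans (cmodB _ _))//.
move: H1 H2; rewrite exprS -/(u n.+1 x) => H1 /(_ _)/= H2.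
have {}H2 := H2 (mulr_ge0 (mulr_ge0 (ler0n _ 2) (ltW rho0)) (exprn_ge0 _ _)).
lra.
Qed.

End picard.

(** * The first return map *)

Section first_return.
Context {R : realType}.

Lemma cvg_double (u : nat -> R[i]) (s : R[i]) : u @ \oo --> s ->
  (fun n => 2 * u n) @ \oo --> 2 * s.
Proof. by move=> us; have := cvgM (cvg_cst (2 : R[i])) us; apply. Qed.

Implicit Types (a b : X R) (g : GX R) (r s z : R[i]) (u v : R -> R[i]) (x y : R).

Let pi0 : 0 < pi :> R. Proof. exact: pi_gt0. Qed.

Lemma flow_exists a : exists2 rho : R, 0 < rho & forall r, cmod r < rho ->
  exists v, is_flow a r v.
Proof.
have [l l0 al] := coef_ae_bound a.
pose rho := (32 * pi * l)^-1.
have rho0 : 0 < rho by rewrite invr_gt0 !mulr_gt0.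
have hl : 32 * pi * l * rho <= 1 by rewrite divff// gt_eqF// !mulr_gt0.
exists (rho / 2) => [|r rr]; first by rewrite divr_gt0.
(* Representatives for which the series of the vector field converges
   everywhere. *)
pose alpha i x := if cmod (a i x) <= l ^+ i.+1 then a i x else 0.
have malpha i : cmeasurable (alpha i).
  apply: cmeasurable_if; [|exact: coef_measurable|exact: cmeasurable_cst].
  apply: measurable_fun_ler => //; apply: measurable_cmod; exact: coef_measurable.
have alphal i x : cmod (alpha i x) <= l ^+ i.+1.
  by rewrite /alpha; case: ifP => // _; rewrite cmod0 exprn_ge0// ltW.
have [u [lu ur uE]] := picard_fixpoint l0 rho0 hl malpha alphal (ltW rr).
have lf := loc_bounded_vfield l0 rho0 hl malpha alphal lu ur.
have p20 : 0 <= 2 * pi :> R by rewrite mulr_ge0// ltW.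
exists u; split.
- by rewrite uE /picard clamp_id// cint_id addr0.
- exists (2 * (2 * l * rho * rho)) => x y _ _; rewrite [u x]uE [u y]uE.
  exact: (picard_lipschitz l0 rho0 hl malpha alphal).
move: (ae_and al (ae_is_cderive_cint 0 (2 * pi) lf)); apply: ae_imp => x /= [{}al du].
rewrite in_itv/= => /andP[x0 x2]; exists (vfield alpha x (u x)); last first.
  have := vfield_cvg l0 rho0 hl alphal (x := x) (ur x).
  rewrite (_ : (fun i => alpha i x * u x ^+ i.+2) = (fun i => a i x * u x ^+ i.+2))//.
  by apply/funext => i; rewrite /alpha al.
have := is_cderiveD (is_cderive_cst x (r + cintegral `[0, 2 * pi] (fun y => vfield alpha y (u y))))
  (is_cderiveN (du x0 x2)).
rewrite opprK add0r; apply: near_is_cderive.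
have : \forall y \near x, y \in `]0, 2 * pi[ by apply: near_in_itvoo; rewrite in_itv/= x0.
apply: filterS => y; rewrite in_itv/= => /andP[/ltW y0 /ltW y2].
by rewrite [u y]uE /picard clamp_id// (cint_split lf y0 y2) -addrA addrK.
Qed.

Lemma first_returnE a : \forall r \near (0 : R[i]),
  first_return a r = Gc_eval (return_map a) r.
Proof.
have [rho rho0 ex] := flow_exists a; have [rho' rho'0 endE] := flow_end a.
apply/near0_cmodP; exists (Num.min rho rho'); first by rewrite lt_min rho0.
move=> r; rewrite lt_min => /andP[r1 r2].
have [v fv] := ex _ r1; apply: endE => //.
by rewrite /flow; case: xgetP => // /(_ v).
Qed.

(** Any germ that represents the first return map is its chosen representative,
    by the identity theorem. *)
Lemma hatP_unique g (f : Gc R) :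
  (\forall r \near (0 : R[i]), first_return (reprX g) r = Gc_eval f r) -> hatP g = f.
Proof.
move=> gf; apply: Gc_eval_inj; rewrite /hatP; case: xgetP => [h _|/(_ f)//].
by move=> gh; near=> r; rewrite -(near gh r)// (near gf r).
Unshelve. all: by end_near. Qed.

Lemma hatPE g : hatP g = return_map (reprX g).
Proof. by apply: hatP_unique; exact: first_returnE. Qed.

Lemma hatP_coef g k : hatP g k = flow_coef (giter g) k.+1.
Proof. by rewrite hatPE. Qed.

Lemma hatP_classX a : hatP (classX a) = return_map a.
Proof.
by apply: Gc_eqP => k; rewrite hatP_coef; apply: eq_flow_coef; exact: giter_classX.
Qed.

Lemma clipschitz_on_glue (v w : R -> R[i]) T c : 0 <= c <= T -> clipschitz_on T v ->
  clipschitz_on T w -> v c = w c ->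
  clipschitz_on T (fun x => if x <= c then v x else w x).
Proof.
move=> /andP[c0 cT] [K K0 vK] [L L0 wL] vw; exists (K + L); first exact: addr_ge0.
have cI : c \in `[0, T] by rewrite in_itv/= c0.
have W x y : x \in `[0, T] -> y \in `[0, T] -> x <= y ->
    cmod ((if x <= c then v x else w x) - (if y <= c then v y else w y)) <= (K + L) * `|x - y|.
  move=> xT yT xy; have [yc|cy] := leP y c.
    rewrite (le_trans xy yc) (le_trans (vK _ _ xT yT))// ler_wpM2r//.
    by rewrite lerDl.
  have [xc|cx] := leP x c; last first.
    rewrite (le_trans (wL _ _ xT yT))// ler_wpM2r//.
    by rewrite lerDr.
  rewrite (le_trans (cmod_distD _ _ (v c)))// [in X in _ + X]vw.
  rewrite (le_trans (lerD (vK _ _ xT cI) (wL _ _ cI yT)))//.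
  rewrite !ler0_norm ?subr_le0 ?(ltW cy)// mulrDl.
  by rewrite lerD// ler_wpM2l//; lra.
move=> x y xT yT; have [xy|/ltW yx] := leP x y; first exact: W.
by rewrite cmodC distrC W.
Qed.

(** A solution for the first path, run at double speed, followed by a solution
    for the second one. Extending both by clamping makes the glued function
    globally Lipschitz. *)
Lemma flow_cat a b r v w : is_flow a r v -> is_flow b (v (2 * pi)) w ->
  exists2 y, is_flow (catX a b) r y & y (2 * pi) = w (2 * pi).
Proof.
move=> fv fw; have [v0 _ vd] := fv; have [w0 _ wd] := fw.
have [K K0 vK] := flow_lipschitz fv; have [L L0 wL] := flow_lipschitz fw.
pose v' x := v (2 * clamp 0 pi x).
pose w' x := w (2 * clamp pi (2 * pi) x - 2 * pi).
have pi2 : pi <= 2 * pi :> R by have := pi0; lra.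
have lv' : clipschitz_on (2 * pi) v'.
  exists (K * 2); first by rewrite mulr_ge0.
  move=> x y _ _.
  have /andP[? ?] := clamp_itv x (ltW pi0); have /andP[? ?] := clamp_itv y (ltW pi0).
  rewrite (le_trans (vK _ _ _ _)) ?in_itv/= ?mulr_ge0 ?ler_pM2l//.
  by rewrite -mulrA ler_wpM2l// -mulrBr normrM ger0_norm// ler_wpM2l// clamp_lipschitz.
have lw' : clipschitz_on (2 * pi) w'.
  exists (L * 2); first by rewrite mulr_ge0.
  have wI (t : R) : 2 * clamp pi (2 * pi) t - 2 * pi \in `[0, 2 * pi].
    by have /andP[? ?] := clamp_itv t pi2; rewrite in_itv/=; apply/andP; split; lra.
  move=> x y _ _; rewrite (le_trans (wL _ _ (wI x) (wI y)))//.
  have -> : 2 * clamp pi (2 * pi) x - 2 * pi - (2 * clamp pi (2 * pi) y - 2 * pi) =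
    2 * (clamp pi (2 * pi) x - clamp pi (2 * pi) y) by ring.
  by rewrite -mulrA ler_wpM2l// normrM ger0_norm// ler_wpM2l// clamp_lipschitz.
exists (fun x => if x <= pi then v' x else w' x); last first.
  rewrite leNgt (_ : pi < 2 * pi)/=; last by have := pi0; lra.
  by rewrite /w' clamp_id//; congr w; ring.
split.
- by rewrite ltW// /v' clamp_id ?lexx ?ltW// mulr0.
- have [C _ HC] : clipschitz_on (2 * pi) (fun x => if x <= pi then v' x else w' x).
    apply: clipschitz_on_glue => //; first by rewrite ltW.
    by rewrite /v' /w' !clamp_id// ?ltW// subrr w0.
  by exists C.
have Hv := ae_affine 0 vd; have Hw := ae_affine (- (2 * pi)) wd.
move: (ae_and Hv (ae_and Hw (ae_neq pi))); apply: ae_imp => x /= [{}Hv [{}Hw xpi]].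
rewrite in_itv/= => /andP[x0 x2].
have [xp|px] := ltP x pi.
  have [|s vs sx] := Hv; first by rewrite in_itv/=; apply/andP; split; lra.
  exists (2 * s).
    apply: near_is_cderive (is_cderive_affine vs).
    have : \forall y \near x, y \in `]0, pi[ by apply: near_in_itvoo; rewrite in_itv/= x0.
    apply: filterS => y; rewrite in_itv/= => /andP[y0 yp].
    by rewrite (ltW yp) /v' clamp_id ?ltW// addr0.
  rewrite (ltW xp) /v' clamp_id; [|exact: ltW|exact: ltW].
  rewrite (_ : series _ = (fun n => 2 *
      series (fun i => a i (2 * x + 0) * v (2 * x + 0) ^+ i.+2) n)).
    exact: cvg_double sx.
  have cE i : cat_fun a b i x = 2 * a i (2 * x + 0).
    by rewrite cat_funE red_id ?x0 ?(ltW x2)// (ltW xp) addr0.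
  apply/funext => n; rewrite /series mulr_sumr; apply: eq_bigr => i _.
  by rewrite cE addr0; exact: (esym (mulrA _ _ _)).
have {}px : pi < x by rewrite lt_neqAle eq_sym xpi.
have [|s ws sx] := Hw; first by rewrite in_itv/=; apply/andP; split; lra.
exists (2 * s).
  apply: near_is_cderive (is_cderive_affine ws).
  have : \forall y \near x, y \in `]pi, 2 * pi[ by apply: near_in_itvoo; rewrite in_itv/= px.
  apply: filterS => y; rewrite in_itv/= => /andP[y0 yp].
  by rewrite leNgt y0/= /w' clamp_id ?ltW.
rewrite leNgt px /= /w' clamp_id; [|exact: ltW|exact: ltW].
rewrite (_ : series _ = (fun n => 2 *
    series (fun i => b i (2 * x - 2 * pi) * w (2 * x - 2 * pi) ^+ i.+2) n)).
  exact: cvg_double sx.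
have cE i : cat_fun a b i x = 2 * b i (2 * x - 2 * pi).
  rewrite cat_funE red_id ?x0 ?(ltW x2)// leNgt px/=; congr (_ * _).
  by rewrite -[RHS](@coef_periodic _ b) subrK.
apply/funext => n; rewrite /series mulr_sumr; apply: eq_bigr => i _.
by rewrite cE; exact: (esym (mulrA _ _ _)).
Qed.

(** The first return map of a concatenation is a composition, the first path
    acting first. The radius must be small enough for the intermediate value to
    be an admissible starting point for the second path. *)
Lemma return_map_cat a b : \forall r \near (0 : R[i]),
  Gc_eval (return_map (catX a b)) r = Gc_eval (return_map b) (Gc_eval (return_map a) r).
Proof.
have [ra ra0 exa] := flow_exists a; have [rb rb0 exb] := flow_exists b.
have [ea ea0 enda] := flow_end a; have [eb eb0 endb] := flow_end b.
have [ec ec0 endc] := flow_end (catX a b).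
have [L L1 aL] := Gc_coef_le (return_map a).
have L0 : 0 < L by lra.
pose m1 := Num.min rb eb.
have m10 : 0 < m1 by rewrite lt_min rb0.
pose m := Num.min (Num.min (Num.min ra ea) (Num.min ec (m1 / 2))) (2^-1 / L).
have m0 : 0 < m by rewrite !lt_min ra0 ea0 ec0 !divr_gt0.
apply/near0_cmodP; exists m => // r; rewrite /m !lt_min.
move=> /andP[/andP[/andP[r1 r2] /andP[r3 r4]] r5].
have {}r5 : L * cmod r <= 2^-1 by rewrite mulrC -ler_pdivlMr// ltW.
have [v fv] := exa _ r1; rewrite -(enda _ _ r2 fv).
have vr : cmod (v (2 * pi)) < m1.
  rewrite (enda _ _ r2 fv).
  have := Gc_eval_bound aL (ltW L0) r5 0; rewrite /series/= big_mkord big_ord0 addr0 expr1 => H.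
  have : cmod (Gc_eval (return_map a) r) <= cmod (Gc_eval (return_map a) r - r) + cmod r.
    by rewrite -{1}(subrK r (Gc_eval _ _)) cmodD.
  have : 2 * cmod r * (L * cmod r) <= 2 * cmod r * 2^-1 by rewrite ler_wpM2l ?mulr_ge0 ?cmod_ge0.
  lra.
move: vr; rewrite lt_min => /andP[v1 v2].
have [w fw] := exb _ v1; rewrite -(endb _ _ v2 fw).
have [y fy <-] := flow_cat fv fw.
by rewrite (endc _ _ r3 fy).
Qed.

End first_return.

(** * The section *)

Section section_of_hatP.
Context {R : realType}.
Implicit Types (f : Gc R) (s t x : R).

Let pi0 : 0 < pi :> R. Proof. exact: pi_gt0. Qed.

Lemma cint_cst s t (c : R[i]) : s <= t -> cintegral `[s, t] (fun=> c) = c * (t - s)%:C.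
Proof.
move=> st; rewrite /cintegral/= !rint_cst//.
by case: c => a b /=; apply: complexP => /=; ring.
Qed.

(** The map from time [s] to time [2 pi] is [r + (1 - s / (2 pi)) (f r - r)]. Its
    derivative in [r] is the denominator, and minus its derivative in [s] the
    numerator, of the quotient that defines [a_of f]; so the defining identity of
    [a_of f] is the transport equation of this map. *)
Lemma transport_a_of f n s : 0 <= s <= 2 * pi ->
  transport (a_of f) n.+1 s = f n * (1 - s / (2 * pi))%:C.
Proof.
have pn0 : pi != 0 :> R by rewrite gt_eqF.
elim/ltn_ind: n s => n IH s /andP[s0 s2]; rewrite transportS.
transitivity (cintegral `[s, 2 * pi] (fun=> numer f n)); last first.
  rewrite cint_cst// /numer -mulrA; congr (_ * _).
  have E (p : R) : p != 0 -> 1 - s / (2 * p) = (2 * p)^-1 * (2 * p - s).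
    by move=> p0; field.
  rewrite E//.
  by rewrite [RHS]rmorphM [in RHS]fmorphV.
apply: eq_cint_oo => //.
- apply: (@loc_bounded_sum _ _
    (fun i x => (n.+1 - i)%:R * (a_of f i x * transport (a_of f) (n - i) x))).
  move=> i _; apply: loc_boundedM; first exact: loc_bounded_cst.
  by apply: loc_boundedM; [exact: loc_bounded_coef|exact: loc_bounded_transport].
- exact: loc_bounded_cst.
move=> x /andP[sx x2]; have x0 : 0 < x by rewrite (le_lt_trans s0).
rewrite -(@a_fun_identity _ f x n); last by rewrite x0 ltW.
apply: eq_bigr => i _; rewrite mulrCA; congr (_ * _).
have iN : (i <= n)%N by rewrite -ltnS.
rewrite subSn//; case E : (n - i)%N => [|k]; first by rewrite transport0 mul1r.
have kn : (k < n)%N by rewrite -E leq_subr.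
by rewrite IH ?(ltW x0) ?(ltW x2)//= mulrA.
Qed.

Lemma return_map_a_of f : return_map (a_of f) = f.
Proof.
apply: Gc_eqP => k; have := @transport_a_of f k 0.
by rewrite lexx mulr_ge0 ?(ltW pi0)// mul0r subr0 mulr1 => /(_ isT).
Qed.

Lemma hatP_Tmap f : hatP (Tmap f) = f.
Proof. by rewrite hatP_classX return_map_a_of. Qed.

Lemma rint_pow j s t : s <= t ->
  \int[lebesgue_measure]_(x in `[s, t]) x ^+ j = (t ^+ j.+1 - s ^+ j.+1) / j.+1%:R.
Proof.
rewrite le_eqVlt => /predU1P[->|st]; first by rewrite set_itv1 Rintegral_set1 subrr mul0r.
have D (x : R) : is_derive x (1 : R) (fun y => y ^+ j.+1 / j.+1%:R) (x ^+ j).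
  have := is_deriveZ (j.+1%:R^-1) (@is_deriveX _ _ (id : R -> R) j.+1 x 1 1 (is_derive_id _ _)).
  rewrite (_ : _ \*: _ = (fun y => y ^+ j.+1 / j.+1%:R)); last first.
    by apply/funext => y; rewrite /= exprfctE /GRing.scale/= mulrC.
  by move=> h; apply: is_derive_eq h _; rewrite /GRing.scale/=; field.
have cD : continuous (fun y : R => y ^+ j.+1 / j.+1%:R).
  move=> x; apply: differentiable_continuous; apply/derivable1_diffP.
  by have [] := D x.
rewrite /Rintegral (@continuous_FTC2 _ (fun x => x ^+ j) (fun y => y ^+ j.+1 / j.+1%:R))//.
- by rewrite /= -mulrBl.
- by apply: continuous_subspaceT => x; exact: exprn_continuous.
- split; [by move=> x _; have [] := D x| |].
  + exact/cvg_at_right_filter/cD.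
  + exact/cvg_at_left_filter/cD.
- by move=> x _; rewrite derive1E; have [_ ->] := D x.
Qed.

Lemma cint_pow j s t : s <= t ->
  cintegral `[s, t] (fun x => x%:C ^+ j) = (t%:C ^+ j.+1 - s%:C ^+ j.+1) / j.+1%:R.
Proof.
move=> st; have E x : x%:C ^+ j = (x ^+ j)%:C by rewrite rmorphXn.
have -> : (t%:C ^+ j.+1 - s%:C ^+ j.+1) / j.+1%:R =
    ((t ^+ j.+1 - s ^+ j.+1) / j.+1%:R)%:C.
  by rewrite rmorphM rmorphB !rmorphXn fmorphV rmorph_nat.
rewrite /cintegral; apply: complexP => /=.
  by rewrite -rint_pow//; apply: eq_Rintegral => x _; rewrite E.
rewrite (@eq_Rintegral _ _ _ lebesgue_measure `[s, t] (cst 0)); last by move=> x _; rewrite E.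
by rewrite /cst rint_cst// mul0r.
Qed.

End section_of_hatP.

(** * Continuity *)

Section topologies.
Context {R : realType}.

(** Supremum topologies of initial topologies: the defining functions are
    continuous, and they detect continuity. *)
Lemma dcoef_continuous k : continuous (fun f : Gc R => f k).
Proof.
move=> f A fA.
apply: ((@cvg_sup (Gc R) nat (fun k => Topological.class
  (initial_topology (fun f : Gc R => f k))) (nbhs f) f _).1 _ k) => //.
exact: (@initial_continuous (Gc R) R[i] (fun f : Gc R => f k) f A fA).
Qed.

Lemma continuous_Gc (T : topologicalType) (F : T -> Gc R) :
  (forall k, continuous (fun t => F t k)) -> continuous F.
Proof.
move=> cF t; apply/(@cvg_sup (Gc R) nat (fun k => Topological.class
  (initial_topology (fun f : Gc R => f k)))).
move=> k; exact: (@continuous_comp_initial _ T R[i] (fun f : Gc R => f k) F (cF k)).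
Qed.

Lemma hat_integral_continuous w : continuous (@hat_integral R w).
Proof.
move=> g A gA.
apply: ((@cvg_sup (GX R) word (fun w => Topological.class
  (initial_topology (@hat_integral R w))) (nbhs g) g _).1 _ w) => //.
exact: (@initial_continuous (GX R) R[i] (@hat_integral R w) g A gA).
Qed.

Lemma giter_continuous w : continuous (fun g : GX R => giter g w).
Proof.
case: w => [|i w].
  by rewrite (_ : (fun g => _) = (fun=> 1))//; exact: cst_continuous.
have -> : (fun g : GX R => giter g (i :: w)) = hat_integral (exist _ (i :: w) isT) by [].
exact: hat_integral_continuous.
Qed.

Lemma continuous_GX (T : topologicalType) (F : T -> GX R) :
  (forall w, continuous (fun t => giter (F t) w)) -> continuous F.
Proof.
move=> cF t; apply/(@cvg_sup (GX R) word (fun w => Topological.class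
  (initial_topology (@hat_integral R w)))).
move=> w; exact: (@continuous_comp_initial _ T R[i] (@hat_integral R w) F (cF (val w))).
Qed.

Section continuous_families.
Variable T : topologicalType.
Implicit Types (F : T -> R[i]) (S : T -> seq nat -> R[i]).

Lemma continuous_addC F G : continuous F -> continuous G -> continuous (fun t => F t + G t).
Proof. by move=> cF cG t; exact: (cvgD (cF t) (cG t)). Qed.

Lemma continuous_mulC F G : continuous F -> continuous G -> continuous (fun t => F t * G t).
Proof. by move=> cF cG t; exact: (cvgM (cF t) (cG t)). Qed.

Lemma continuous_constC (c : R[i]) : continuous (fun _ : T => c).
Proof. exact: cst_continuous. Qed.

Lemma continuous_sumC n (F : nat -> T -> R[i]) :
  (forall j, (j < n)%N -> continuous (F j)) -> continuous (fun t => \sum_(j < n) F j t).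
Proof.
elim: n => [|n IH] Fn.
  by under eq_fun do rewrite big_ord0; exact: continuous_constC.
under eq_fun do rewrite big_ord_recr/=; apply: continuous_addC; last exact: Fn.
by apply: IH => j jn; apply: Fn; rewrite (ltn_trans jn).
Qed.

Lemma continuous_flow_coef S n : (forall w, continuous (fun t => S t w)) ->
  continuous (fun t => flow_coef (S t) n).
Proof.
elim/ltn_ind: n S => -[|n] IH S cS; first exact: cS.
under eq_fun do rewrite flow_coefS.
apply: (@continuous_sumC _
  (fun i t => (n.+1 - i)%:R * flow_coef (fun w => S t (i :: w)) (n - i))).
move=> i _; apply: continuous_mulC; first exact: continuous_constC.
apply: (IH _ _ (fun t w => S t (i :: w))) => [|w]; first by rewrite ltnS leq_subr.
exact: cS.
Qed.

Lemma continuous_ncmul S S' w : (forall w, continuous (fun t => S t w)) ->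
  (forall w, continuous (fun t => S' t w)) -> continuous (fun t => ncmul (S t) (S' t) w).
Proof.
move=> cS cS'; apply: (@continuous_sumC _ (fun k t => S t (take k w) * S' t (drop k w))).
by move=> k _; exact: continuous_mulC.
Qed.

(** The coefficients of the inverse of a noncommutative series are obtained
    from those of the series by finitely many ring operations. *)
Lemma continuous_ncinv S S' : (forall t, S t [::] = 1) ->
  (forall t, ncmul (S' t) (S t) =1 @ncone _) ->
  (forall w, continuous (fun t => S t w)) -> forall w, continuous (fun t => S' t w).
Proof.
move=> S1 SS cS w; elim: {w}(size w) {-2}w (leqnn (size w)) => [|n IH] w wn.
  rewrite (_ : (fun t => S' t w) = (fun=> 1)); first exact: continuous_constC.
  apply/funext => t; move: wn; rewrite leqn0 => /nilP ->.
  by have := SS t [::]; rewrite ncmul_nil S1 mulr1 /ncone eqxx.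
have -> : (fun t => S' t w) = (fun t => ncone w + (-1) *
    \sum_(k < size w) S' t (take k w) * S t (drop k w)).
  apply/funext => t; rewrite -(SS t w) /ncmul big_ord_recr/= take_size drop_size S1 mulr1.
  by ring.
apply: continuous_addC; first exact: continuous_constC.
apply: continuous_mulC; first exact: continuous_constC.
apply: (@continuous_sumC _ (fun k t => S' t (take k w) * S t (drop k w))) => k kw.
apply: continuous_mulC => //; apply: IH.
by rewrite size_take kw -ltnS (leq_trans kw).
Qed.

(** Functions that are polynomial in [x], with coefficients depending
    continuously on [t]. This class is generated by monomials so that products
    and primitives are obtained by induction. *)
Inductive poly_family : (T -> R -> R[i]) -> Prop :=
| poly_family_mono (Q : T -> R[i]) j : continuous Q -> poly_family (fun t x => Q t * x%:C ^+ j)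
| poly_family_add P P' : poly_family P -> poly_family P' ->
    poly_family (fun t x => P t x + P' t x).

Implicit Types P : T -> R -> R[i].

Lemma poly_family_cont (Q : T -> R[i]) : continuous Q -> poly_family (fun t _ => Q t).
Proof.
move=> cQ; rewrite (_ : (fun t _ => _) = (fun t (x : R) => Q t * x%:C ^+ 0)).
  exact: poly_family_mono.
by apply/funext => t; apply/funext => x; rewrite mulr1.
Qed.

Lemma poly_family_mul P P' : poly_family P -> poly_family P' ->
  poly_family (fun t x => P t x * P' t x).
Proof.
move=> pP pP'; elim: pP => [Q j cQ|P1 P2 _ IH1 _ IH2]; last first.
  under eq_fun do under eq_fun do rewrite mulrDl.
  exact: poly_family_add.
elim: pP' => [Q' j' cQ'|P1 P2 _ IH1 _ IH2]; last first.
  under eq_fun do under eq_fun do rewrite mulrDr.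
  exact: poly_family_add.
rewrite (_ : (fun t x => _) = (fun t x => (Q t * Q' t) * x%:C ^+ (j + j'))).
  by apply: poly_family_mono; exact: continuous_mulC.
by apply/funext => t; apply/funext => x; rewrite exprD; ring.
Qed.

Lemma poly_family_sum n (P : nat -> T -> R -> R[i]) :
  (forall j, (j < n)%N -> poly_family (P j)) ->
  poly_family (fun t x => \sum_(j < n) P j t x).
Proof.
elim: n => [|n IH] Pn.
  under eq_fun do under eq_fun do rewrite big_ord0.
  exact/poly_family_cont/continuous_constC.
under eq_fun do under eq_fun do rewrite big_ord_recr/=.
apply: poly_family_add; last exact: Pn.
by apply: IH => j jn; apply: Pn; rewrite (ltn_trans jn).
Qed.

Lemma loc_bounded_real : loc_bounded (fun x : R => x%:C).
Proof.
split; first by apply: cmeasurable_real; exact: measurable_id.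
by move=> C; exists C; apply: aeW => x xC; rewrite cmodR.
Qed.

Lemma poly_family_loc_bounded P t : poly_family P -> loc_bounded (P t).
Proof.
elim => [Q j _|P1 P2 _ IH1 _ IH2]; last exact: loc_boundedD.
apply: loc_boundedM; first exact: loc_bounded_cst.
exact: loc_bounded_exp loc_bounded_real.
Qed.

Lemma poly_family_cint P (b : R) : poly_family P -> exists2 P', poly_family P' &
  forall t s, s <= b -> cintegral `[s, b] (P t) = P' t s.
Proof.
elim => [Q j cQ|P1 P2 p1 [P1' q1 e1] p2 [P2' q2 e2]]; last first.
  exists (fun t x => P1' t x + P2' t x); first exact: poly_family_add.
  by move=> t s sb; rewrite cintD ?e1 ?e2//; exact: poly_family_loc_bounded.
exists (fun t s => Q t * (b%:C ^+ j.+1 / j.+1%:R) +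
    Q t * (- j.+1%:R^-1) * s%:C ^+ j.+1).
  apply: poly_family_add.
    exact: (poly_family_cont (continuous_mulC cQ (@continuous_constC _))).
  exact: (poly_family_mono j.+1 (continuous_mulC cQ (@continuous_constC _))).
move=> t s sb; rewrite cintZ ?cint_pow//; first by ring.
exact: loc_bounded_exp loc_bounded_real.
Qed.

Lemma poly_family_eval P (x : R) : poly_family P -> continuous (fun t => P t x).
Proof.
elim => [Q j cQ|P1 P2 _ IH1 _ IH2]; last exact: continuous_addC.
exact: (continuous_mulC cQ (@continuous_constC _)).
Qed.

End continuous_families.

Lemma poly_family_denom k : poly_family (fun (f : Gc R) x => denom f x k).
Proof.
case: k => [|k]; first exact/poly_family_cont/continuous_constC.
apply: poly_family_mul.
  apply: poly_family_cont; apply: continuous_mulC; first exact: continuous_constC.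
  exact: dcoef_continuous.
rewrite (_ : (fun f x => _) =
    (fun (f : Gc R) (x : R) => 1 + (- (2 * pi)%:C^-1) * x%:C ^+ 1)).
  apply: poly_family_add; first exact/poly_family_cont/continuous_constC.
  exact/poly_family_mono/continuous_constC.
apply/funext => f; apply/funext => x.
by rewrite rmorphB rmorph1 rmorphM fmorphV expr1; ring.
Qed.

Lemma poly_family_fquo i :
  poly_family (fun (f : Gc R) x => fquo (numer f) (denom f x) i).
Proof.
elim/ltn_ind: i => i IH.
under eq_fun do under eq_fun do rewrite fquoE.
apply: poly_family_add.
  apply: poly_family_cont; apply: continuous_mulC; last exact: continuous_constC.
  exact: dcoef_continuous.
under eq_fun do under eq_fun do rewrite -mulN1r.
apply: poly_family_mul; first exact/poly_family_cont/continuous_constC.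
apply: (@poly_family_sum _ _ (fun j (f : Gc R) x =>
  fquo (numer f) (denom f x) j * denom f x (i - j))) => j ji.
by apply: poly_family_mul; [exact: IH|exact: poly_family_denom].
Qed.

(** Iterated integrals of polynomials are polynomials in the endpoint. *)
Lemma poly_family_iterint w : exists2 P, poly_family P &
  forall (f : Gc R) s, 0 <= s <= 2 * pi -> iterint (a_of f) s w = P f s.
Proof.
elim: w => [|i w [P pP eP]].
  by exists (fun _ _ => 1) => //; exact/poly_family_cont/continuous_constC.
have pM := poly_family_mul (poly_family_fquo i) pP.
have [P' pP' eP'] := poly_family_cint (2 * pi) pM.
exists P' => // f s /andP[s0 s2]; rewrite -eP'// [LHS]/=.
apply: eq_cint_oo => //.
- apply: loc_boundedM; last exact: loc_bounded_iterint.
  exact: (loc_bounded_coef (a_of f)).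
- exact: poly_family_loc_bounded pM.
move=> x /andP[sx x2]; rewrite eP; last by rewrite (ltW x2) (le_trans s0)// ltW.
congr (_ * _); rewrite /= /a_fun /perext red_id//.
by rewrite (le_lt_trans s0)//= ltW.
Qed.

Lemma Tmap_continuous : continuous (@Tmap R).
Proof.
apply: continuous_GX => w; have [P pP eP] := poly_family_iterint w.
rewrite (_ : (fun f => _) = (fun f => P f 0)); first exact: poly_family_eval.
apply/funext => f; rewrite giter_classX eP// lexx mulr_ge0// ltW// pi_gt0//.
Qed.

Lemma hatP_continuous : continuous (@hatP R).
Proof.
apply: continuous_Gc => k.
rewrite (_ : (fun g => _) = (fun g => flow_coef (giter g) k.+1)).
  by apply: continuous_flow_coef; exact: giter_continuous.
by apply/funext => g; rewrite hatP_coef.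
Qed.

End topologies.

Section group.
Context {R : realType}.
Implicit Types (g h : GX R) (f : Gc R).

Definition invG g : GX R := classX (invX (reprX g)).

Lemma giter_mul_invG g : ncmul (giter g) (giter (invG g)) =1 @ncone _.
Proof.
move=> w; rewrite (eq_ncmul (frefl _) (giter_classX _)); exact: ncmul_inv_r.
Qed.

Lemma giter_invG_mul g : ncmul (giter (invG g)) (giter g) =1 @ncone _.
Proof.
move=> w; rewrite (eq_ncmul (giter_classX _) (frefl _)); exact: ncmul_inv_l.
Qed.

Lemma mulKG g h : mulG (invG g) (mulG g h) = h.
Proof.
apply: GX_eqP => w; rewrite giter_mulG (eq_ncmul (frefl _) (giter_mulG _ _)) -ncmulA.
by rewrite (eq_ncmul (giter_invG_mul g) (frefl _)) mul1nc.
Qed.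

Lemma mulVKG g h : mulG g (mulG (invG g) h) = h.
Proof.
apply: GX_eqP => w; rewrite giter_mulG (eq_ncmul (frefl _) (giter_mulG _ _)) -ncmulA.
by rewrite (eq_ncmul (giter_mul_invG g) (frefl _)) mul1nc.
Qed.

Lemma hatP_mulG g h : \forall r \near (0 : R[i]),
  Gc_eval (hatP (mulG g h)) r = Gc_eval (hatP h) (Gc_eval (hatP g) r).
Proof. by rewrite hatP_classX !hatPE; exact: return_map_cat. Qed.

Lemma Gc_eval_id (r : R[i]) : Gc_eval (@Gc_id R) r = r.
Proof.
rewrite /Gc_eval (_ : series _ = (fun=> 0)).
  by rewrite (cvg_lim (@complex_hausdorff R) (cvg_cst _)) addr0.
by apply/funext => n; rewrite /series/= big1// => k _; rewrite mul0r.
Qed.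

Lemma hatP_mulG_hatC g h : hatC h -> hatP (mulG g h) = hatP g.
Proof.
move=> hC; apply: Gc_eval_inj; have := hatP_mulG g h.
by apply: filterS => r ->; rewrite hC Gc_eval_id.
Qed.

Lemma hatP_mul_invG g : hatP (mulG (invG g) g) = @Gc_id R.
Proof.
apply: Gc_eqP => k; rewrite hatP_coef.
rewrite (@eq_flow_coef _ _ (@ncone _)) ?flow_coef_ncone//.
by move=> w; rewrite giter_mulG giter_invG_mul.
Qed.

(** Two elements with the same first return map [P] differ by an element of the
    kernel: the first return map of [h^-1 g] is [P] after that of [h^-1], like the
    first return map of [h^-1 h], which is the identity. *)
Lemma hatC_invG_mul g h : hatP g = hatP h -> hatC (mulG (invG h) g).
Proof.
move=> gh; apply: Gc_eval_inj.
have := hatP_mulG (invG h) g; have := hatP_mulG (invG h) h.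
by apply: filterS2 => r; rewrite hatP_mul_invG gh => <- ->.
Qed.

Lemma continuous_invG : continuous invG.
Proof.
apply: continuous_GX; apply: (@continuous_ncinv _ _ (fun g w => giter g w)) => //.
  exact: giter_invG_mul.
exact: giter_continuous.
Qed.

Lemma continuous_mulG (T : topologicalType) (F G : T -> GX R) :
  continuous F -> continuous G -> continuous (fun t => mulG (F t) (G t)).
Proof.
move=> cF cG; apply: continuous_GX => w; under eq_fun do rewrite giter_mulG.
apply: continuous_ncmul => u t.
  exact: (@continuous_comp T (GX R) R[i] F (fun g => giter g u) t (cF t)
    (@giter_continuous R u (F t))).
exact: (@continuous_comp T (GX R) R[i] G (fun g => giter g u) t (cG t)
  (@giter_continuous R u (G t))).
Qed.

End group.

Theorem theorem3p10 (R : realType) :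
  [/\ embedding (@Tmap R),
      (forall f : Gc R, hatP (Tmap f) = f) &
      homeomorphism (@Ttilde R)].
Proof.
split; last 2 first.
- exact: hatP_Tmap.
- have HC g : @hatC R (mulG (invG (Tmap (hatP g))) g).
    by apply: hatC_invG_mul; rewrite hatP_Tmap.
  pose K g : @hatC R := exist _ (mulG (invG (Tmap (hatP g))) g) (mem_set (HC g)).
  have TtildeP (p : Gc R * @hatC R) : hatP (Ttilde p) = p.1.
    case: p => f [h hC]; rewrite /Ttilde/= hatP_mulG_hatC ?hatP_Tmap//.
    exact: set_mem.
  exists (fun g => (hatP g, K g)); split.
  + move=> p; have := TtildeP p; case: p => f [h hC] /= TE.
    rewrite TE; congr (_, _); apply: val_inj => /=.
    by rewrite TE /Ttilde/= mulKG.
  + by move=> g; rewrite /Ttilde/= mulVKG.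
  + apply: continuous_mulG => p.
      apply: (continuous_comp (@cvg_fst _ _ _ _ _)); exact: Tmap_continuous.
    apply: (continuous_comp (@cvg_snd _ _ _ _ _)); exact: initial_continuous.
  + have cK : continuous K.
      apply: (@continuous_comp_initial _ (GX R) (GX R) set_val K).
      apply: (@continuous_mulG R (GX R) (fun g => invG (Tmap (hatP g))) id) => g.
        exact: (@continuous_comp (GX R) (Gc R) (GX R) hatP (@invG R \o @Tmap R) g
          (@hatP_continuous R g) (@continuous_comp (Gc R) (GX R) (GX R) (@Tmap R)
          (@invG R) _ (@Tmap_continuous R _) (@continuous_invG R _))).
      exact: cvg_id.
    move=> g; have := cvg_pair (@hatP_continuous R g) (cK g). exact.
split; [exact: can_inj (@hatP_Tmap R)|exact: Tmap_continuous|].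
move=> U oU; exists (@hatP R @^-1` U).
  by apply: open_comp => // g _; exact: hatP_continuous.
apply/seteqP; split => [_ [f Uf <-]|g [Ug [f _ fg]]].
  by split; [rewrite /= hatP_Tmap|exists f].
by exists f => //; move: Ug; rewrite -fg /= hatP_Tmap.
Qed.
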